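(* Let $(M,I,J,K,\Omega)$ be a compact HKT-manifold, $\dim_{\mathbb H}M=n$, whose Obata connection $\nabla$ has holonomy $\mathrm{Hol}(M)\subset SL(n,\mathbb H)$, and let $\Phi\in\Lambda^{2n,0}_I(M)$ be a non-zero section of the canonical bundle of $(M,I)$ which is parallel with respect to $\nabla$. Assume that the quaternionic Calabi–Yau conjecture holds for $M$, that is: for every nowhere degenerate, real and positive section $\Psi\in\Lambda^{2n,0}_I(M)$ there exist a constant $A>0$ and a real function $\phi\in C^\infty(M)$ such that $$\Psi=A(\Omega+\partial\partial_J\phi)^n .$$ Then $M$ admits an HKT-form $\Omega_1=\Omega+\partial\partial_J\phi$, for some real $\phi\in C^\infty(M)$, such that $\Omega_1^n$ is a holomorphic volume form on $(M,I)$. Moreover, in this case $\nabla(\Omega_1^n)=0$.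
   Context: Manifolds are connected. A hypercomplex manifold $(M,I,J,K)$ is a smooth manifold with three integrable almost complex structures satisfying $I^2=J^2=K^2=IJK=-\mathrm{Id}_{TM}$; $\dim_{\mathbb H}M=n$ means $\dim_{\mathbb R}M=4n$. A quaternionic Hermitian metric is a Riemannian metric $g$ invariant under $I,J,K$. Put $\omega_J=g(\cdot,J\cdot)$, $\omega_K=g(\cdot,K\cdot)$ and $\Omega=\omega_J+\sqrt{-1}\,\omega_K\in\Lambda^{2,0}_I(M)$ (Hodge type with respect to $I$). The metric is HKT, and $\Omega$ is an HKT-form, if $\partial\Omega=0$, where $\partial$ is the $(1,0)$-part of $d$ on $(M,I)$. An HKT-form means a form arising in this way from some quaternionic Hermitian metric. The Obata connection is the unique torsion-free connection on $TM$ preserving $I,J,K$; its holonomy lies in $GL(n,\mathbb H)$, and $SL(n,\mathbb H)$ is the commutator subgroup of $GL(n,\mathbb H)$. The operator $J$ is extended from $\Lambda^1(M)$ to $\Lambda^*(M)$ by multiplicativity, and $\partial_J:=J\circ\bar\partial\circ J:\Lambda^{p,q}_I(M)\to\Lambda^{p+1,q}_I(M)$, where $\bar\partial$ is the Dolbeault operator of $(M,I)$; on functions $\partial\partial_J\phi=\partial(J(\bar\partial\phi))$. A form $\eta\in\Lambda^{2p,0}_I(M)$ is real if $J(\bar\eta)=\eta$. A real nowhere degenerate section $\Psi\in\Lambda^{2n,0}_I(M)$ is positive if $\Psi=f\,\Omega^n$ with $f$ a positive function. A holomorphic volume form is a nowhere vanishing holomorphic section of $\Lambda^{2n,0}_I(M)$.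 *)

(* Defs.v *)
From HB Require Import structures.
From mathcomp Require Import all_boot all_order all_fingroup all_algebra.
From mathcomp Require Import all_classical all_reals all_analysis.
From mathcomp.real_closed Require Export complex.

Set Implicit Arguments.
Unset Strict Implicit.
Unset Printing Implicit Defensive.

Import Order.TTheory GRing.Theory Num.Theory.
Import numFieldNormedType.Exports.

Local Open Scope classical_set_scope.
Local Open Scope ring_scope.

(* On an open set of a finite-dimensional space this is the usual class [C^k]:
   all iterated directional derivatives of order at most [k] exist and are
   continuous. *)
Fixpoint Ck {R : realType} {V : normedModType R} (k : nat) (U : set V)
    (f : V -> R) : Prop :=
  (forall x, U x -> {for x, continuous f}) /\
  (if k is k'.+1 then
     forall v, (forall x, U x -> derivable f x v) /\ Ck k' U ('D_v f)
   else True).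

Definition smooth_on {R : realType} {V : normedModType R} (U : set V)
  (f : V -> R) : Prop := forall k, Ck k U f.

Section CkTheory.
Context {R : realType} {V : normedModType R}.
Implicit Types (U : set V) (f g : V -> R).

Lemma Ck_eq U f g k : open U -> (forall x, U x -> f x = g x) ->
  Ck k U f -> Ck k U g.
Proof.
move=> oU; elim: k f g => [|k IH] f g fg [cf df].
  split=> // x Ux; have nfg : \near x, f x = g x.
    by near=> y; apply: fg; near: y; exact: open_nbhs_nbhs.
  change (g @ x --> g x); rewrite -(fg x Ux).
  by apply: cvg_trans (cf _ Ux); apply: near_eq_cvg; exact: nfg.
have nfg x : U x -> \near x, f x = g x.
  by move=> Ux; near=> y; apply: fg; near: y; exact: open_nbhs_nbhs.
split=> [x Ux|v].
  change (g @ x --> g x); rewrite -(fg x Ux).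
  by apply: cvg_trans (cf _ Ux); apply: near_eq_cvg; exact: nfg.
have [dfv Cf] := df v; split=> [x Ux|].
  by apply: near_eq_derivable (dfv x Ux); exact: nfg.
apply: IH Cf => x Ux; apply: near_eq_derive; exact: nfg.
Unshelve. all: by end_near. Qed.

Lemma Ck_cst U (c : R) k : open U -> Ck k U (cst c).
Proof.
move=> oU; elim: k c => [|k IH] c; split=> //.
- by move=> x _; exact: cst_continuous.
- by move=> x _; exact: cst_continuous.
- move=> v; split=> [x _|]; first exact: derivable_cst.
  by apply: Ck_eq (IH 0) => // x _ /=; rewrite derive_cst.
Qed.

Lemma CkD U f g k : open U -> Ck k U f -> Ck k U g -> Ck k U (f \+ g).
Proof.
move=> oU; elim: k f g => [|k IH] f g [cf df] [cg dg].
  by split=> // x Ux; apply: continuousD; [exact: cf|exact: cg].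
split=> [x Ux|v]; first by apply: continuousD; [exact: cf|exact: cg].
have [dfv Cf] := df v; have [dgv Cg] := dg v; split=> [x Ux|].
  by apply: derivableD; [exact: dfv|exact: dgv].
apply: Ck_eq (IH _ _ Cf Cg) => // x Ux /=.
by rewrite -deriveD//; [exact: dfv|exact: dgv].
Qed.

Lemma CkW U f k : Ck k.+1 U f -> Ck k U f.
Proof.
elim: k f => [|k IH] f [cf df]; first by split.
by split=> // v; have [dfv Cf] := df v; split=> //; exact: IH.
Qed.

Lemma CkM U f g k : open U -> Ck k U f -> Ck k U g -> Ck k U (f \* g).
Proof.
move=> oU; elim: k f g => [|k IH] f g.
  move=> [cf _] [cg _]; split=> // x Ux.
  by apply: continuousM; [exact: cf|exact: cg].
move=> Cf1 Cg1; have [cf df] := Cf1; have [cg dg] := Cg1.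
split=> [x Ux|v]; first by apply: continuousM; [exact: cf|exact: cg].
have [dfv Cf] := df v; have [dgv Cg] := dg v; split=> [x Ux|].
  by apply: derivableM; [exact: dfv|exact: dgv].
have := CkD oU (IH _ _ (CkW Cf1) Cg) (IH _ _ (CkW Cg1) Cf).
apply: Ck_eq => // x Ux /=.
by rewrite deriveM//; [exact: dfv|exact: dgv].
Qed.

End CkTheory.

Record chart (R : realType) (m : nat) (M : topologicalType) := Chart {
  cdom : set M;
  ccod : set 'rV[R]_m;
  cfwd : M -> 'rV[R]_m;
  cbwd : 'rV[R]_m -> M;
  cdom_open : open cdom;
  ccod_open : open ccod;
  cfwd_cod : forall p, cdom p -> ccod (cfwd p);
  cbwd_dom : forall x, ccod x -> cdom (cbwd x);
  cfwdK : forall p, cdom p -> cbwd (cfwd p) = p;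
  cbwdK : forall x, ccod x -> cfwd (cbwd x) = x;
  cfwd_cont : forall p, cdom p -> {for p, continuous cfwd};
  cbwd_cont : forall x, ccod x -> {for x, continuous cbwd}
}.

Record manifold (R : realType) (m : nat) := Manifold {
  mpoint :> topologicalType;
  matlas : set (chart R m mpoint);
  matlas_cover : forall p, exists2 c, matlas c & cdom c p;
  matlas_smooth : forall c c', matlas c -> matlas c' -> forall i,
    smooth_on (ccod c `&` cbwd c @^-1` cdom c')
      (fun x => cfwd c' (cbwd c x) ord0 i);
  mhausdorff : hausdorff_space mpoint;
  msecond_countable : @second_countable mpoint;
  mnonempty : [set: mpoint] !=set0;
  mconnected : connected [set: mpoint]
}.

Section Functions.
Context {R : realType} {m : nat} (M : manifold R m).

Definition smooth (f : M -> R) : Prop :=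
  forall c, matlas c -> smooth_on (ccod c) (f \o cbwd c).

Definition csmooth (h : M -> R[i]) : Prop :=
  smooth (fun p => complex.Re (h p)) /\ smooth (fun p => complex.Im (h p)).

Lemma smooth_cst (a : R) : smooth (fun=> a).
Proof. by move=> c _ k; apply: Ck_cst; exact: ccod_open. Qed.

Lemma smoothD f g : smooth f -> smooth g -> smooth (fun p => f p + g p).
Proof.
by move=> sf sg c Mc k; apply: CkD (sf c Mc k) (sg c Mc k); exact: ccod_open.
Qed.

Lemma smoothM f g : smooth f -> smooth g -> smooth (fun p => f p * g p).
Proof.
by move=> sf sg c Mc k; apply: CkM (sf c Mc k) (sg c Mc k); exact: ccod_open.
Qed.

Lemma smoothB f g : smooth f -> smooth g -> smooth (fun p => f p - g p).
Proof.
move=> sf sg; have := smoothD sf (smoothM (smooth_cst (-1)) sg).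
by congr smooth; apply/funext => p; rewrite mulN1r.
Qed.

Definition smooth_pred : {pred M -> R} := fun f => `[< smooth f >].
Definition csmooth_pred : {pred M -> R[i]} := fun f => `[< csmooth f >].

Lemma smooth_subring : subring_closed smooth_pred.
Proof.
split=> [|f g|f g].
- by apply/asboolP; exact: smooth_cst.
- by move=> /asboolP sf /asboolP sg; apply/asboolP; exact: smoothB.
- by move=> /asboolP sf /asboolP sg; apply/asboolP; exact: smoothM.
Qed.

Lemma csmooth_subring : subring_closed csmooth_pred.
Proof.
split=> [|f g|f g].
- by apply/asboolP; split; exact: smooth_cst.
- move=> /asboolP[sf sf'] /asboolP[sg sg']; apply/asboolP; split.
    have := smoothB sf sg; congr smooth; apply/funext => p /=.
    by rewrite [(f - g) p]/(f p - g p) raddfB.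
  have := smoothB sf' sg'; congr smooth; apply/funext => p /=.
  by rewrite [(f - g) p]/(f p - g p) raddfB.
- move=> /asboolP[sf sf'] /asboolP[sg sg']; apply/asboolP; split.
    have := smoothB (smoothM sf sg) (smoothM sf' sg').
    congr smooth; apply/funext => p /=.
    by rewrite [(f * g) p]/(f p * g p); case: (f p) (g p) => a b [].
  have := smoothD (smoothM sf sg') (smoothM sf' sg).
  congr smooth; apply/funext => p /=.
  by rewrite [(f * g) p]/(f p * g p); case: (f p) (g p) => a b [].
Qed.

HB.instance Definition _ :=
  GRing.isSubringClosed.Build (M -> R) smooth_pred smooth_subring.
HB.instance Definition _ :=
  GRing.isSubringClosed.Build (M -> R[i]) csmooth_pred csmooth_subring.

Record cinf := Cinf { cinf_val :> M -> R; _ : cinf_val \in smooth_pred }.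
HB.instance Definition _ := [isSub for cinf_val].
HB.instance Definition _ := [Choice of cinf by <:].
HB.instance Definition _ := GRing.SubChoice_isSubComPzRing.Build
  (M -> R) smooth_pred cinf smooth_subring.

Record ccinf := CCinf { ccinf_val :> M -> R[i]; _ : ccinf_val \in csmooth_pred }.
HB.instance Definition _ := [isSub for ccinf_val].
HB.instance Definition _ := [Choice of ccinf by <:].
HB.instance Definition _ := GRing.SubChoice_isSubComPzRing.Build
  (M -> R[i]) csmooth_pred ccinf csmooth_subring.

Lemma cinfP (f : cinf) : smooth f.
Proof. by case: f => f /= /asboolP. Qed.

Lemma ccinfP (h : ccinf) : csmooth h.
Proof. by case: h => h /= /asboolP. Qed.

Definition cst_cinf (a : R) : cinf := Cinf (asboolT (smooth_cst a)).

Definition re_cinf (h : ccinf) : cinf := Cinf (asboolT (proj1 (ccinfP h))).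
Definition im_cinf (h : ccinf) : cinf := Cinf (asboolT (proj2 (ccinfP h))).

Lemma csmooth_mk (u v : cinf) : csmooth (fun p => u p +i* v p)%C.
Proof. by split; exact: cinfP. Qed.

(* [mk_ccinf u v] is [u + sqrt(-1) v]. *)
Definition mk_ccinf (u v : cinf) : ccinf := CCinf (asboolT (csmooth_mk u v)).
Definition toC (u : cinf) : ccinf := mk_ccinf u 0.
Definition iC : ccinf := mk_ccinf 0 1.
Definition conjC (h : ccinf) : ccinf := mk_ccinf (re_cinf h) (- im_cinf h).

End Functions.

Section Tangent.
Context {R : realType} {m : nat} {M : manifold R m}.

Definition is_derivation_at (p : M) (v : cinf M -> R^o) : Prop :=
  [/\ forall f g, v (f + g) = v f + v g,
      forall a f, v (cst_cinf M a * f) = a * v f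
    & forall f g, v (f * g) = f p * v g + g p * v f].

Definition derivation_at_pred p : {pred cinf M -> R^o} :=
  fun v => `[< is_derivation_at p v >].

Lemma derivation_at_submod p : submod_closed (derivation_at_pred p).
Proof.
split.
  apply/asboolP; split=> [f g|a f|f g]; rewrite [LHS]/(0 : R).
  - by rewrite [RHS]addr0.
  - by rewrite [RHS]mulr0.
  - by rewrite [_ * _ in RHS]mulr0 mulr0 addr0.
move=> a u v /asboolP[uD uZ uM] /asboolP[vD vZ vM].
have E f : (a *: u + v) f = a * u f + v f by [].
apply/asboolP; split=> [f g|b f|f g]; rewrite !E.
- by rewrite uD vD mulrDr addrACA.
- by rewrite uZ vZ mulrDr mulrCA.
- by rewrite uM vM !mulrDr (mulrCA a (f p)) (mulrCA a (g p)) addrACA.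
Qed.

HB.instance Definition _ p := GRing.isSubmodClosed.Build R (cinf M -> R^o)
  (derivation_at_pred p) (derivation_at_submod p).

Record tangent (p : M) := Tangent {
  tangent_val :> cinf M -> R^o; _ : tangent_val \in derivation_at_pred p }.
HB.instance Definition _ p := [isSub for @tangent_val p].
HB.instance Definition _ p := [Choice of tangent p by <:].
HB.instance Definition _ p := [SubChoice_isSubLmodule of tangent p by <:].

(* Smooth vector fields are identified with derivations of [C^oo(M)]; they
   form a module over [C^oo(M)]. *)
Definition is_derivation (X : cinf M -> (cinf M)^o) : Prop :=
  [/\ forall f g, X (f + g) = X f + X g,
      forall a f, X (cst_cinf M a * f) = cst_cinf M a * X f
    & forall f g, X (f * g) = f * X g + g * X f].

Definition derivation_pred : {pred cinf M -> (cinf M)^o} :=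
  fun X => `[< is_derivation X >].

Lemma derivation_submod : submod_closed derivation_pred.
Proof.
split.
  apply/asboolP; split=> [f g|a f|f g]; rewrite [LHS]/(0 : cinf M).
  - by rewrite [RHS]addr0.
  - by rewrite [RHS]mulr0.
  - by rewrite [_ * _ in RHS]mulr0 mulr0 addr0.
move=> a u v /asboolP[uD uZ uM] /asboolP[vD vZ vM].
have E f : (a *: u + v) f = a * u f + v f by [].
apply/asboolP; split=> [f g|b f|f g]; rewrite !E.
- by rewrite uD vD mulrDr addrACA.
- by rewrite uZ vZ mulrDr mulrCA.
- by rewrite uM vM !mulrDr (mulrCA a f) (mulrCA a g) addrACA.
Qed.

HB.instance Definition _ := GRing.isSubmodClosed.Build (cinf M)
  (cinf M -> (cinf M)^o) derivation_pred derivation_submod.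

Record vfield := VField {
  vfield_val :> cinf M -> (cinf M)^o; _ : vfield_val \in derivation_pred }.
HB.instance Definition _ := [isSub for vfield_val].
HB.instance Definition _ := [Choice of vfield by <:].
HB.instance Definition _ := [SubChoice_isSubLmodule of vfield by <:].

Lemma vfieldP (X : vfield) : is_derivation X.
Proof. by case: X => X /= /asboolP. Qed.

Lemma vat_subproof (X : vfield) (p : M) : is_derivation_at p (fun f => X f p).
Proof.
by have [XD XZ XM] := vfieldP X; split=> *; rewrite ?XD ?XZ ?XM.
Qed.

Definition vat (X : vfield) (p : M) : tangent p :=
  Tangent (asboolT (vat_subproof X p)).

Lemma bracket_subproof (X Y : vfield) : is_derivation (fun f => X (Y f) - Y (X f)).
Proof.
have [XD XZ XM] := vfieldP X; have [YD YZ YM] := vfieldP Y.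
split=> [f g|a f|f g].
- by rewrite YD XD XD YD opprD addrACA.
- by rewrite YZ XZ XZ YZ mulrBr.
- have E (a b c d a' c' : cinf M) :
      a + b + (c + d) - (a' + d + (c' + b)) = (a - a') + (c - c').
    rewrite (_ : a + b + (c + d) = a + c + (b + d)); last exact: addrACA.
    rewrite (_ : a' + d + (c' + b) = a' + c' + (b + d)); last first.
      by rewrite addrACA (addrC d).
    by rewrite opprD [LHS]addrACA subrr addr0 opprD [LHS]addrACA.
  rewrite YM XM XD YD !XM !YM (mulrC (X g)) (mulrC (X f)) E.
  by rewrite !mulrBr.
Qed.

Definition bracket (X Y : vfield) : vfield := VField (asboolT (bracket_subproof X Y)).

End Tangent.

Arguments vfield {R m} M.

Section Forms.
Context {R : realType} {m : nat} {M : manifold R m}.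

(* Tensor fields are given by their values on smooth vector fields: a
   complex-valued [k]-form is an alternating [C^oo(M)]-multilinear map from
   vector fields to [C^oo(M, C)].  [cform k] is the type of the underlying
   maps, [is_form] the condition. *)
Definition cform (k : nat) := ('I_k -> vfield M) -> ccinf M.

Definition is_form k (eta : cform k) : Prop :=
  (forall (X : 'I_k -> vfield M) i (f : cinf M) (Y Z : vfield M),
     eta [eta X with i |-> f *: Y + Z] =
     toC f * eta [eta X with i |-> Y] + eta [eta X with i |-> Z]) /\
  (forall (X : 'I_k -> vfield M) i j, i != j -> X i = X j -> eta X = 0).

Definition nowhere_zero k (eta : cform k) : Prop :=
  forall p : M, exists X, eta X p != 0.

Definition form_add k (a b : cform k) : cform k := fun X => a X + b X.

Definition form0 (h : ccinf M) : cform 0 := fun=> h.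

Definition wedge p q (a : cform p) (b : cform q) : cform (p + q) := fun X =>
  toC (cst_cinf M (p`! * q`!)%:R^-1) *
  \sum_(s : 'S_(p + q)) (-1) ^+ s *
    (a (fun i => X (s (lshift q i))) * b (fun j => X (s (rshift p j)))).

Fixpoint wedge_pow (w : cform 2) (n : nat) : cform n.*2 :=
  match n return cform n.*2 with
  | 0 => form0 1
  | n'.+1 => wedge w (@wedge_pow w n')
  end.

Definition conj_form k (eta : cform k) : cform k := fun X => conjC (eta X).

Definition vact (X : vfield M) (h : ccinf M) : ccinf M :=
  mk_ccinf (X (re_cinf h)) (X (im_cinf h)).

(* Cartan's formula.  In the second sum the bracket stands in position [i]
   instead of in front, whence the sign [(-1)^j] instead of [(-1)^(i+j)]. *)
Definition ext_d k (eta : cform k) : cform k.+1 := fun X =>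
  \sum_(i < k.+1) (-1) ^+ i * vact (X i) (eta (fun l => X (lift i l))) +
  \sum_(i < k.+1) \sum_(j < k.+1 | (i < j)%N) (-1) ^+ j *
    eta (fun l => if lift j l == i then bracket (X i) (X j) else X (lift j l)).

(* A complex vector field [X + sqrt(-1) Y] is the pair [(X, Y)], and [cext eta]
   is the complex-multilinear extension of [eta]. *)
Definition cvfield := (vfield M * vfield M)%type.

Definition cbracket (Z W : cvfield) : cvfield :=
  (bracket Z.1 W.1 - bracket Z.2 W.2, bracket Z.1 W.2 + bracket Z.2 W.1).

Definition cext k (eta : cform k) (Z : 'I_k -> cvfield) : ccinf M :=
  \sum_(S : {set 'I_k}) iC M ^+ #|S| *
    eta (fun j => if j \in S then (Z j).2 else (Z j).1).

End Forms.

Arguments cform {R m} M k.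
Arguments wedge_pow {R m M} w n X : rename.
Arguments cvfield {R m} M.

Section Hodge.
Context {R : realType} {m : nat} {M : manifold R m}.

Notation endo := {linear vfield M -> vfield M}.
Implicit Types I J K : endo.

Definition T10 I (Z : cvfield M) : Prop := I Z.1 = - Z.2 /\ I Z.2 = Z.1.

(* Formal integrability: [T^{1,0}] is involutive. *)
Definition integrable I : Prop :=
  forall Z W, T10 I Z -> T10 I W -> T10 I (cbracket Z W).

Definition half : cinf M := cst_cinf M 2^-1.

Definition proj10 I (X : vfield M) : cvfield M := (half *: X, - (half *: I X)).
Definition proj01 I (X : vfield M) : cvfield M := (half *: X, half *: I X).

(* The component of [eta] in [Lambda^{p,k-p}], obtained by splitting every
   argument [X] as [X^{1,0} + X^{0,1}]. *)
Definition hodge_part I (p : nat) k (eta : cform M k) : cform M k := fun X =>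
  \sum_(T : {set 'I_k} | #|T| == p)
    cext eta (fun j => if j \in T then proj10 I (X j) else proj01 I (X j)).

Definition hodge_type I (p q : nat) k (eta : cform M k) : Prop :=
  [/\ (p + q = k)%N, is_form eta & forall X, hodge_part I p eta X = eta X].

(* The (1,0)- and (0,1)-parts of [d]. *)
Definition del I k (eta : cform M k) : cform M k.+1 := fun X =>
  \sum_(p < k.+1) hodge_part I p.+1 (ext_d (hodge_part I p eta)) X.

Definition delbar I k (eta : cform M k) : cform M k.+1 := fun X =>
  \sum_(p < k.+1) hodge_part I p (ext_d (hodge_part I p eta)) X.

(* Convention on 1-forms: [(J eta)(X) = eta(J X)].  The other convention
   [- eta(J X)] changes [ddJ] below only by a sign. *)
Definition act_form J k (eta : cform M k) : cform M k :=
  fun X => eta (fun i => J (X i)).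

Definition del_J I J k (eta : cform M k) : cform M k.+1 :=
  act_form J (delbar I (act_form J eta)).

Definition ddJ I J (phi : cinf M) : cform M 2 :=
  del I (del_J I J (form0 (toC phi))).

Definition real_form J k (eta : cform M k) : Prop :=
  forall X, act_form J (conj_form eta) X = eta X.

Definition hypercomplex I J K : Prop :=
  [/\ integrable I, integrable J, integrable K
    & forall X, [/\ I (I X) = - X, J (J X) = - X, K (K X) = - X
                  & I (J (K X)) = - X]].

Definition riemannian (g : vfield M -> vfield M -> cinf M) : Prop :=
  [/\ forall (f : cinf M) X Y Z, g (f *: X + Y) Z = f * g X Z + g Y Z,
      forall X Y, g X Y = g Y X
    & forall X (p : M), 0 <= g X X p /\ (g X X p = 0 -> vat X p = 0)].

Definition quaternionic_hermitian I J K (g : vfield M -> vfield M -> cinf M) :=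
  riemannian g /\
  forall X Y, [/\ g (I X) (I Y) = g X Y, g (J X) (J Y) = g X Y
                & g (K X) (K Y) = g X Y].

Definition Omega_of J K (g : vfield M -> vfield M -> cinf M) : cform M 2 :=
  fun X => mk_ccinf (g (X ord0) (J (X ord_max))) (g (X ord0) (K (X ord_max))).

Definition HKT_form I J K (Omega : cform M 2) : Prop :=
  exists g, [/\ quaternionic_hermitian I J K g,
                forall X, Omega X = Omega_of J K g X
              & forall X, del I Omega X = 0].

Definition positive (Omega : cform M 2) n (Psi : cform M n.*2) : Prop :=
  exists2 f : cinf M, (forall p, 0 < f p)
    & forall X, Psi X = toC f * wedge_pow Omega n X.

Definition holomorphic_volume_form I n (Psi : cform M n.*2) : Prop :=
  [/\ hodge_type I n.*2 0 Psi, nowhere_zero Psi & forall X, delbar I Psi X = 0].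

Definition quaternionic_Calabi_Yau I J (Omega : cform M 2) (n : nat) : Prop :=
  forall Psi : cform M n.*2,
    hodge_type I n.*2 0 Psi -> nowhere_zero Psi -> real_form J Psi ->
    positive Omega Psi ->
    exists (A : R) (phi : cinf M), 0 < A /\
      forall X, Psi X = toC (cst_cinf M A) *
        wedge_pow (form_add Omega (ddJ I J phi)) n X.

Definition connection (D : vfield M -> vfield M -> vfield M) : Prop :=
  [/\ forall (f : cinf M) X Y Z, D (f *: X + Y) Z = f *: D X Z + D Y Z,
      forall X Y Z, D X (Y + Z) = D X Y + D X Z
    & forall (f : cinf M) X Y, D X (f *: Y) = (X f : cinf M) *: Y + f *: D X Y].

Definition torsion_free (D : vfield M -> vfield M -> vfield M) : Prop :=
  forall X Y, D X Y - D Y X = bracket X Y.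

Definition obata I J K (D : vfield M -> vfield M -> vfield M) : Prop :=
  [/\ connection D, torsion_free D
    & forall X Y, [/\ D X (I Y) = I (D X Y), D X (J Y) = J (D X Y)
                    & D X (K Y) = K (D X Y)]].

Definition nabla_form (D : vfield M -> vfield M -> vfield M) k
    (X : vfield M) (eta : cform M k) : cform M k := fun Y =>
  vact X (eta Y) - \sum_(i < k) eta [eta Y with i |-> D X (Y i)].

Definition parallel_form D k (eta : cform M k) : Prop :=
  forall X Y, nabla_form D X eta Y = 0.

Definition smooth_path (c : R -> M) : Prop :=
  forall f : cinf M, smooth_on (V := R^o) setT (f \o c).

Definition velocity_at (c : R -> M) (t : R) (v : tangent (c t)) : Prop :=
  forall f : cinf M, v f = derive1 (f \o c : R -> R^o) t.

(* [w] is the parallel transport of [v] along [c] restricted to [0, 1]: there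
   is a parallel vector field [t |-> \sum_i a_i(t) V_i(c(t))] along [c] from
   [v] to [w].  Every smooth vector field along [c] is of this form on [0, 1],
   with covariant derivative [\sum_i (a_i' V_i + a_i D_(c') V_i)]. *)
Definition parallel_transport (D : vfield M -> vfield M -> vfield M)
    (c : R -> M) (v : tangent (c 0)) (w : tangent (c 1)) : Prop :=
  exists (N : nat) (a : 'I_N -> R -> R) (V : 'I_N -> vfield M),
  [/\ forall i, smooth_on (V := R^o) setT (a i),
      v = \sum_(i < N) a i 0 *: vat (V i) (c 0),
      w = \sum_(i < N) a i 1 *: vat (V i) (c 1)
    & forall t : R, 0 <= t <= 1 ->
      exists2 Y : vfield M, velocity_at (vat Y (c t))
        & \sum_(i < N) (derive1 (a i : R -> R^o) t *: vat (V i) (c t) +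
                        a i t *: vat (D Y (V i)) (c t)) = 0].

(* Composing transports along smooth paths gives piecewise smooth paths, so
   [transport] at [p = q] already ranges over a group. *)
Inductive transport (D : vfield M -> vfield M -> vfield M) (p : M) :
    forall q : M, (tangent p -> tangent q) -> Prop :=
| transport_id : transport D (@id (tangent p))
| transport_step (c : R -> M) (A : tangent p -> tangent (c 0))
    (B : tangent (c 0) -> tangent (c 1)) :
    transport D A -> smooth_path c ->
    (forall v, parallel_transport D v (B v)) -> transport D (B \o A).

Definition holonomy D (p : M) (A : tangent p -> tangent p) : Prop :=
  transport D A.

(* The group of automorphisms of [T_p M] commuting with [I], [J], [K], which is
   [GL(n, H)] when [M] has quaternionic dimension [n]. *)
Definition GLH I J K (p : M) (A : tangent p -> tangent p) : Prop :=
  [/\ linear A, bijective A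
    & forall X Y, A (vat X p) = vat Y p ->
      [/\ A (vat (I X) p) = vat (I Y) p, A (vat (J X) p) = vat (J Y) p
        & A (vat (K X) p) = vat (K Y) p]].

Inductive SLH I J K (p : M) : (tangent p -> tangent p) -> Prop :=
| SLH_id : SLH I J K (@id (tangent p))
| SLH_comm (A A' B B' : tangent p -> tangent p) :
    GLH I J K A -> GLH I J K B ->
    cancel A A' -> cancel A' A -> cancel B B' -> cancel B' B ->
    SLH I J K (A \o B \o A' \o B')
| SLH_comp (A B : tangent p -> tangent p) :
    SLH I J K A -> SLH I J K B -> SLH I J K (A \o B).

End Hodge.

(* Main.v *)
Require Import Defs.
From HB Require Import structures.
From mathcomp Require Import all_boot all_order all_fingroup all_algebra.
From mathcomp Require Import all_classical all_reals all_analysis.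
From mathcomp Require Import zify ring lra.
Import Order.TTheory GRing.Theory Num.Theory.
Import numFieldNormedType.Exports.
Local Open Scope classical_set_scope.
Local Open Scope ring_scope.
Set Implicit Arguments.
Unset Strict Implicit.
Unset Printing Implicit Defensive.

(** Write [nabla] for the Obata connection and [w] for [Omega ^ n].  A form of
    type [(2n, 0)] is a multiple of [w], so [Phi = h w] and
    [nabla_X w = theta(X) w], where [theta] is real because [w] is.  Since [Phi]
    is parallel, [h] solves the real linear equation [X h = - theta(X) h], and so
    does the real function [f = Re (conj (h p0) h)], with [p0] a point where
    [Phi] is not zero.  A solution that vanishes at one point of a connected
    manifold vanishes identically ([linear_transport_unique]); as [f] is positive
    at [p0], it is positive everywhere, and [Psi = f w] is parallel
    ([positive_parallel_multiple]).

    The Calabi-Yau hypothesis for [Psi] gives [Psi = A (Omega + ddJ phi) ^ n].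
    Put [Omega1 = Omega + ddJ phi].  Its top power is parallel, and [delbar] is
    computed by antisymmetrizing [nabla] for any torsion-free connection that
    preserves [I] ([delbar_nabla]), so this power is a holomorphic volume form.

    It remains that [Omega1] is an HKT-form.  The form [ddJ phi] comes from the
    [nabla]-Hessian of [phi] averaged over [1, I, J, K] ([ddJ_qhessian]), so
    [Omega1] comes from a symmetric form [g1] invariant under the quaternions.
    It is [del]-closed because [del] squares to zero on 1-forms of type (1,0), by
    the first Bianchi identity ([del_del_one_form]).  The form [g1] is
    non-degenerate since the top power of [Omega1] vanishes nowhere
    ([power_nondegenerate]), and at a minimum of [phi] it is positive, the
    Hessian being nonnegative there; since the index of a non-degenerate form on
    a connected manifold is constant, [g1] is a metric
    ([nonnegative_everywhere], [hermitian_perturbation]).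

    Conversely, let [Omega1] be any HKT-form of this shape whose top power is
    holomorphic.  This power is [f Psi] with [f] real and [Psi] parallel as above,
    so holomorphy says that the (0,1)-derivative of [f] vanishes; as [f] is real,
    it is constant and [f Psi] is parallel ([holomorphic_multiple_parallel]).

    The calculus underneath takes vector fields to be derivations.
    Hadamard's lemma and bump functions provide local frames ([local_frame]),
    whence expressions linear over the functions depend only on values at a
    point ([tensor_vanish]). *)

(** * Functions of class C^k *)

Lemma continuous_sum_at {R : realType} (T : topologicalType) (I : Type) (r : seq I)
    (F : I -> T -> R) x : (forall i, {for x, continuous (F i)}) ->
  {for x, continuous (fun y => \sum_(i <- r) F i y)}.
Proof.
move=> cF; elim: r => [|i r IH].
  rewrite (_ : (fun y => _) = fun=> 0); first exact: cst_continuous.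
  by apply/funext => y; rewrite big_nil.
rewrite (_ : (fun y => _) = (F i \+ fun y => \sum_(j <- r) F j y)).
  by apply: continuousD => //; exact: cF.
by apply/funext => y; rewrite big_cons.
Qed.

Section CkExtra.
Context {R : realType} {V : normedModType R}.
Implicit Types (U W : set V) (f g : V -> R).

Lemma Ck_sub U W f k : W `<=` U -> Ck k U f -> Ck k W f.
Proof.
move=> WU; elim: k f => [|k IH] f [cf df]; split=> //.
- by move=> x /WU; exact: cf.
- by move=> x /WU; exact: cf.
- move=> v; have [dv Cv] := df v; split; last exact: IH.
  by move=> x /WU; exact: dv.
Qed.

Lemma Ck_cont U f k : Ck k U f -> forall x, U x -> {for x, continuous f}.
Proof. by case: k => [|k] []. Qed.

Lemma Ck_local U f k :
  (forall x, U x -> exists W, [/\ open W, W x & Ck k W f]) -> Ck k U f.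
Proof.
elim: k f => [|k IH] f loc.
  by split=> // x /loc[W [_ Wx]] /Ck_cont; exact.
split=> [x /loc[W [_ Wx]] /Ck_cont|v]; first exact.
split=> [x /loc[W [_ Wx]] [_ /(_ v)[+ _]]|]; first exact.
by apply: IH => x /loc[W [oW Wx [_ /(_ v)[_ Cf]]]]; exists W.
Qed.

Lemma CkN U f k : open U -> Ck k U f -> Ck k U (fun x => - f x).
Proof.
move=> oU Cf; have := CkM oU (Ck_cst (-1) k oU) Cf.
by apply: Ck_eq => // x _; rewrite /= mulN1r.
Qed.

Lemma CkB U f g k : open U -> Ck k U f -> Ck k U g ->
  Ck k U (fun x => f x - g x).
Proof. by move=> oU Cf Cg; exact: CkD oU Cf (CkN oU Cg). Qed.

Lemma Ck_sum (I : Type) (r : seq I) (P : pred I) (F : I -> V -> R) U k :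
  open U -> (forall i, P i -> Ck k U (F i)) ->
  Ck k U (fun x => \sum_(i <- r | P i) F i x).
Proof.
move=> oU CF; elim: r => [|i r IH].
  by apply: Ck_eq (Ck_cst 0 k oU) => // x _; rewrite big_nil.
case Pi: (P i); last by apply: Ck_eq IH => // x _; rewrite big_cons Pi.
by apply: Ck_eq (CkD oU (CF i Pi) IH) => // x _; rewrite big_cons Pi.
Qed.

Lemma Ck_prod (I : Type) (r : seq I) (P : pred I) (F : I -> V -> R) U k :
  open U -> (forall i, P i -> Ck k U (F i)) ->
  Ck k U (fun x => \prod_(i <- r | P i) F i x).
Proof.
move=> oU CF; elim: r => [|i r IH].
  by apply: Ck_eq (Ck_cst 1 k oU) => // x _; rewrite big_nil.
case Pi: (P i); last by apply: Ck_eq IH => // x _; rewrite big_cons Pi.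
by apply: Ck_eq (CkM oU (CF i Pi) IH) => // x _; rewrite big_cons Pi.
Qed.

Lemma CkV U f k : open U -> (forall x, U x -> f x != 0) -> Ck k U f ->
  Ck k U (fun x => (f x)^-1).
Proof.
move=> oU f0; elim: k => [|k IH] Cf.
  by split=> // x Ux; apply: continuousV; [exact: f0|exact: Ck_cont Cf x Ux].
split=> [x Ux|v].
  by apply: continuousV; [exact: f0|exact: Ck_cont Cf x Ux].
have [dv Cv] := (proj2 Cf) v; split=> [x Ux|].
  by apply: derivableV; [exact: f0|exact: dv].
have CV := IH (CkW Cf).
apply: Ck_eq (CkN oU (CkM oU (CkM oU CV CV) Cv)) => // x Ux.
by rewrite deriveV ?f0//; [rewrite /= -invfM -expr2 scaleNr|exact: dv].
Qed.

End CkExtra.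

Lemma derive_derive1 {R : realType} {V W : normedModType R} (w : V -> W) (x v : V) :
  'D_v w x = derive1 (fun h : R => w (h *: v + x)) 0.
Proof.
rewrite derive1E /derive; set g1 := fun h => h^-1 *: _.
set g2 := fun h => h^-1 *: _; suff -> : g1 = g2 by [].
by apply/funext => h; rewrite /g1 /g2 /= addr0 scale0r add0r [_%:A]mulr1.
Qed.

Lemma Ck_comp1 {R : realType} {V : normedModType R} (U : set V) (u : V -> R)
    (psi : R -> R) k :
  open U -> Ck k U u -> Ck (V := R^o) k setT psi -> Ck k U (psi \o u).
Proof.
move=> oU; elim: k psi => [|k IH] psi Cu Cpsi.
  split=> // x Ux; apply: continuous_comp; first exact: Ck_cont Cu x Ux.
  exact: Ck_cont Cpsi _ I.
have H v x : U x -> is_derive x v (psi \o u) (('D_(1 : R^o) psi) (u x) * 'D_v u x).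
  move=> Ux; have [_ /(_ 1)[/(_ (u x) I) dpsi _]] := Cpsi.
  have [_ /(_ v)[/(_ x Ux) du _]] := Cu.
  have/derivable1P/derivable1_diffP du' := du.
  have dpsi' : differentiable (psi : R^o -> R^o) (u (0 *: v + x)).
    by rewrite scale0r add0r; exact/derivable1_diffP.
  have dc := differentiable_comp du' dpsi'.
  apply: DeriveDef; first by apply/derivable1P/derivable1_diffP.
  rewrite derive_derive1 (@derive1_comp _ (fun h : R => u (h *: v + x)) psi 0).
  - by rewrite scale0r add0r derive1E -derive_derive1.
  - exact/derivable1_diffP.
  - exact/derivable1_diffP.
split=> [x Ux|v].
  apply: continuous_comp; first exact: Ck_cont Cu x Ux.
  exact: Ck_cont Cpsi _ I.
split=> [x Ux|]; first exact: (@ex_derive _ _ _ _ _ _ _ (H v x Ux)).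
have Cd := proj2 ((proj2 Cpsi) 1).
apply: Ck_eq (CkM oU (IH _ (CkW Cu) Cd) (proj2 ((proj2 Cu) v))) => // x Ux.
by rewrite (@derive_val _ _ _ _ _ _ _ (H v x Ux)).
Qed.

Lemma differentiable_bound {R : realFieldType} (V W : normedModType R)
    (f : V -> W) (L : {linear V -> W}) x : continuous L ->
  (forall e : R, 0 < e ->
     exists2 d, 0 < d & forall k, `|k| <= d -> `|f (k + x) - f x - L k| <= e * `|k|) ->
  differentiable f x /\ 'd f x = L :> (V -> W).
Proof.
move=> cL H; have dE : f \o shift x = cst (f x) + L +o_ 0 id.
  apply/eqaddoP => e e0; have [d d0 Hd] := H e e0.
  rewrite near_simpl /=; near=> k; have kd : `|k| <= d.
    by near: k; exact: nbhs0_le.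
  by have := Hd k kd; rewrite !fctE /= opprD addrA.
have dfE : 'd f x = L :> (_ -> _) by exact: diff_unique cL dE.
by split=> //; apply/diff_locallyP; rewrite dfE.
Unshelve. all: by end_near. Qed.

Section ChainRule.
Context {R : realType}.

Lemma derive_line {V : normedModType R} (f : V -> R) (y v : V) (t : R) :
  derivable f (t *: v + y) v ->
  is_derive t (1 : R^o) (fun s : R => f (s *: v + y)) ('D_v f (t *: v + y)).
Proof.
move=> df; have E : (fun h : R => h^-1 *: ((f \o shift (t *: v + y)) (h *: v)
    - f (t *: v + y))) = (fun h : R => h^-1 *:
    (((fun s : R => f (s *: v + y)) \o shift t) (h *: (1 : R^o)) - f (t *: v + y))).
  by apply/funext => h; rewrite /= [_ *: 1]mulr1 scalerDl addrA.
by split; [rewrite /derivable -E; exact: df|rewrite /derive -E].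
Qed.

Lemma mean_value_bound (g dg : R -> R) (c e s : R) :
  (forall t, `|t| <= `|s| -> is_derive t (1 : R^o) g (dg t)) ->
  (forall t, `|t| <= `|s| -> `|dg t - c| <= e) ->
  `|g s - g 0 - s * c| <= e * `|s|.
Proof.
move=> Dg Dge.
have cg a b : (forall t, t \in `[a, b] -> `|t| <= `|s|) ->
    {within `[a, b], continuous g}.
  move=> ab; apply: derivable_within_continuous => t /ab ts.
  exact: (@ex_derive _ _ _ _ _ _ _ (Dg t ts)).
have [s0|s0|->] := ltgtP s 0; last by rewrite subrr mul0r subr0 !normr0 mulr0.
- have sub t : t \in `[s, 0] -> `|t| <= `|s|.
    rewrite in_itv /= => /andP[st t0].
    by rewrite (ler0_norm t0) (ler0_norm (ltW s0)) lerN2.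
  have [t tI E] := MVT s0 (fun t ti => Dg t (sub t (subset_itv_oo_cc ti)))
    (cg _ _ sub).
  have -> : g s - g 0 - s * c = - ((dg t - c) * (0 - s)).
    by rewrite mulrBl -E; ring.
  rewrite normrN normrM sub0r normrN ler_wpM2r ?normr_ge0//.
  by apply: Dge; apply: sub; exact: subset_itv_oo_cc.
- have sub t : t \in `[0, s] -> `|t| <= `|s|.
    rewrite in_itv /= => /andP[t0 ts].
    by rewrite (ger0_norm t0) (ger0_norm (ltW s0)).
  have [t tI E] := MVT s0 (fun t ti => Dg t (sub t (subset_itv_oo_cc ti)))
    (cg _ _ sub).
  rewrite E subr0 (mulrC s) -mulrBl normrM ler_wpM2r ?normr_ge0//.
  by apply: Dge; apply: sub; exact: subset_itv_oo_cc.
Qed.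

Context {m : nat}.
Implicit Types (f : 'rV[R]_m -> R) (y k : 'rV[R]_m).

Lemma rV_norm_ge y i : `|y ord0 i| <= `|y|.
Proof.
rewrite [leRHS]/Num.Def.normr /= mx_normrE.
exact: (le_bigmax _ (fun x : 'I_1 * 'I_m => `|y x.1 x.2|) (ord0, i)).
Qed.

Lemma rV_norm_le y e : 0 <= e -> (forall i, `|y ord0 i| <= e) -> `|y| <= e.
Proof.
move=> e0 H; rewrite [leLHS]/Num.Def.normr /= mx_normrE.
by apply: bigmax_le => // -[i j] _ /=; rewrite ord1.
Qed.

Definition unit_rV (i : 'I_m) : 'rV[R]_m := delta_mx ord0 i.

Definition gradient_form f y : 'rV[R]_m -> R :=
  fun k => \sum_i k ord0 i * 'D_(unit_rV i) f y.

Lemma gradient_form_linear f y : linear (gradient_form f y : _ -> R^o).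
Proof.
move=> a k l; rewrite /gradient_form scaler_sumr -big_split /=.
by apply: eq_bigr => i _; rewrite !mxE mulrDl -mulrA.
Qed.

HB.instance Definition _ f y := GRing.isLinear.Build R 'rV[R]_m R^o _
  (gradient_form f y : _ -> R^o) (gradient_form_linear f y).

Lemma gradient_form_continuous f y : continuous (gradient_form f y : _ -> R^o).
Proof.
apply: continuous_big => [|i _]; first exact: add_continuous.
move=> k; apply: (@continuousM _ 'rV[R]_m (fun k => k ord0 i)); last exact: cst_continuous.
exact: (@coord_continuous R 1 m ord0 i k).
Qed.

(** Moving from [y] to [y + k] one coordinate at a time keeps inside the box of
    radius [`|k|], where each step is controlled by the mean value theorem. *)
Lemma C1_bound f (y : 'rV[R]_m) (d e : R) :
  (forall z i, `|z - y| <= d -> derivable f z (unit_rV i)) ->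
  (forall z i, `|z - y| <= d ->
     `|'D_(unit_rV i) f z - 'D_(unit_rV i) f y| <= e) ->
  forall k, `|k| <= d -> `|f (k + y) - f y - gradient_form f y k| <= m%:R * e * `|k|.
Proof.
move=> df De k kd.
pose P (j : nat) : 'rV[R]_m := (\row_i if (i < j)%N then k ord0 i else 0) + y.
have P0 : P 0 = y by apply/rowP => i; rewrite !mxE ltn0 add0r.
have Pm : P m = k + y by apply/rowP => i; rewrite !mxE ltn_ord.
have PS (j : 'I_m) : P j.+1 = k ord0 j *: unit_rV j + P j.
  apply/rowP => i; rewrite !mxE eqxx /= ltnS leq_eqVlt -val_eqE /=.
  by case: eqVneq => [/val_inj->|_]; rewrite ?ltnn /= ?mulr1 ?mulr0 ?add0r.
have Pd (j : 'I_m) (t : R) : `|t| <= `|k ord0 j| ->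
    `|t *: unit_rV j + P j - y| <= d.
  move=> tk; apply: le_trans kd; rewrite addrA addrK; apply: rV_norm_le => // i.
  rewrite !mxE eqxx /=; case: (eqVneq i j) => [->|_]; rewrite ?ltnn /=.
    by rewrite mulr1 addr0 (le_trans tk) ?rV_norm_ge.
  by rewrite mulr0 add0r; case: ifP => _; rewrite ?normr0 // rV_norm_ge.
have -> : f (k + y) - f y = \sum_(j < m) (f (P j.+1) - f (P j)).
  rewrite -Pm -{1}P0 -(big_mkord xpredT (fun j => f (P j.+1) - f (P j))).
  by rewrite telescope_sumr.
rewrite /gradient_form -sumrB; apply: le_trans (ler_norm_sum _ _ _) _.
rewrite -mulrA mulr_natl; set e' := e * _.
have -> : e' *+ m = \sum_(j < m) e' by rewrite sumr_const card_ord.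
apply: ler_sum => j _.
have De' t : `|t| <= `|k ord0 j| ->
    is_derive t (1 : R^o) (fun s : R => f (s *: unit_rV j + P j))
      ('D_(unit_rV j) f (t *: unit_rV j + P j)).
  by move=> /Pd tk; apply: derive_line; exact: df.
have := @mean_value_bound _ _ ('D_(unit_rV j) f y) e _ De' _.
rewrite scale0r add0r -PS => /(_ _)/le_trans; apply.
- by move=> t /Pd; exact: De.
- rewrite ler_wpM2l ?rV_norm_ge//.
  by apply: le_trans (De y j _); rewrite ?normr_ge0// subrr normr0 (le_trans _ kd).
Qed.

Lemma C1_differentiable f (U : set 'rV[R]_m) y : open U -> Ck 1 U f -> U y ->
  differentiable (f : _ -> R^o) y /\ 'd (f : _ -> R^o) y = gradient_form f y :> (_ -> _).
Proof.
move=> oU [_ df] Uy.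
have cg : continuous (gradient_form f y : _ -> R^o).
  exact: gradient_form_continuous.
apply: differentiable_bound cg _ => e e0.
have e'0 : 0 < e / m.+1%:R by rewrite divr_gt0.
have : \forall z \near y, forall i, derivable f z (unit_rV i) /\
    `|'D_(unit_rV i) f z - 'D_(unit_rV i) f y| <= e / m.+1%:R.
  apply: (@filter_forall _ 'I_m (fun i z => derivable f z (unit_rV i) /\
    `|'D_(unit_rV i) f z - 'D_(unit_rV i) f y| <= e / m.+1%:R) (nbhs y)) => i.
  near=> z; split.
    apply: (proj1 (df (unit_rV i))); near: z; exact: open_nbhs_nbhs.
  rewrite distrC; near: z.
  have /cvgrPdist_le/(_ _ e'0) := proj1 (proj2 (df (unit_rV i))) y Uy.
  exact.
move=> /nbhs_normP[r /= r0 Hr]; exists (r / 2) => [|k kr].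
  by rewrite divr_gt0.
have in_r (z : 'rV[R]_m) : `|z - y| <= r / 2 -> `|y - z| < r.
  by rewrite distrC => /le_lt_trans; apply; rewrite ltr_pdivrMr// ltr_pMr// ltr1n.
have := @C1_bound f y (r / 2) _ (fun z i zr => proj1 (Hr z (in_r z zr) i))
  (fun z i zr => proj2 (Hr z (in_r z zr) i)) k kr.
move=> /le_trans; apply.
rewrite ler_wpM2r// mulrA ler_pdivrMr// mulrC ler_wpM2l ?ler_nat//.
exact: ltW.
Unshelve. all: by end_near. Qed.

(** A change of variables preserves the class [C^k]: by the chain rule, the
    derivatives of [f \o u] are sums of products of derivatives of [u] and of
    partial derivatives of [f] composed with [u]. *)
Lemma Ck_comp {V : normedModType R} (U : set V) (W : set 'rV[R]_m)
    (u : V -> 'rV[R]_m) f (k : nat) : open U -> open W -> (forall x, U x -> W (u x)) ->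
  (forall i, Ck k U (fun x => u x ord0 i)) -> Ck k W f -> Ck k U (f \o u).
Proof.
move=> oU oW UW; elim: k f => [|k IH] f Cu Cf.
  split=> // x Ux; apply: continuous_comp; last exact: Ck_cont Cf _ (UW _ Ux).
  apply/cvgrPdist_le => /= e e0.
  have : \forall t \near x, forall i, `|u x ord0 i - u t ord0 i| <= e.
    apply: filter_forall => i.
    exact: (cvgrPdist_le _ _).1 (Ck_cont (Cu i) Ux) e e0.
  apply: filterS => t H; apply: rV_norm_le; rewrite ?ltW// => i.
  by rewrite !mxE.
have C1 : Ck 1 W f.
  by elim: (k) Cf => // j IHj /CkW.
have H v x : U x -> is_derive x v (f \o u : V -> R^o)
    (\sum_i 'D_v (fun x => u x ord0 i) x * 'D_(unit_rV i) f (u x)).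
  move=> Ux; have [df dfE] := C1_differentiable oW C1 (UW x Ux).
  have du : derivable u x v.
    by apply/derivable_mxP => i j; rewrite ord1; exact: (proj1 ((proj2 (Cu j)) v)).
  have du' := du; move/derivable1P/derivable1_diffP: du' => du'.
  have df' : differentiable (f : _ -> R^o) (u (0 *: v + x)).
    by rewrite scale0r add0r.
  have dc := differentiable_comp du' df'.
  apply: DeriveDef; first by apply/derivable1P/derivable1_diffP.
  rewrite derive_derive1 derive1E' //.
  rewrite (@diff_comp _ _ _ _ (fun h : R => u (h *: v + x)) (f : _ -> R^o)) //=.
  rewrite -(derive1E' du') -derive_derive1 scale0r add0r dfE /gradient_form.
  by apply: eq_bigr => i _; rewrite derive_mx// mxE.
have C0 := IH f (fun i => CkW (Cu i)) (CkW Cf).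
split=> [x Ux|v]; first exact: Ck_cont C0 x Ux.
split=> [x Ux|]; first exact: (@ex_derive _ _ _ _ _ _ _ (H v x Ux)).
apply: Ck_eq (Ck_sum _ oU (fun i _ => CkM oU (proj2 ((proj2 (Cu i)) v))
  (IH _ (fun i => CkW (Cu i)) (proj2 ((proj2 Cf) (unit_rV i)))))) => // x Ux.
by rewrite (@derive_val _ _ _ _ _ _ _ (H v x Ux)).
Qed.

End ChainRule.

(** * Hadamard's lemma *)

Section Hadamard.
Context {R : realType} {V : normedModType R}.
Variables (U : set V) (y : V).
Hypothesis oU : open U.
Hypothesis star : forall z (t : R), U z -> 0 <= t <= 1 -> U (t *: (z - y) + y).

Notation mu := (@lebesgue_measure R).

(** The weight [t ^+ j] makes the family stable under differentiation: deriving
    in [z] brings out a factor [t]. *)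
Definition mean (j : nat) (f : V -> R) (z : V) : R :=
  \int[mu]_(t in `[0, 1]) (t ^+ j * f (t *: (z - y) + y)).

Lemma ray_unif_continuous (f : V -> R) z0 (e : R) : Ck 0 U f -> U z0 -> 0 < e ->
  \forall z \near z0, forall t, 0 <= t <= 1 ->
    `|f (t *: (z - y) + y) - f (t *: (z0 - y) + y)| <= e.
Proof.
move=> [cf _] Uz0 e0.
have := (compact_near_coveringP (`[0, 1] : set R)).1 (@segment_compact R 0 1).
move=> /(_ V (nbhs z0) (fun z t =>
  `|f (t *: (z - y) + y) - f (t *: (z0 - y) + y)| <= e)) K.
have {K}: \forall z \near z0, `[0, 1]%classic `<=` (fun t : R =>
  `|f (t *: (z - y) + y) - f (t *: (z0 - y) + y)| <= e).
  apply: K => t t01.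
  have Ul : U (t *: (z0 - y) + y) by apply: star => //; move: t01; rewrite /= in_itv.
  have fl := cf _ Ul; have e20 : 0 < e / 2 by rewrite divr_gt0.
  have Hf : \forall w \near t *: (z0 - y) + y,
      `|f (t *: (z0 - y) + y) - f w| <= e / 2.
    by move/cvgrPdist_le: fl; exact.
  have l1 : (fun p : R * V => p.1 *: (p.2 - y) + y) @ (t, z0) --> t *: (z0 - y) + y.
    apply: cvgD; last exact: cvg_cst.
    apply: cvgZ; first exact: cvg_fst.
    by apply: cvgB; [exact: cvg_snd|exact: cvg_cst].
  have l2 : (fun p : R * V => p.1 *: (z0 - y) + y) @ (t, z0) --> t *: (z0 - y) + y.
    apply: cvgD; last exact: cvg_cst.
    by apply: cvgZ; [exact: cvg_fst|exact: cvg_cst].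
  have H1 := l1 _ Hf; have H2 := l2 _ Hf.
  have : \forall p \near (t, z0), `|f (t *: (z0 - y) + y) - f (p.1 *: (p.2 - y) + y)| <= e / 2
     /\ `|f (t *: (z0 - y) + y) - f (p.1 *: (z0 - y) + y)| <= e / 2.
    by apply: filterI; [exact: H1|exact: H2].
  apply: filterS => -[s z] /= [A B].
  rewrite (_ : f (s *: (z - y) + y) - f (s *: (z0 - y) + y) =
     (f (t *: (z0 - y) + y) - f (s *: (z0 - y) + y)) -
     (f (t *: (z0 - y) + y) - f (s *: (z - y) + y))); last by ring.
  by rewrite (splitr e); apply: le_trans (ler_normB _ _) _; rewrite lerD.
by apply: filterS => z H t t01; apply: H; rewrite /= in_itv.
Qed.

Lemma ray_continuous (f : V -> R) (j : nat) z : Ck 0 U f -> U z ->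
  {within `[0, 1], continuous (fun t : R => t ^+ j * f (t *: (z - y) + y))}.
Proof.
move=> [cf _] Uz; apply: continuous_in_subspaceT => t.
rewrite inE /= in_itv /= => t01.
apply: cvgM; first exact: exprn_continuous.
apply: (@cvg_comp _ _ _ (fun t : R => t *: (z - y) + y) f); last first.
  by apply: cf; exact: star.
apply: cvgD; last exact: cvg_cst.
by apply: cvgZ; [exact: cvg_id|exact: cvg_cst].
Qed.

Lemma ray_integrable (f : V -> R) (j : nat) z : Ck 0 U f -> U z ->
  mu.-integrable `[0, 1] (EFin \o (fun t : R => t ^+ j * f (t *: (z - y) + y))).
Proof.
move=> cf Uz; apply: continuous_compact_integrable; first exact: segment_compact.
exact: ray_continuous.
Qed.

Lemma Rintegral01_cst (c : R) : \int[mu]_(t in `[0, 1]) c = c.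
Proof.
rewrite Rintegral_cst//= lebesgue_measure_itv/= lte_fin ltr01.
by rewrite oppr0 adde0 /= mulr1.
Qed.

Lemma mean_continuous (f : V -> R) (j : nat) z : Ck 0 U f -> U z ->
  {for z, continuous (mean j f)}.
Proof.
move=> cf Uz; apply/cvgrPdist_le => e e0.
have H : \forall z' \near z, U z' by exact: open_nbhs_nbhs.
have := ray_unif_continuous cf Uz e0; apply: filterS2 H => z' Uz' H.
rewrite /mean -RintegralB//; try exact: ray_integrable.
apply: (le_trans (le_normr_Rintegral _ _)) => //.
  apply: continuous_compact_integrable; first exact: segment_compact.
  by move=> t; apply: cvgB; exact: ray_continuous.
rewrite -[leRHS]Rintegral01_cst; apply: le_Rintegral => //.
- apply: continuous_compact_integrable; first exact: segment_compact.
  move=> t; apply: cvg_norm.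
  by apply: cvgB; exact: ray_continuous.
- apply: continuous_compact_integrable; first exact: segment_compact.
  by move=> t; exact: cst_continuous.
- move=> t; rewrite /= in_itv /= => t01; rewrite -mulrBr normrM distrC.
  rewrite -[leRHS]mul1r ler_pM//; last exact: H.
  case/andP: t01 => t0 t1; rewrite normrX ger0_norm//.
  by rewrite exprn_ile1.
Qed.

(** Differentiation under the integral sign; the bound on the derivative near
    [z] is uniform along the segment by compactness. *)
Lemma mean_derive (f : V -> R) (j : nat) z v : Ck 1 U f -> U z ->
  is_derive z v (mean j f) (mean j.+1 ('D_v f) z).
Proof.
move=> Cf Uz; have C0 : Ck 0 U f by exact: CkW.
have [dv Cv] := (proj2 Cf) v.
have H1 := ray_unif_continuous Cv Uz ltr01.
have : \forall z' \near z, U z' /\ forall t, 0 <= t <= 1 ->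
    `|('D_v f) (t *: (z' - y) + y) - ('D_v f) (t *: (z - y) + y)| <= 1.
  by apply: filterI => //; exact: open_nbhs_nbhs.
move=> {}H1.
have lz : (fun s : R => s *: v + z) @ (0 : R) --> z.
  rewrite -[X in _ --> X]add0r -[X in _ --> X + _](scale0r v).
  apply: cvgD; last exact: cvg_cst.
  by apply: cvgZ; [exact: cvg_id|exact: cvg_cst].
have [d d0 Hd] := (nbhs_normP _ _).1 (lz _ H1).
have Id (s : R) : s \in `](- d), d[ -> U (s *: v + z) /\ forall t, 0 <= t <= 1 ->
    `|('D_v f) (t *: (s *: v + z - y) + y) - ('D_v f) (t *: (z - y) + y)| <= 1.
  rewrite in_itv /= => /andP[s1 s2]; apply: Hd => /=.
  by rewrite sub0r normrN ltr_norml s1.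
have I0 : `](- d), d[%classic (0 : R) by rewrite /= in_itv /= oppr_lt0 d0.
have [c _ cmax] : exists2 c : R, c \in `[0, 1] & forall t, t \in `[0, 1] ->
    `|('D_v f) (t *: (z - y) + y)| <= `|('D_v f) (c *: (z - y) + y)|.
  apply: EVT_max => // t; apply: cvg_norm.
  have := @ray_continuous ('D_v f) 0 z Cv Uz.
  rewrite (_ : (fun t : R => t ^+ 0 * _) = fun t : R => ('D_v f) (t *: (z - y) + y)).
    exact.
  by apply/funext => s; rewrite expr0 mul1r.
pose G (t : R) : R := 1 + `|('D_v f) (c *: (z - y) + y)|.
pose F (s t : R) : R := t ^+ j * f (t *: (s *: v + z - y) + y).
have dF s t : s \in `](- d), d[ -> t \in `[0, 1] ->
    is_derive s (1 : R^o) (F ^~ t) (t ^+ j.+1 * ('D_v f) (t *: (s *: v + z - y) + y)).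
  rewrite [t \in _]in_itv /= => /Id[Us _] t01.
  have Ut := star Us t01.
  have E w : t *: (w *: v + z - y) + y = w *: (t *: v) + (t *: (z - y) + y).
    by rewrite -[w *: v + z - y]addrA scalerDr !scalerA (mulrC t) addrA.
  have du : is_derive s (1 : R^o) (fun w : R => f (t *: (w *: v + z - y) + y))
      (t * 'D_v f (t *: (s *: v + z - y) + y)).
    have -> : (fun w : R => f (t *: (w *: v + z - y) + y)) =
        (fun w : R => f ((t * w) *: v + (t *: (z - y) + y))).
      by apply/funext => w; rewrite E scalerA mulrC.
    have := @derive_line R V f (t *: (z - y) + y) v (t * s).
    rewrite mulrC -scalerA -E => /(_ (dv _ Ut)) D.
    have D2 : is_derive s (1 : R^o) (fun w : R => t * w) t.
      by have := @is_deriveZ R R^o R^o id t s 1 1 (is_derive_id _ _); rewrite [_ *: 1]mulr1.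
    rewrite mulrC; apply: (@is_derive1_comp R
      (fun w : R => f (w *: v + (t *: (z - y) + y))) (fun w : R => t * w) _ _ _ _ D2).
    by rewrite [t * s]mulrC.
  rewrite exprSr -mulrA.
  exact: (@is_deriveZ R R^o R^o (fun w : R => f (t *: (w *: v + z - y) + y)) (t ^+ j) s 1 _ du).
have intF s : s \in `](- d), d[ -> mu.-integrable `[0, 1] (EFin \o F s).
  by move=> /Id[Us _]; exact: ray_integrable.
have ubF s t : s \in `](- d), d[ -> t \in `[0, 1] -> `|partial1of2 F s t| <= G t.
  move=> sd t01; have ds := dF s t sd t01.
  rewrite partial1of2E (@derive_val _ _ _ _ _ _ _ ds).
  have [_ H] := Id s sd.
  have /andP[t0 t1] : 0 <= t <= 1 by move: t01; rewrite in_itv.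
  rewrite normrM -[leRHS]mul1r ler_pM//.
    by rewrite normrX ger0_norm// exprn_ile1.
  rewrite -[X in `|X|](subrK (('D_v f) (t *: (z - y) + y))).
  by rewrite (le_trans (ler_normD _ _))// lerD ?cmax// H// t0 t1.
have G0 (t : R) : 0 <= G t by rewrite addr_ge0.
have intG : mu.-integrable `[0, 1] (EFin \o G).
  apply: continuous_compact_integrable; first exact: segment_compact.
  by move=> t; exact: cst_continuous.
have dF1 s t : `](- d), d[%classic s -> `[0, 1]%classic t -> derivable (F ^~ t) s 1.
  by move=> sd t01; exact: (@ex_derive _ _ _ _ _ _ _ (dF s t sd t01)).
have D1 := @derivable_under_integral R _ _ mu F `[0, 1] (measurable_itv _) 0 (- d) d I0
  intF dF1 G G0 intG ubF.
have D2 := @differentiation_under_integral R _ _ mu F `[0, 1] (measurable_itv _) 0 (- d) d I0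
  intF dF1 G G0 intG ubF.
apply: DeriveDef; first exact/derivable1P.
rewrite derive_derive1 D2; apply: eq_Rintegral => t /set_mem t01.
rewrite partial1of2E (@derive_val _ _ _ _ _ _ _ (dF 0 t I0 t01)).
by rewrite scale0r add0r.
Qed.

Lemma mean_Ck (f : V -> R) (j k : nat) : Ck k U f -> Ck k U (mean j f).
Proof.
elim: k f j => [|k IH] f j Cf.
  by split=> // z Uz; exact: mean_continuous.
have C1 : Ck 1 U f by elim: (k) Cf => // i IHi /CkW.
have C0 : Ck 0 U f by exact: CkW C1.
split=> [z Uz|v]; first exact: mean_continuous.
split=> [z Uz|]; first exact: (@ex_derive _ _ _ _ _ _ _ (mean_derive _ _ C1 Uz)).
apply: Ck_eq (IH _ j.+1 (proj2 ((proj2 Cf) v))) => // z Uz.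
by rewrite (@derive_val _ _ _ _ _ _ _ (mean_derive _ _ C1 Uz)).
Qed.

End Hadamard.

(** Integrating [f] along the segment from [y] to [z] writes [f z - f y] as a
    combination of the coordinates of [z - y] with smooth coefficients. *)
Lemma hadamard {R : realType} {m : nat} (U : set 'rV[R]_m) (y : 'rV[R]_m)
    (f : 'rV[R]_m -> R) : open U -> U y ->
  (forall z (t : R), U z -> 0 <= t <= 1 -> U (t *: (z - y) + y)) ->
  smooth_on U f ->
  exists h : 'I_m -> 'rV[R]_m -> R,
    [/\ forall i, smooth_on U (h i), forall i, h i y = 'D_(unit_rV i) f y
      & forall z, U z -> f z - f y = \sum_i (z ord0 i - y ord0 i) * h i z].
Proof.
move=> oU Uy star Cf.
have Cd i : smooth_on U ('D_(unit_rV i) f).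
  by move=> k; exact: (proj2 ((proj2 (Cf k.+1)) (unit_rV i))).
exists (fun i => mean y 0 ('D_(unit_rV i) f)); split.
- by move=> i k; apply: mean_Ck => //; exact: Cd.
- move=> i; rewrite /mean.
  under eq_Rintegral do rewrite expr0 mul1r subrr scaler0 add0r.
  exact: Rintegral01_cst.
move=> z Uz.
pose g (t : R) := f (t *: (z - y) + y).
pose dg (t : R) := \sum_i (z ord0 i - y ord0 i) * 'D_(unit_rV i) f (t *: (z - y) + y).
have Dg (t : R) : 0 <= t <= 1 -> is_derive t (1 : R^o) g (dg t).
  move=> t01; have Ut := star z t Uz t01.
  have [df dfE] := C1_differentiable oU (Cf 1%N) Ut.
  have dv : derivable f (t *: (z - y) + y) (z - y) by exact: diff_derivable.
  have <- : 'D_(z - y) f (t *: (z - y) + y) = dg t.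
    rewrite deriveE// dfE /gradient_form /dg.
    by apply: eq_bigr => i _; rewrite !mxE.
  exact: derive_line.
have cdg : {within `[0, 1], continuous dg}.
  apply: continuous_in_subspaceT => t; rewrite inE /= in_itv /= => t01.
  have Ut := star z t Uz t01.
  apply: continuous_sum_at => i.
  apply: cvgM; first exact: cvg_cst.
  apply: (@cvg_comp _ _ _ (fun t : R => t *: (z - y) + y) ('D_(unit_rV i) f)); last first.
    exact: (Ck_cont (Cd i 0%N) Ut).
  apply: cvgD; last exact: cvg_cst.
  by apply: cvgZ; [exact: cvg_id|exact: cvg_cst].
have cg (t : R) : 0 <= t <= 1 -> {for t, continuous g}.
  move=> /Dg Dt; apply: differentiable_continuous; apply/derivable1_diffP.
  exact: (@ex_derive _ _ _ _ _ _ _ Dt).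
have dLR : derivable_oo_LRcontinuous g 0 1.
  split.
  - move=> t /subset_itv_oo_cc; rewrite in_itv /= => /Dg Dt.
    exact: (@ex_derive _ _ _ _ _ _ _ Dt).
  - by apply: cvg_at_right_filter; apply: cg; rewrite lexx ler01.
  - by apply: cvg_at_left_filter; apply: cg; rewrite lexx ler01.
have := continuous_FTC2 ltr01 cdg dLR.
have gE : {in `]0, 1[, derive1 g =1 dg}.
  move=> t /subset_itv_oo_cc; rewrite in_itv /= => /Dg Dt.
  by rewrite derive1E (@derive_val _ _ _ _ _ _ _ Dt).
move=> /(_ gE) /(congr1 fine) /=.
rewrite /g scale1r subrK scale0r add0r => <-.
have int_i i : (@lebesgue_measure R).-integrable `[0, 1]
    (EFin \o (fun t : R => 'D_(unit_rV i) f (t *: (z - y) + y))).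
  have := @ray_integrable R _ U y star ('D_(unit_rV i) f) 0 z (Cd i 0%N) Uz.
  congr integrable; apply/funext => t /=; by rewrite expr0 mul1r.
have int_ci i : (@lebesgue_measure R).-integrable `[0, 1] (fun t : R =>
    ((z ord0 i - y ord0 i) * 'D_(unit_rV i) f (t *: (z - y) + y))%:E).
  by apply: (integrableZl _ (z ord0 i - y ord0 i) (int_i i)); exact: measurable_itv.
rewrite /dg; under eq_integral do rewrite -sumEFin.
rewrite integral_sum//= -sum_fine; last first.
  by move=> i _; exact: integrable_fin_num.
apply: eq_bigr => i _; rewrite /mean.
under [in RHS]eq_Rintegral do rewrite expr0 mul1r.
by rewrite -RintegralZl//.
Qed.

(** * Bump functions *)

Section Bump.
Context {R : realType}.

(** The functions [t ^- j * expR (- t^-1)], extended by [0] to [t <= 0]: this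
    family is stable under differentiation up to linear combinations, so the
    smoothness of all its members is proved at once. *)
Definition flat (j : nat) (t : R) : R :=
  if 0 < t then t^-1 ^+ j * expR (- t^-1) else 0.

Lemma flat_ge0 j t : 0 <= flat j t.
Proof.
rewrite /flat; case: ifPn => // t0.
by rewrite mulr_ge0 ?exprn_ge0 ?expR_ge0// invr_ge0 ltW.
Qed.

(** The exponential series at [t^-1] beats any power; the factor [t ^+ 2] gives
    a zero derivative at the origin. *)
Lemma flat_bound j (t : R) : flat j t <= (j.+2)`!%:R * t ^+ 2.
Proof.
have [t0|t0] := ltP 0 t; last first.
  by rewrite /flat ltNge t0 /= mulr_ge0// exprn_even_ge0.
have s0 : 0 < t^-1 by rewrite invr_gt0.
have H : t^-1 ^+ j.+2 / (j.+2)`!%:R <= expR t^-1.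
  by apply: le_trans (expR_ge1Dxn j.+1 (ltW s0)); rewrite lerDr.
rewrite /flat t0 expRN ler_pdivrMr ?expR_gt0//.
have -> : t^-1 ^+ j = (j.+2)`!%:R * t ^+ 2 * (t^-1 ^+ j.+2 / (j.+2)`!%:R).
  have C0 : (j.+2)`!%:R != 0 :> R by rewrite pnatr_eq0 -lt0n fact_gt0.
  have ts : t * t^-1 = 1 by rewrite divff// gt_eqF.
  transitivity (t^-1 ^+ j * (t * t^-1) ^+ 2 * ((j.+2)`!%:R / (j.+2)`!%:R)).
    by rewrite ts divff// expr1n !mulr1.
  by rewrite -[in X in _ = _ * (X / _)]addn2 exprD; ring.
by rewrite ler_wpM2l// mulr_ge0// exprn_ge0// ltW.
Qed.

Lemma flat_derive j (t : R) :
  is_derive t (1 : R^o) (flat j) (flat j.+2 t - j%:R * flat j.+1 t).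
Proof.
have [t0|t0|->] := ltgtP t 0.
- have E : \near t, cst 0 t = flat j t.
    near=> s; rewrite /flat ifF//; apply/negbTE; rewrite -leNgt ltW//.
    by near: s; exact: lt_nbhsl.
  have -> : flat j.+2 t - j%:R * flat j.+1 t = 0.
    by rewrite /flat !ltNge (ltW t0) /= mulr0 subr0.
  exact: near_eq_is_derive E (is_derive_cst _ _ _).
- have tn0 : t != 0 by rewrite gt_eqF.
  have E : \near t, (fun s => s^-1 ^+ j * expR (- s^-1)) t = flat j t.
    near=> s; rewrite /flat ifT//.
    by near: s; exact: lt_nbhsr.
  apply: near_eq_is_derive E _.
  have DV : is_derive t (1 : R^o) (fun s : R => s^-1) (- t ^- 2).
    have := @is_deriveV R id t 1 1 tn0 (is_derive_id _ _).
    by rewrite [_ *: 1]mulr1.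
  have DE : is_derive t (1 : R^o) (fun s : R => expR (- s^-1)) (expR (- t^-1) * t ^- 2).
    have DN : is_derive t (1 : R^o) (fun s : R => - s^-1) (t ^- 2).
      by have := @is_deriveN _ _ _ _ _ _ _ DV; rewrite opprK.
    exact: (@is_derive1_comp R expR (fun s => - s^-1)).
  have DX : is_derive t (1 : R^o) (fun s : R => s^-1 ^+ j) (j%:R * t^-1 ^+ j.-1 * - t ^- 2).
    have -> : (fun s : R => s^-1 ^+ j) = (fun s : R => s^-1) ^+ j.
      by rewrite exprfctE.
    exact: (@is_deriveX _ _ _ j _ _ _ DV).
  rewrite /flat t0; apply: (is_derive_eq (@is_deriveM _ _ _ _ _ _ _ _ DX DE)).
  have sE (x y : R) : x *: (y : R^o) = x * y by [].
  rewrite !sE -!exprVn; case: (j) => [|i] /=; rewrite ?mulr0n !exprS ?expr0.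
    have key (a e : R) : 1 * (e * (a * (a * 1))) + e * (0 * 1 * - (a * (a * 1))) =
      a * (a * 1) * e - 0 * (a * 1 * e) by ring.
    exact: key.
  have key (a e p c : R) : a * p * (e * (a * (a * 1))) + e * (c * p * - (a * (a * 1))) =
    a * (a * (a * p)) * e - c * (a * (a * p) * e) by ring.
  exact: key.
- have f0 i : flat i 0 = 0 by rewrite /flat ltxx.
  rewrite !f0 mulr0 subr0.
  have L : (fun h : R => h^-1 *: ((flat j \o shift 0) (h *: (1 : R^o)) - flat j 0))
      @ 0^' --> (0 : R).
    apply/cvgrPdist_le => e e0; near=> h.
    have h0 : h != 0 by near: h; exact: nbhs_dnbhs_neq.
    rewrite /= f0 subr0 addr0 sub0r normrN [h *: 1]mulr1 [_ *: _]/(_ * _).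
    rewrite normrM (ger0_norm (flat_ge0 _ _)) normfV ler_pdivrMl ?normr_gt0//.
    apply: le_trans (flat_bound _ _) _; rewrite (_ : h ^+ 2 = `|h| * `|h|); last by rewrite -normrM ger0_norm ?expr2// -expr2 exprn_even_ge0.
    rewrite mulrCA ler_wpM2l// -ler_pdivlMl ?ltr0n ?fact_gt0//.
    near: h; apply: dnbhs0_le; rewrite mulr_gt0// invr_gt0 ltr0n fact_gt0//.
  by split; [apply/cvg_ex; exists 0|exact: cvg_lim L].
Unshelve. all: by end_near. Qed.

Lemma flat_Ck j k : Ck (V := R^o) k setT (flat j).
Proof.
have cf i : continuous (flat i : R^o -> R^o).
  move=> t; apply: differentiable_continuous; apply/derivable1_diffP.
  exact: (@ex_derive _ _ _ _ _ _ _ (flat_derive i t)).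
have dv i (t v : R^o) : is_derive t v (flat i : R^o -> R)
    (v * (flat i.+2 t - i%:R * flat i.+1 t)).
  have d1 := flat_derive i t.
  have df : differentiable (flat i : R^o -> R^o) t.
    by apply/derivable1_diffP; exact: (@ex_derive _ _ _ _ _ _ _ d1).
  apply: DeriveDef; first exact: diff_derivable.
  rewrite deriveE// -[v in LHS]mulr1 linearZ /= -deriveE//.
  by rewrite (@derive_val _ _ _ _ _ _ _ d1).
elim: k j => [|k IH] j; first by split=> // t _; exact: cf.
split=> [t _|v]; first exact: cf.
split=> [t _|]; first exact: (@ex_derive _ _ _ _ _ _ _ (dv j t v)).
have C c i : Ck (V := R^o) k setT (fun t => c * flat i t).
  exact: (CkM openT (Ck_cst c k openT) (IH i)).
apply: (Ck_eq openT _ (CkB openT (C v j.+2) (C (v * j%:R) j.+1))) => t _.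
by rewrite (@derive_val _ _ _ _ _ _ _ (dv j t v)) mulrBr mulrA.
Qed.

Definition step (t : R) : R := flat 0 t / (flat 0 t + flat 0 (1 - t)).

Lemma Ck_coord1 k : Ck (V := R^o) k setT (id : R -> R).
Proof.
case: k => [|k]; split=> //; try by move=> t _; exact: cvg_id.
move=> v; split=> [t _|]; first exact: derivable_id.
by apply: (Ck_eq openT _ (Ck_cst v k openT)) => t _; rewrite derive_id.
Qed.

Lemma flat0_gt0 t : 0 < t -> 0 < flat 0 t.
Proof. by move=> t0; rewrite /flat t0 expr0 mul1r expR_gt0. Qed.

Lemma step_Ck k : Ck (V := R^o) k setT step.
Proof.
have C1 : Ck (V := R^o) k setT (fun t => flat 0 (1 - t)).
  apply: (Ck_comp1 (u := fun t : R^o => 1 - t)) (flat_Ck 0 k) => //; first exact: openT.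
  by apply: CkB; [exact: openT|exact: Ck_cst openT|exact: Ck_coord1].
apply: CkM; [exact: openT|exact: flat_Ck|].
apply: CkV; [exact: openT| |by apply: CkD; [exact: openT|exact: flat_Ck|]].
move=> t _; rewrite gt_eqF//.
have [t0|t0] := ltP 0 t.
  by rewrite ltr_pwDl ?flat_ge0// flat0_gt0.
by rewrite ltr_wpDl ?flat_ge0// flat0_gt0// subr_gt0 (le_lt_trans t0).
Qed.

Lemma step0 t : t <= 0 -> step t = 0.
Proof. by move=> t0; rewrite /step {1}/flat ltNge t0 /= mul0r. Qed.

Lemma step1 t : 1 <= t -> step t = 1.
Proof.
move=> t1; have t0 : 0 < t by rewrite (lt_le_trans ltr01).
have -> : step t = flat 0 t / flat 0 t.
  by rewrite /step [flat 0 (1 - t)]/flat ltNge subr_le0 t1 /= addr0.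
by rewrite divff// gt_eqF// flat0_gt0.
Qed.

Lemma Ck_coord m (i : 'I_m) k : Ck k setT (fun x : 'rV[R]_m => x ord0 i).
Proof.
have dv (x v : 'rV[R]_m) : is_derive x v (fun x : 'rV[R]_m => x ord0 i) (v ord0 i).
  have dx : derivable (id : 'rV[R]_m -> _) x v by exact: derivable_id.
  split; first by have /derivable_mxP := dx; exact.
  by have := derive_mx dx; rewrite derive_id => /matrixP/(_ ord0 i); rewrite mxE.
case: k => [|k]; split=> //; try by move=> t _; exact: coord_continuous.
move=> v; split=> [x _|]; first exact: (@ex_derive _ _ _ _ _ _ _ (dv x v)).
apply: (Ck_eq openT _ (Ck_cst (v ord0 i) k openT)) => x _.
by rewrite (@derive_val _ _ _ _ _ _ _ (dv x v)).
Qed.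

(** The norm is the largest absolute value of a coordinate, so a product of
    functions of one coordinate cuts off on a ball. *)
Lemma bump_exists m (a : 'rV[R]_m) (r : R) : 0 < r ->
  exists b : 'rV[R]_m -> R, [/\ smooth_on setT b,
    forall x, `|x - a| <= r / 2 -> b x = 1 & forall x, r <= `|x - a| -> b x = 0].
Proof.
move=> r0.
(* The factor [4 / 3] makes [u i x] reach [1] exactly where the [i]-th
   coordinate is at distance [r / 2] from that of [a]. *)
pose u i (x : 'rV[R]_m) : R := 4 / 3 * (1 - (x ord0 i - a ord0 i) ^+ 2 / r ^+ 2).
exists (fun x => \prod_i step (u i x)); split.
- move=> k; apply: Ck_prod => [|i _]; first exact: openT.
  apply: (Ck_comp1 (u := u i)) (step_Ck k); first exact: openT.
  have C c : Ck k setT (cst c : 'rV[R]_m -> R) by exact: Ck_cst openT.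
  have Cx := CkB openT (Ck_coord i k) (C (a ord0 i)).
  exact: CkM openT (C _) (CkB openT (C _) (CkM openT (CkM openT Cx Cx) (C _))).
- move=> x xa; apply: big1 => i _; apply: step1.
  have := le_trans (rV_norm_ge (x - a) i) xa; rewrite !mxE => xi.
  have : (x ord0 i - a ord0 i) ^+ 2 <= (r / 2) ^+ 2.
    by rewrite -[leLHS]ger0_norm ?exprn_even_ge0// normrX lerXn2r ?nnegrE ?divr_ge0// ltW.
  rewrite /u; set s := (_ - _) ^+ 2 => sr.
  have : s / r ^+ 2 <= 1 / 4.
    rewrite ler_pdivrMr ?exprn_gt0//; apply: le_trans sr _; rewrite expr_div_n; lra.
  lra.
- move=> x xa.
  have [i xi] : exists i, r <= `|x ord0 i - a ord0 i|.
    apply: contrapT => H; move: xa; apply/negP; rewrite -ltNge.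
    rewrite [ltLHS]/Num.Def.normr /= mx_normrE; apply: bigmax_lt => // -[j i] _ /=.
    by rewrite ltNge; apply/negP => xi; apply: H; exists i; move: xi; rewrite !mxE ord1.
  rewrite (bigD1 i)//= step0 ?mul0r//.
  have : r ^+ 2 <= (x ord0 i - a ord0 i) ^+ 2.
    by rewrite -[leRHS]ger0_norm ?exprn_even_ge0// normrX lerXn2r ?nnegrE// ltW.
  rewrite /u; set s := (_ - _) ^+ 2 => sr.
  have : 1 <= s / r ^+ 2 by rewrite ler_pdivlMr ?exprn_gt0// mul1r.
  lra.
Qed.

End Bump.

(** * Smooth functions on a manifold *)

Section SmoothLocal.
Context {R : realType} {m : nat} (M : manifold R m).

Lemma chart_preimage_open (c : chart R m M) (N : set M) :
  open N -> open (ccod c `&` cbwd c @^-1` N).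
Proof.
move=> oN; rewrite openE => x [cx Nx]; apply: filterI.
  by apply: open_nbhs_nbhs; split => //; exact: ccod_open.
by apply: (cbwd_cont cx); exact: open_nbhs_nbhs.
Qed.

Lemma chart_image_open (c : chart R m M) (W : set 'rV[R]_m) :
  open W -> open (cdom c `&` cfwd c @^-1` W).
Proof.
move=> oW; rewrite openE => p [cp Wp]; apply: filterI.
  by apply: open_nbhs_nbhs; split => //; exact: cdom_open.
by apply: (cfwd_cont cp); exact: open_nbhs_nbhs.
Qed.

(** Smoothness may be tested near each point in one chart of the atlas, since
    the transition maps are smooth. *)
Lemma smooth_in_charts (f : M -> R) :
  (forall p, exists c W u, [/\ matlas c /\ cdom c p, open W /\ W `<=` ccod c,
     W (cfwd c p), smooth_on W u & forall x, W x -> f (cbwd c x) = u x]) ->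
  smooth f.
Proof.
move=> H c' Mc' k; apply: Ck_local => x' cx'.
have [c [W [u [[Mc cp] [oW Wc] Wp su fu]]]] := H (cbwd c' x').
exists (ccod c' `&` cbwd c' @^-1` (cdom c `&` cfwd c @^-1` W)).
have oW' := @chart_preimage_open c' _ (chart_image_open c oW).
split => //.
apply: (@Ck_eq _ _ _ (u \o (cfwd c \o cbwd c'))) => //.
  move=> y [cy [/= dy Wy]]; rewrite /= -fu// cfwdK//.
apply: (Ck_comp oW' oW) (su k); first by move=> y [_ []].
move=> i; apply: Ck_sub (matlas_smooth Mc' Mc i k).
by move=> y [cy [dy _]]; split.
Qed.

Lemma smooth_continuous (f : M -> R) : smooth f -> continuous f.
Proof.
move=> sf p; have [c Mc cp] := matlas_cover p.
have E : \near p, (f \o cbwd c \o cfwd c) p = f p.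
  near=> q; rewrite /= cfwdK//; near: q.
  by apply: open_nbhs_nbhs; split => //; exact: cdom_open.
change (f @ p --> f p); rewrite -{2}(cfwdK cp).
apply: cvg_trans (near_eq_cvg E) _.
apply: (@continuous_comp _ _ _ (cfwd c) (f \o cbwd c)); first exact: cfwd_cont.
exact: (Ck_cont (sf c Mc 0%N) (cfwd_cod cp)).
Unshelve. all: by end_near. Qed.

Lemma rV_ball_open (a : 'rV[R]_m) (r : R) : open [set x : 'rV[R]_m | `|x - a| < r].
Proof.
rewrite (_ : [set x | _] = ball a r); first exact: ball_open.
by apply/seteqP; split=> x; rewrite -ball_normE /= distrC.
Qed.

Definition extend (c : chart R m M) (u : 'rV[R]_m -> R) (q : M) : R :=
  if `[< cdom c q >] then u (cfwd c q) else 0.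

Lemma extend_in (c : chart R m M) u x : ccod c x -> extend c u (cbwd c x) = u x.
Proof.
by move=> cx; rewrite /extend asboolT ?cbwdK//; exact: cbwd_dom.
Qed.

Lemma extend_out (c : chart R m M) u q : ~ cdom c q -> extend c u q = 0.
Proof. by move=> cq; rewrite /extend asboolF. Qed.

(** The support of [u] lies in a compact ball of the chart, whose image is
    closed because [M] is Hausdorff. *)
Lemma extend_smooth (c : chart R m M) (a : 'rV[R]_m) (s r : R) u :
  matlas c -> s < r -> (forall x, `|x - a| < r -> ccod c x) ->
  smooth_on [set x | `|x - a| < r] u -> (forall x, s <= `|x - a| -> u x = 0) ->
  smooth (extend c u).
Proof.
move=> Mc sr rc su u0; apply: smooth_in_charts => p.
pose S := cbwd c @` [set x : 'rV[R]_m | `|x - a| <= s].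
have oC : open (~` S).
  rewrite openC; apply: compact_closed; first exact: mhausdorff.
  apply: continuous_compact.
    apply: continuous_in_subspaceT => x /set_mem xs.
    by apply: cbwd_cont; apply: rc; exact: le_lt_trans xs sr.
  apply: bounded_closed_compact.
    exists (`|a| + s); split; first exact: num_real.
    move=> e es x xs; apply: le_trans (ltW es).
    by rewrite -[x](subrK a) addrC (le_trans (ler_normD _ _))// lerD2l.
  have := @closed_closed_ball_ R 'rV[R]_m a s; congr closed.
  by apply/funext => x; rewrite /closed_ball_ /= distrC.
have [Sp|Sp] := pselect (S p).
  have [x xs xp] := Sp; have xr : `|x - a| < r by exact: le_lt_trans xs sr.
  exists c, [set x | `|x - a| < r], u; split => //.
  - by split; rewrite // -xp; apply: cbwd_dom; exact: rc.
  - by split; [exact: rV_ball_open|exact: rc].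
  - by rewrite -xp cbwdK//; exact: rc.
  - by move=> y /rc cy; exact: extend_in.
have [c' Mc' cp'] := matlas_cover p.
exists c', (ccod c' `&` cbwd c' @^-1` (~` S)), (cst 0); split => //.
- by split; [exact: chart_preimage_open|move=> x []].
- by split; [exact: cfwd_cod|rewrite /= cfwdK].
- by move=> k; apply: Ck_cst; exact: chart_preimage_open.
- move=> x [_ /= Sx]; rewrite /extend; case: asboolP => // cx.
  apply: u0; rewrite leNgt; apply/negP => xs; apply: Sx.
  by exists (cfwd c (cbwd c' x)); [exact: ltW|rewrite cfwdK].
Qed.

End SmoothLocal.

(** * Vector fields and local frames *)

Section LocalFrame.
Context {R : realType} {m : nat} (M : manifold R m).
Implicit Types (f g : cinf M) (X Y : vfield M).

Lemma cinf_ext f g : (forall p, f p = g p) -> f = g.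
Proof. by move=> fg; apply/val_inj/funext. Qed.

Lemma ccinf_ext (f g : ccinf M) : (forall p, f p = g p) -> f = g.
Proof. by move=> fg; apply/val_inj/funext. Qed.

Lemma cinfDE f g p : (f + g) p = f p + g p. Proof. by []. Qed.
Lemma cinfME f g p : (f * g) p = f p * g p. Proof. by []. Qed.
Lemma cinfNE f p : (- f) p = - f p. Proof. by []. Qed.
Lemma cinfBE f g p : (f - g) p = f p - g p. Proof. by []. Qed.
Lemma cinf0E p : (0 : cinf M) p = 0. Proof. by []. Qed.
Lemma cinf1E p : (1 : cinf M) p = 1. Proof. by []. Qed.
Lemma cst_cinfE (t : R) p : cst_cinf M t p = t. Proof. by []. Qed.
Definition cinfE := (cinfDE, cinfME, cinfNE, cinf0E, cinf1E, cst_cinfE).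

Lemma vfield_ext X Y : (forall f p, X f p = Y f p) -> X = Y.
Proof. by move=> XY; apply/val_inj/funext => f; exact: (cinf_ext (XY f)). Qed.

Lemma tangent_ext p (v w : tangent p) : (forall f, v f = w f) -> v = w.
Proof. by move=> vw; apply/val_inj/funext. Qed.

Lemma vfieldD X f g : X (f + g) = X f + X g.
Proof. by have [-> _ _] := vfieldP X. Qed.

Lemma vfieldM X f g : X (f * g) = f * X g + g * X f.
Proof. by have [_ _ ->] := vfieldP X. Qed.

Lemma vfieldZ X (a : R) f : X (cst_cinf M a * f) = cst_cinf M a * X f.
Proof. by have [_ -> _] := vfieldP X. Qed.

Lemma vfield_cst X (a : R) : X (cst_cinf M a) = 0.
Proof.
have X1 : X 1 = 0.
  have := vfieldM X 1 1; rewrite !mul1r => H.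
  by apply: (@addrI (cinf M) (X 1)); rewrite addr0 -[LHS]H.
by have := vfieldZ X a 1; rewrite !mulr1 X1 mulr0.
Qed.

Lemma vfield_cstD X f (a : R) : X (f - cst_cinf M a) = X f.
Proof.
have -> : f - cst_cinf M a = f + cst_cinf M (- a).
  by apply: cinf_ext => p.
by rewrite vfieldD vfield_cst addr0.
Qed.

Lemma vfield_sum X (I : Type) (r : seq I) (F : I -> cinf M) :
  X (\sum_(i <- r) F i) = \sum_(i <- r) X (F i).
Proof.
elim: r => [|i r IH]; last by rewrite !big_cons vfieldD IH.
rewrite !big_nil; have := vfield_cst X 0; congr (_ = _); congr (_ _).
exact: cinf_ext.
Qed.

Lemma vfield_sumE (I : Type) (r : seq I) (F : I -> vfield M) f p :
  (\sum_(i <- r) F i) f p = \sum_(i <- r) F i f p.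
Proof.
by elim: r => [|i r IH]; rewrite ?big_nil// !big_cons -IH.
Qed.

Lemma vfield_scaleE g X f p : (g *: X) f p = g p * X f p.
Proof. by []. Qed.

Lemma cinf_sumE (I : Type) (r : seq I) (F : I -> cinf M) p :
  (\sum_(i <- r) F i) p = \sum_(i <- r) F i p.
Proof.
by elim: r => [|i r IH]; rewrite ?big_nil// !big_cons -IH.
Qed.

Definition mk_cinf (f : M -> R) (sf : smooth f) : cinf M := Cinf (asboolT sf).

Lemma chart_smooth f (c : chart R m M) : matlas c -> smooth_on (ccod c) (f \o cbwd c).
Proof. by move=> Mc; exact: cinfP. Qed.

Section Frame.
Variables (c : chart R m M) (a : 'rV[R]_m) (r s : R) (b : 'rV[R]_m -> R).
Hypotheses (Mc : matlas c) (sr : s < r).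
Hypothesis rc : forall x : 'rV[R]_m, `|x - a| < r -> ccod c x.
Hypothesis sb : smooth_on setT b.
Hypothesis b0 : forall x, s <= `|x - a| -> b x = 0.

Let ball_ok := @rV_ball_open R m a r.

Lemma cutoff_smooth (u : 'rV[R]_m -> R) :
  smooth_on [set x : 'rV[R]_m | `|x - a| < r] u -> smooth (extend c (fun x => b x * u x)).
Proof.
move=> su; apply: extend_smooth Mc sr rc _ _.
  by move=> k; apply: CkM => //; apply: Ck_sub (sb k).
by move=> x /b0 ->; rewrite mul0r.
Qed.

Lemma chart_ball_smooth f v :
  smooth_on [set x : 'rV[R]_m | `|x - a| < r] ('D_v (f \o cbwd c)).
Proof.
move=> k; apply: Ck_sub (proj2 ((proj2 (chart_smooth f Mc k.+1)) v)).
exact: rc.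
Qed.

(** The constant field [v] of the chart, cut off by [b]. *)
Definition straight_fun (v : 'rV[R]_m) : cinf M -> (cinf M)^o :=
  fun f => mk_cinf (cutoff_smooth (chart_ball_smooth f v)).

Lemma straight_derivation v : is_derivation (straight_fun v).
Proof.
have df f q : cdom c q -> derivable (f \o cbwd c : _ -> R) (cfwd c q) v.
  move=> cq; exact: (proj1 ((proj2 (chart_smooth f Mc 1)) v) _ (cfwd_cod cq)).
have Ein f q : cdom c q ->
    straight_fun v f q = b (cfwd c q) * 'D_v (f \o cbwd c) (cfwd c q).
  by move=> cq; rewrite /straight_fun /= /extend asboolT.
have Eout f q : ~ cdom c q -> straight_fun v f q = 0.
  by move=> cq; rewrite /straight_fun /= extend_out.
split=> [f g|t f|f g]; apply: cinf_ext => q.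
- rewrite cinfE.
  have [cq|cq] := pselect (cdom c q); last by rewrite !Eout// addr0.
  by rewrite !Ein// -mulrDr -deriveD//; exact: df.
- rewrite !cinfE.
  have [cq|cq] := pselect (cdom c q); last by rewrite !Eout// mulr0.
  rewrite !Ein// mulrCA; congr (_ * _).
  exact: (deriveZ (t : R) (df f q cq)).
- rewrite !cinfE.
  have [cq|cq] := pselect (cdom c q); last by rewrite !Eout// !mulr0 addr0.
  rewrite !Ein// mulrCA (mulrCA (g q)) -mulrDr; congr (_ * _).
  rewrite [LHS](deriveM (df f q cq) (df g q cq)) /=.
  by rewrite cfwdK.
Qed.

Definition straight_field v : vfield M := VField (asboolT (straight_derivation v)).

Lemma straight_fieldE v f x : ccod c x ->
  straight_field v f (cbwd c x) = b x * 'D_v (f \o cbwd c) x.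
Proof. exact: extend_in. Qed.

Lemma straight_field_out v f q : ~ cdom c q -> straight_field v f q = 0.
Proof. exact: extend_out. Qed.

End Frame.

(** Near each point there are a chart, vector fields [E v] that are the constant
    fields of that chart, and global functions [x i] that are its coordinates.
    A vector field is then determined near the point by its values on the
    [x i]: by Hadamard's lemma a derivation annihilates the functions that
    vanish to second order. *)
Lemma local_frame (p : M) :
  exists (c : chart R m M) (r : R) (E : 'rV[R]_m -> vfield M) (x : 'I_m -> cinf M)
    (b : cinf M),
  [/\ [/\ 0 < r, matlas c, cdom c p & forall y, `|y - cfwd c p| < r -> ccod c y],
      b p = 1,
      forall v f y, `|y - cfwd c p| < r -> E v f (cbwd c y) = 'D_v (f \o cbwd c) y,
      forall X, b *: X = \sum_i X (x i) *: E (unit_rV i)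
    & forall i j, E (unit_rV i) (x j) p = (i == j)%:R].
Proof.
have [c Mc cp] := matlas_cover p; set a := cfwd c p.
have [r r0 rc] : exists2 r : R, 0 < r & forall x, `|x - a| < r -> ccod c x.
  have : nbhs a (ccod c).
    by apply: open_nbhs_nbhs; split; [exact: ccod_open|exact: cfwd_cod].
  move=> /nbhs_normP[r r0 H]; exists r => // x xr; apply: H.
  by rewrite /= distrC.
have r20 : 0 < r / 2 by rewrite divr_gt0.
have r40 : 0 < r / 4 by rewrite divr_gt0.
have r2r : r / 2 < r by lra.
have r4r : r / 4 < r by lra.
have [kap [sk k1 k0]] := bump_exists a r20.
have [bet [sb b1 b0]] := bump_exists a r40.
have su1 : smooth_on [set x : 'rV[R]_m | `|x - a| < r] (cst 1).
  by move=> k; apply: Ck_cst; exact: rV_ball_open.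
have sux i : smooth_on [set x : 'rV[R]_m | `|x - a| < r] (fun x => x ord0 i).
  by move=> k; apply: Ck_sub (Ck_coord i k).
pose E := straight_field Mc r4r rc sb b0.
pose x i : cinf M := mk_cinf (cutoff_smooth Mc r2r rc sk k0 (sux i)).
pose b : cinf M := mk_cinf (cutoff_smooth Mc r4r rc sb b0 su1).
pose kp : cinf M := mk_cinf (cutoff_smooth Mc r2r rc sk k0 su1).
have E1 v f y : `|y - a| < r / 8 -> E v f (cbwd c y) = 'D_v (f \o cbwd c) y.
  move=> y8; rewrite straight_fieldE; last by apply: (rc); lra.
  by rewrite b1 ?mul1r//; lra.
have bE y : ccod c y -> b (cbwd c y) = bet y.
  by move=> cy; rewrite /= extend_in//= mulr1.
have kpE y : ccod c y -> kp (cbwd c y) = kap y.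
  by move=> cy; rewrite /= extend_in//= mulr1.
have xE i y : ccod c y -> x i (cbwd c y) = kap y * y ord0 i.
  by move=> cy; rewrite /= extend_in.
(* [kp] is a constant [1] on the support of [b], which forces [X kp] to vanish
   where [b] does not. *)
have bkp : b * kp = b.
  apply: cinf_ext => q; rewrite cinfE.
  have [cq|cq] := pselect (cdom c q); last by rewrite [b q]extend_out// mul0r.
  rewrite -(cfwdK cq) bE ?kpE; try exact: cfwd_cod.
  have [|q4] := leP (r / 4) `|cfwd c q - a|; first by move/b0 ->; rewrite mul0r.
  by rewrite k1 ?mulr1//; lra.
exists c, (r / 8), E, x, b; split => //.
- split=> //; [lra|by move=> y yr; apply: (rc); apply: lt_trans yr _; lra].
- by rewrite -(cfwdK cp) bE ?b1 ?subrr ?normr0//; [lra|exact: cfwd_cod].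
- move=> X; apply: vfield_ext => f q; rewrite vfield_sumE vfield_scaleE.
  have [cq|cq] := pselect (cdom c q); last first.
    rewrite [b q]extend_out// mul0r big1// => i _.
    by rewrite vfield_scaleE [E _ f q]straight_field_out// mulr0.
  set y := cfwd c q; have cy : ccod c y by exact: cfwd_cod.
  have qy : q = cbwd c y by rewrite cfwdK.
  have Eq i : E (unit_rV i) f q = bet y * 'D_(unit_rV i) (f \o cbwd c) y.
    by rewrite qy straight_fieldE.
  have bq : b q = bet y by rewrite qy bE.
  have [by0|by0] := eqVneq (bet y) 0.
    rewrite bq by0 mul0r big1// => i _.
    by rewrite vfield_scaleE Eq by0 mul0r mulr0.
  have ya : `|y - a| < r / 4.
    by rewrite ltNge; apply/negP => /b0 /eqP; rewrite (negbTE by0).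
  have kq : kp q = 1 by rewrite qy kpE ?k1//; lra.
  have Xk : X kp q = 0.
    have := congr1 (fun g : cinf M => X g q) bkp.
    rewrite /= vfieldM !cinfE kq mul1r => /(canRL (addrK _)).
    by rewrite subrr => /eqP; rewrite mulf_eq0 bq (negbTE by0) /= => /eqP.
  have xq i : x i q = y ord0 i by rewrite qy xE// k1 ?mul1r//; lra.
  have [||h [sh hy hE]] := @hadamard R m [set x : 'rV[R]_m | `|x - a| < r] y (f \o cbwd c)
      (@rV_ball_open R m a r) _ _ (fun k => Ck_sub rc (chart_smooth f Mc k)).
  - by move: ya; rewrite /=; lra.
  - move=> z t /= zr /andP[t0 t1].
    have yr : `|y - a| < r by lra.
    have -> : t *: (z - y) + y - a = t *: (z - a) + (1 - t) *: (y - a).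
      by apply/rowP => i; rewrite !mxE; ring.
    rewrite (le_lt_trans (ler_normD _ _))// !normrZ (ger0_norm t0) ger0_norm ?subr_ge0//.
    have [t00|t00] := eqVneq t 0; first by rewrite t00 mul0r add0r subr0 mul1r.
    have tp : 0 < t by rewrite lt_neqAle eq_sym t00.
    have : t * `|z - a| < t * r by rewrite ltr_pM2l.
    have : (1 - t) * `|y - a| <= (1 - t) * r by rewrite ler_wpM2l ?subr_ge0// ltW.
    lra.
  pose h' i : cinf M := mk_cinf (cutoff_smooth Mc r2r rc sk k0 (sh i)).
  (* Hadamard's expansion at [y], with every factor cut off by [kp] so that it
     becomes an identity between global functions. *)
  have key : kp * kp * (f - cst_cinf M (f q)) =
      \sum_i (x i - cst_cinf M (y ord0 i) * kp) * h' i.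
    apply: cinf_ext => q'; rewrite cinf_sumE !cinfE.
    have [cq'|cq'] := pselect (cdom c q'); last first.
      rewrite [kp q']extend_out// !mul0r big1// => i _.
      by rewrite !cinfE [h' i q']extend_out ?mulr0.
    set z := cfwd c q'; have cz : ccod c z by exact: cfwd_cod.
    have q'z : q' = cbwd c z by rewrite cfwdK.
    have h'z i : h' i q' = kap z * h i z by rewrite q'z /= extend_in.
    have kz : kp q' = kap z by rewrite q'z kpE.
    rewrite kz; have [zr|zr] := leP (r / 2) `|z - a|.
      rewrite k0// !mul0r big1// => i _.
      by rewrite cinfME h'z k0// mul0r mulr0.
    have -> : f q' - f q = \sum_i (z ord0 i - y ord0 i) * h i z.
      by rewrite q'z [in f q]qy; apply: hE; rewrite /=; lra.
    rewrite mulr_sumr; apply: eq_bigr => i _.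
    by rewrite !cinfE h'z kz q'z xE//; ring.
  have : X (kp * kp * (f - cst_cinf M (f q))) q =
      X (\sum_i (x i - cst_cinf M (y ord0 i) * kp) * h' i) q by rewrite key.
  rewrite vfield_sum cinf_sumE vfieldM !cinfE kq subrr mul0r addr0 !mul1r.
  rewrite vfield_cstD => ->; rewrite mulr_sumr; apply: eq_bigr => i _.
  rewrite vfield_scaleE Eq bq vfieldM !cinfE xq kq mulr1 subrr mul0r add0r.
  have -> : h' i q = 'D_(unit_rV i) (f \o cbwd c) y.
    rewrite qy /= extend_in//= k1 ?mul1r ?hy//; lra.
  have -> : X (x i - cst_cinf M (y ord0 i) * kp) q = X (x i) q.
    have -> : x i - cst_cinf M (y ord0 i) * kp = x i + cst_cinf M (- y ord0 i) * kp.
      by apply: cinf_ext => q'; rewrite !cinfE; ring.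
    by rewrite vfieldD vfieldZ !cinfE Xk mulr0 addr0.
  ring.
- move=> i j; rewrite -(cfwdK cp) E1 ?subrr ?normr0; last by lra.
  have : \near a, (fun y : 'rV[R]_m => y ord0 j) a = (x j \o cbwd c) a.
    apply/nbhs_normP; exists (r / 4) => // y /=; rewrite distrC => ya.
    suff : y ord0 j = x j (cbwd c y) by [].
    by rewrite xE ?k1 ?mul1r//; [lra|apply: (rc); lra].
  move=> /near_eq_derive <-.
  have da : derivable (id : 'rV[R]_m -> _) a (unit_rV i) by exact: derivable_id.
  have := derive_mx da; rewrite derive_id => /matrixP/(_ ord0 j); rewrite [in RHS]mxE => <-.
  by rewrite !mxE eqxx /= eq_sym.
Qed.

End LocalFrame.

(** * Tensors at a point, minima, and linear first-order systems *)

Section PointwiseConsequences.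
Context {R : realType} {m : nat} (M : manifold R m).
Implicit Types (f g : cinf M) (X Y : vfield M).

Lemma clopen_all (Z : set M) p0 : open Z -> closed Z -> Z p0 -> forall p, Z p.
Proof.
move=> oZ cZ Zp p; suff -> : Z = [set: M] by [].
apply: (@mconnected _ _ M); first by exists p0.
- by exists Z => //; rewrite setTI.
- by exists Z => //; rewrite setTI.
Qed.

(** A field vanishing at [p] is near [p] a combination of the fields of a local
    frame, with coefficients that vanish at [p]. *)
Lemma tensor_vanish (V : zmodType) (p : M) (G : vfield M -> V) :
  (forall X Y, G (X + Y) = G X + G Y) ->
  (forall f X, f p = 0 -> G (f *: X) = 0) ->
  forall X, vat X p = 0 -> G X = 0.
Proof.
move=> GD G0 X Xp.
have [c [r [E [x [b [_ bp _ bX _]]]]]] := local_frame p.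
have Gs (I : Type) (s : seq I) (F : I -> vfield M) :
    (forall i, G (F i) = 0) -> G (\sum_(i <- s) F i) = 0.
  move=> GF; elim: s => [|i s IH]; last by rewrite big_cons GD GF IH addr0.
  by rewrite big_nil -(scale0r X); apply: G0.
have -> : X = (1 - b) *: X + b *: X by rewrite scalerBl scale1r subrK.
have b1 : (1 - b) p = 0 by rewrite cinfBE cinf1E bp subrr.
rewrite GD (G0 _ _ b1) add0r.
rewrite bX; apply: Gs => i; apply: G0.
have := congr1 (fun v : tangent p => v (x i)) Xp; exact.
Qed.

Lemma tangent_coords (p : M) :
  exists (cx : vfield M -> 'rV[R]_m) (lift : 'rV[R]_m -> vfield M),
  [/\ forall X Y, cx (X + Y) = cx X + cx Y,
      forall f X, cx (f *: X) = f p *: cx X,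
      cancel lift cx
    & forall X, cx X = 0 -> vat X p = 0].
Proof.
have [c [r [E [x [b [_ bp _ bX Ex]]]]]] := local_frame p.
exists (fun X => \row_i X (x i) p).
exists (fun v => \sum_i cst_cinf M (v ord0 i) *: E (unit_rV i)); split.
- by move=> X Y; apply/rowP => i; rewrite !mxE.
- by move=> f X; apply/rowP => i; rewrite !mxE.
- move=> v; apply/rowP => j; rewrite mxE vfield_sumE (bigD1 j)// .
  rewrite vfield_scaleE Ex eqxx mulr1 big1 => [|i ij]; first exact: addr0.
  by rewrite vfield_scaleE Ex (negbTE ij) mulr0.
- move=> X /rowP X0; apply: tangent_ext => f /=.
  have : (b *: X) f p = (\sum_i X (x i) *: E (unit_rV i)) f p by rewrite bX.
  rewrite vfield_sumE vfield_scaleE bp mul1r => ->.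
  rewrite big1 // => i _; rewrite vfield_scaleE.
  by have := X0 i; rewrite !mxE => ->; rewrite mul0r.
Qed.

Lemma second_derivative_at_min (k k' : R -> R) (l d : R) : 0 < d ->
  (forall t, `|t| < d -> is_derive t (1 : R^o) k (k' t)) ->
  is_derive (0 : R) (1 : R^o) k' l -> (forall t, `|t| < d -> k 0 <= k t) ->
  k' 0 = 0 /\ 0 <= l.
Proof.
move=> d0 Dk Dk' kmin.
have k0 : k' 0 = 0.
  have D0 : `|0 : R| < d by rewrite normr0.
  have dd : - d <= d by lra.
  have Id t : t \in `](- d), d[ -> `|t| < d by rewrite in_itv ltr_norml.
  have H0 : is_derive (0 : R) (1 : R^o) k 0.
    apply: (derive1_at_min dd).
    - by move=> t /Id /Dk Dt; exact: (@ex_derive _ _ _ _ _ _ _ Dt).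
    - by rewrite in_itv /= oppr_lt0 d0.
    - by move=> t /Id; exact: kmin.
  by rewrite -(@derive_val _ _ _ _ _ _ _ (Dk 0 D0)) (@derive_val _ _ _ _ _ _ _ H0).
split=> //; rewrite leNgt; apply/negP => l0.
(* Otherwise [k'] is negative just to the right of [0], and [k] decreases. *)
have : \forall t \near (0 : R)^', t^-1 * k' t < 0.
  have := @ex_derive _ _ _ _ _ _ _ Dk'; have := @derive_val _ _ _ _ _ _ _ Dk'.
  rewrite /derive /derivable => El /cvgrPdist_lt; rewrite El.
  move=> /(_ (- l)); rewrite oppr_gt0 => /(_ l0); apply: filterS => t.
  rewrite /= k0 subr0 addr0 [t *: 1]mulr1 ltr_distlC => /andP[_].
  by rewrite subrr.
move=> /nbhs_ballP[e /= e0 He].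
pose s := Num.min e d / 2.
have s0 : 0 < s by rewrite divr_gt0// lt_min e0 d0.
have se : s < e /\ s < d.
  have : Num.min e d <= e by rewrite ge_min lexx.
  have : Num.min e d <= d by rewrite ge_min lexx orbT.
  by move: s0; rewrite /s; lra.
have sub t : t \in `[0, s] -> `|t| < d.
  by rewrite in_itv /= => /andP[t0 ts]; rewrite ger0_norm//; lra.
have [||t ts Ek] := @MVT R k k' 0 s s0.
- by move=> t /subset_itv_oo_cc /sub; exact: Dk.
- apply: derivable_within_continuous => t /sub /Dk Dt.
  exact: (@ex_derive _ _ _ _ _ _ _ Dt).
have sd : `|s| < d by rewrite ger0_norm; lra.
have := kmin s sd; rewrite -subr_ge0 Ek subr0 pmulr_lge0// leNgt => /negP; apply.
move: ts; rewrite in_itv /= => /andP[t0 ts].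
have := He t; rewrite /ball /= sub0r normrN gtr0_norm// => /(_ _ _).
rewrite pmulr_rlt0 ?invr_gt0//; apply; first by lra.
by rewrite gt_eqF.
Qed.

Lemma line_derivative (c : chart R m M) (a v : 'rV[R]_m) f (t : R) :
  matlas c -> ccod c (t *: v + a) ->
  is_derive t (1 : R^o) (fun s : R => f (cbwd c (s *: v + a)))
    ('D_v (f \o cbwd c) (t *: v + a)).
Proof.
move=> Mc ct; apply: (derive_line (f := f \o cbwd c)).
exact: (proj1 ((proj2 (chart_smooth f Mc 1)) v) _ ct).
Qed.

(** The field [Y] extends [X p] by a constant field of a chart, whose integral
    curves are straight; the one-variable test applies along them. *)
Lemma hessian_at_min (phi : cinf M) (p : M) : (forall q, phi p <= phi q) ->
  forall X, exists Y, [/\ vat Y p = vat X p, Y phi p = 0 & 0 <= Y (Y phi) p].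
Proof.
move=> pmin X.
have [c [r [E [x [b [[r0 Mc cp rc] bp EE bX Ex]]]]]] := local_frame p.
set a := cfwd c p in rc EE.
pose v : 'rV[R]_m := \row_i X (x i) p.
have pa : cbwd c a = p by rewrite cfwdK.
have ca : ccod c a by exact: cfwd_cod.
have a0 : `|a - a| < r by rewrite subrr normr0.
exists (E v).
have d0 : 0 < r / (`|v| + 1) by rewrite divr_gt0// ltr_wpDl.
have td (t : R) : `|t| < r / (`|v| + 1) -> `|t *: v + a - a| < r.
  rewrite ltr_pdivlMr ?ltr_wpDl// addrK normrZ; apply: le_lt_trans.
  by rewrite ler_wpM2l// lerDl.
have Dk t : `|t| < r / (`|v| + 1) -> is_derive t (1 : R^o)
    (fun s : R => phi (cbwd c (s *: v + a))) (E v phi (cbwd c (t *: v + a))).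
  move=> /td tv; rewrite EE//; apply: line_derivative => //; exact: rc.
have Dk0 : is_derive (0 : R) (1 : R^o) (fun s : R => E v phi (cbwd c (s *: v + a)))
    (E v (E v phi) p).
  have c0 : ccod c (0 *: v + a) by rewrite scale0r add0r.
  have := line_derivative (E v phi) Mc c0.
  by rewrite scale0r add0r -EE// pa.
have [] := @second_derivative_at_min (fun s : R => phi (cbwd c (s *: v + a)))
  (fun s : R => E v phi (cbwd c (s *: v + a))) _ _ d0 Dk Dk0.
  by move=> t _; rewrite scale0r add0r pa; exact: pmin.
rewrite scale0r add0r pa => H1 H2; split=> //.
apply: tangent_ext => f /=.
have E1 : (b *: X) f p = (\sum_i X (x i) *: E (unit_rV i)) f p by rewrite bX.
rewrite vfield_sumE vfield_scaleE bp mul1r in E1; rewrite E1.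
have [df dfE] := C1_differentiable (@ccod_open _ _ _ c) (chart_smooth f Mc 1) ca.
rewrite -pa EE// deriveE// dfE /gradient_form; apply: eq_bigr => i _.
by rewrite vfield_scaleE EE// mxE pa.
Qed.

(** The zero set of a solution of a homogeneous linear first-order system on a
    connected manifold is open (by Gronwall's argument along straight lines of
    charts) and closed. *)
Lemma linear_transport_unique f (theta : vfield M -> cinf M) (p0 : M) :
  (forall X, X f = theta X * f) -> f p0 = 0 -> forall p, f p = 0.
Proof.
move=> fE; apply: (@clopen_all (fun p => f p = 0)); last first.
  have cf := smooth_continuous (cinfP f).
  rewrite (_ : (fun p => f p = 0) = f @^-1` [set 0])//.
  by apply: preimage_closed => [p _|]; [exact: cf|exact: closed_eq].
rewrite openE => p fp.
have [c [r [E [x [b [[r0 Mc cp rc] bp EE bX Ex]]]]]] := local_frame p.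
set a := cfwd c p in rc EE.
have pa : cbwd c a = p by rewrite cfwdK.
have near_p : \forall q \near p, cdom c q /\ `|cfwd c q - a| < r.
  apply: open_nbhs_nbhs; split; first exact: (chart_image_open c (@rV_ball_open R m a r)).
  by split => //=; rewrite subrr normr0.
apply: filterS near_p => q [cq qr] /=.
set v := cfwd c q - a in qr.
have tr (t : R) : t \in `[0, 1] -> `|t *: v + a - a| < r.
  rewrite in_itv /= => /andP[t0 t1]; rewrite addrK normrZ ger0_norm//.
  by apply: le_lt_trans qr; rewrite ler_piMl.
pose k (t : R) := f (cbwd c (t *: v + a)).
pose th (t : R) := theta (E v) (cbwd c (t *: v + a)).
have Dk (t : R) : t \in `[0, 1] -> is_derive t (1 : R^o) k (th t * k t).
  move=> /tr tv; rewrite -[th t * k t]/((theta (E v) * f) (cbwd c (t *: v + a))) -fE EE//.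
  by apply: line_derivative => //; exact: rc.
have cth : {within `[0, 1], continuous th}.
  apply: continuous_in_subspaceT => t; rewrite inE => t01.
  apply: differentiable_continuous; apply/derivable1_diffP.
  have D := line_derivative (theta (E v)) Mc (rc _ (tr t t01)).
  exact: (@ex_derive _ _ _ _ _ _ _ D).
have [C Cmax] : exists C, forall t, t \in `[0, 1] -> th t <= C.
  by have [s _ smax] := EVT_max ler01 cth; exists (th s).
(* By Gronwall's argument [w] is nonnegative, zero at [0] and nonincreasing. *)
pose w (t : R) := k t ^+ 2 * expR (- (2 * C) * t).
pose dw (t : R) := 2 * (th t - C) * (k t ^+ 2 * expR (- (2 * C) * t)).
have Dw (t : R) : t \in `[0, 1] -> is_derive t (1 : R^o) w (dw t).
  move=> t01; have D := Dk t t01.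
  have De : is_derive t (1 : R^o) (fun t => expR (- (2 * C) * t))
      (expR (- (2 * C) * t) * - (2 * C)).
    apply: (@is_derive1_comp R expR (fun t => - (2 * C) * t)).
    by have := @is_deriveZ R R^o R^o id (- (2 * C)) t 1 1 (is_derive_id _ _); rewrite [_ *: 1]mulr1.
  have Dk2 := @is_deriveM _ _ _ _ _ _ _ _ D D.
  apply: (is_derive_eq (@is_deriveM _ _ _ _ _ _ _ _ Dk2 De)).
  have sE (u1 u2 : R) : u1 *: (u2 : R^o) = u1 * u2 by [].
  have key (u e h d : R) : u * u * (e * - (2 * d)) + e * (u * (h * u) + u * (h * u)) =
    2 * (h - d) * (u ^+ 2 * e) by ring.
  rewrite !sE /dw mulrfctE; exact: (key (k t) _ (th t) C).
have cw : {within `[0, 1], continuous w}.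
  apply: derivable_within_continuous => t /Dw Dt.
  exact: (@ex_derive _ _ _ _ _ _ _ Dt).
have Dw' (t : R) : t \in `]0, 1[ -> is_derive t (1 : R^o) w (dw t).
  by move=> t01; apply: Dw; exact: subset_itv_oo_cc.
have lt01 : (0 : R) < 1 by exact: ltr01.
have [t t01 Ew] := MVT lt01 Dw' cw.
have w0 : w 0 = 0 by rewrite /w /k scale0r add0r pa [f p]fp expr2 !mul0r.
have w1 : w 1 <= 0.
  have : w 1 - w 0 <= 0; last by rewrite w0 subr0.
  rewrite Ew subr0 mulr1 /dw; apply: mulr_le0_ge0.
    by rewrite pmulr_rle0// subr_le0; apply: Cmax; exact: subset_itv_oo_cc.
  by rewrite mulr_ge0 ?expR_ge0 ?exprn_even_ge0.
have : k 1 ^+ 2 <= 0 by move: w1; rewrite /w pmulr_lle0// expR_gt0.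
rewrite real_exprn_even_le0 ?num_real//= => /eqP.
by rewrite /k scale1r subrK cfwdK.
Qed.

End PointwiseConsequences.

(** * Complex-valued functions and forms *)

Section ComplexFunctions.
Context {R : realType} {m : nat} (M : manifold R m).
Implicit Types (f g : cinf M) (u v w : ccinf M) (X Y Z : vfield M).
Local Open Scope complex_scope.

Lemma ccinfDE u v p : (u + v) p = u p + v p. Proof. by []. Qed.
Lemma ccinfME u v p : (u * v) p = u p * v p. Proof. by []. Qed.
Lemma ccinfNE u p : (- u) p = - u p. Proof. by []. Qed.
Lemma ccinf0E p : (0 : ccinf M) p = 0. Proof. by []. Qed.
Lemma toCE f p : toC f p = (f p)%:C. Proof. by []. Qed.
Lemma iCE p : iC M p = 'i. Proof. by []. Qed.
Lemma conjCE u p : conjC u p = (u p)^*. Proof.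
have -> : conjC u p = Complex (complex.Re (u p)) (- complex.Im (u p)) by [].
by case: (u p).
Qed.

Lemma ccinf_sumE (J : Type) (r : seq J) (P : pred J) (F : J -> ccinf M) p :
  (\sum_(i <- r | P i) F i) p = \sum_(i <- r | P i) F i p.
Proof. by elim/big_rec2: _ => // i a b _ <-. Qed.

Lemma iC2 : iC M * iC M = -1.
Proof. by apply: ccinf_ext => p; rewrite ccinfME iCE -expr2 sqr_i. Qed.

Lemma toCD f g : toC (f + g) = toC f + toC g.
Proof. by apply: ccinf_ext => p; rewrite ccinfDE !toCE cinfE rmorphD. Qed.

Lemma toCM f g : toC (f * g) = toC f * toC g.
Proof.
apply: ccinf_ext => p; rewrite ccinfME !toCE cinfME.
by apply/eqP; rewrite eq_complex /= !mulr0 mul0r subr0 addr0 !eqxx.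
Qed.

Lemma toCN f : toC (- f) = - toC f.
Proof. by apply: ccinf_ext => p; rewrite ccinfNE !toCE cinfE rmorphN. Qed.

Lemma toC0 : toC (0 : cinf M) = 0.
Proof. exact: ccinf_ext. Qed.

Lemma toC1 : toC (1 : cinf M) = 1.
Proof. exact: ccinf_ext. Qed.

Lemma toC_half : toC (@Defs.half R m M) + toC Defs.half = 1.
Proof.
rewrite -toCD -toC1; congr toC; apply: cinf_ext => p.
by rewrite /Defs.half !cinfE; lra.
Qed.

Lemma mk_ccinfE f g : mk_ccinf f g = toC f + iC M * toC g.
Proof.
apply: ccinf_ext => p; rewrite ccinfDE ccinfME !toCE iCE /=.
by apply/eqP; rewrite eq_complex /=; apply/andP; split; apply/eqP; ring.
Qed.

Lemma toC_reim u : toC (re_cinf u) + iC M * toC (im_cinf u) = u.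
Proof. by rewrite -mk_ccinfE; apply: ccinf_ext => p /=; case: (u p). Qed.

Lemma conjCD u v : conjC (u + v) = conjC u + conjC v.
Proof. by apply: ccinf_ext => p; rewrite ccinfDE !conjCE ccinfDE rmorphD. Qed.

Lemma conjCM u v : conjC (u * v) = conjC u * conjC v.
Proof. by apply: ccinf_ext => p; rewrite ccinfME !conjCE ccinfME rmorphM. Qed.

Lemma conjCN u : conjC (- u) = - conjC u.
Proof. by apply: ccinf_ext => p; rewrite ccinfNE !conjCE ccinfNE rmorphN. Qed.

Lemma conjC_toC f : conjC (toC f) = toC f.
Proof. by apply: ccinf_ext => p; rewrite conjCE toCE conjc_real. Qed.

Lemma conjC_iC : conjC (iC M) = - iC M.
Proof.
apply: ccinf_ext => p; rewrite conjCE ccinfNE iCE.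
by apply/eqP; rewrite eq_complex /= oppr0 !eqxx.
Qed.

Lemma vactD X u v : vact X (u + v) = vact X u + vact X v.
Proof.
rewrite /vact !mk_ccinfE.
have -> : re_cinf (u + v) = re_cinf u + re_cinf v.
  by apply: cinf_ext => p; rewrite /= raddfD.
have -> : im_cinf (u + v) = im_cinf u + im_cinf v.
  by apply: cinf_ext => p; rewrite /= raddfD.
by rewrite !vfieldD !toCD; ring.
Qed.

Lemma vact_toC X f : vact X (toC f) = toC (X f).
Proof.
rewrite /vact mk_ccinfE; have -> : re_cinf (toC f) = f by apply: cinf_ext.
have -> : im_cinf (toC f) = cst_cinf M 0 by apply: cinf_ext.
by rewrite vfield_cst toC0 mulr0 addr0.
Qed.

Lemma vact_reim X f g : vact X (toC f + iC M * toC g) = toC (X f) + iC M * toC (X g).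
Proof.
rewrite -mk_ccinfE /vact mk_ccinfE; congr (toC (X _) + _ * toC (X _));
  exact: cinf_ext.
Qed.

Lemma vfieldN X f : X (- f) = - X f.
Proof.
have X0 : X 0 = 0.
  by have := vfield_cst X 0; congr (X _ = 0); exact: cinf_ext.
by apply/eqP; rewrite -addr_eq0; apply/eqP; rewrite -[RHS]X0 -(addNr f) vfieldD.
Qed.

Lemma vactM X u v : vact X (u * v) = u * vact X v + v * vact X u.
Proof.
rewrite -(toC_reim u) -(toC_reim v).
move: (re_cinf u) (im_cinf u) (re_cinf v) (im_cinf v) => a b c d.
have -> : (toC a + iC M * toC b) * (toC c + iC M * toC d) =
    toC (a * c - b * d) + iC M * toC (a * d + b * c).
  rewrite !toCD toCN !toCM; apply/eqP; rewrite -subr_eq0; apply/eqP.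
  transitivity ((iC M * iC M + 1) * (toC b * toC d)); first by ring.
  by rewrite iC2 addNr mul0r.
rewrite !vact_reim !vfieldD vfieldN !vfieldM !(toCD, toCN, toCM).
apply/eqP; rewrite -subr_eq0; apply/eqP.
transitivity (- (iC M * iC M + 1) * (toC b * toC (X d) + toC d * toC (X b))).
  by ring.
by rewrite iC2 addNr oppr0 mul0r.
Qed.

Lemma vact_iC X u : vact X (iC M * u) = iC M * vact X u.
Proof.
have iCE' : iC M = toC (cst_cinf M 0) + iC M * toC (cst_cinf M 1).
  apply: ccinf_ext => p; rewrite ccinfDE ccinfME !toCE iCE !cst_cinfE.
  by apply/eqP; rewrite eq_complex /=; apply/andP; split; apply/eqP; ring.
have X0 : vact X (iC M) = 0.
  by rewrite iCE' vact_reim !vfield_cst toC0 mulr0 addr0.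
by rewrite vactM X0 mulr0 addr0.
Qed.

Lemma vact0 X : vact X 0 = 0.
Proof.
have E : (0 : ccinf M) = toC (cst_cinf M 0) by exact: ccinf_ext.
by rewrite {1}E vact_toC vfield_cst toC0.
Qed.

Lemma vactN X u : vact X (- u) = - vact X u.
Proof. by apply/eqP; rewrite -addr_eq0 -vactD addNr vact0. Qed.

Lemma vact_lin X Y f u : vact (f *: X + Y) u = toC f * vact X u + vact Y u.
Proof.
rewrite /vact !mk_ccinfE.
have E h : (f *: X + Y) h = f * X h + Y h by [].
by rewrite !E !toCD !toCM; ring.
Qed.

Lemma vact_addl X Y u : vact (X + Y) u = vact X u + vact Y u.
Proof. by have := vact_lin X Y 1 u; rewrite scale1r toC1 mul1r. Qed.

Lemma vact_scalel X f u : vact (f *: X) u = toC f * vact X u.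
Proof.
rewrite /vact !mk_ccinfE.
have E h : (f *: X) h = f * X h by [].
by rewrite !E !toCM; ring.
Qed.

Lemma vact_conj X u : vact X (conjC u) = conjC (vact X u).
Proof.
rewrite -[u]toC_reim conjCD conjCM conjC_iC !conjC_toC.
have -> : - iC M * toC (im_cinf u) = - (iC M * toC (im_cinf u)) by rewrite mulNr.
rewrite !vactD vactN !vact_iC !vact_toC conjCD conjCM conjC_iC !conjC_toC.
by rewrite mulNr.
Qed.

End ComplexFunctions.

Section Forms.
Context {R : realType} {m : nat} (M : manifold R m).
Implicit Types (f : cinf M) (X Y Z : vfield M).

Section OneForm.
Variables (k : nat) (eta : cform M k).
Hypothesis feta : is_form eta.
Implicit Types (W : 'I_k -> vfield M).

Lemma formD W i Y Z :
  eta [eta W with i |-> Y + Z] = eta [eta W with i |-> Y] + eta [eta W with i |-> Z].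
Proof. by have := proj1 feta W i 1 Y Z; rewrite scale1r toC1 mul1r. Qed.

Lemma form_slot0 W i : eta [eta W with i |-> 0] = 0.
Proof.
have := formD W i 0 0; rewrite addr0 => /eqP.
by rewrite -subr_eq subrr eq_sym => /eqP.
Qed.

Lemma formZ W i f Y :
  eta [eta W with i |-> f *: Y] = toC f * eta [eta W with i |-> Y].
Proof. by have := proj1 feta W i f Y 0; rewrite addr0 form_slot0 addr0. Qed.

Lemma formN W i Y : eta [eta W with i |-> - Y] = - eta [eta W with i |-> Y].
Proof. by rewrite -scaleN1r formZ toCN toC1 mulN1r. Qed.

Lemma formB W i Y Z :
  eta [eta W with i |-> Y - Z] = eta [eta W with i |-> Y] - eta [eta W with i |-> Z].
Proof. by rewrite formD formN. Qed.

Lemma upd_id W i : [eta W with i |-> W i] = W :> ('I_k -> vfield M).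
Proof. by apply/funext => j /=; case: eqP => [->|]. Qed.

Lemma form_alt W i j : i != j -> W i = W j -> eta W = 0.
Proof. exact: (proj2 feta). Qed.

Lemma form_tperm W i j : i != j -> eta (fun l => W (tperm i j l)) = - eta W.
Proof.
move=> ij; have ji : j != i by rewrite eq_sym.
pose U Y Z : 'I_k -> vfield M := [eta [eta W with i |-> Y] with j |-> Z].
have UD1 Y Y' Z : eta (U (Y + Y') Z) = eta (U Y Z) + eta (U Y' Z).
  have E T : U T Z = [eta [eta W with j |-> Z] with i |-> T].
    by apply/funext => l; rewrite /U /=; case: (eqVneq l i) => [->|//]; rewrite (negbTE ij).
  by rewrite !E formD.
have UD2 Y Z Z' : eta (U Y (Z + Z')) = eta (U Y Z) + eta (U Y Z').
  exact: formD.
have UU Y : eta (U Y Y) = 0.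
  by apply: (form_alt ij); rewrite /U /= !eqxx; case: eqP.
have -> : (fun l => W (tperm i j l)) = U (W j) (W i).
  apply/funext => l; rewrite /U /=; case: tpermP => [->|->|/eqP/negbTE-> /eqP/negbTE->] //.
    by rewrite (negbTE ij) eqxx.
  by rewrite eqxx.
have -> : eta W = eta (U (W i) (W j)).
  congr eta; apply/funext => l; rewrite /U /=.
  by case: eqP => [->|_] //; case: eqP => [->|].
have := UU (W i + W j); rewrite UD1 !UD2 !UU add0r addr0 => /eqP.
by rewrite addrC addr_eq0 => /eqP.
Qed.

Lemma form_perm W (s : 'S_k) : eta (fun l => W (s l)) = (-1) ^+ s * eta W.
Proof.
have [ts -> dts] := prod_tpermP s.
elim: ts dts W => [_ W|[i j] ts IH /= /andP[ij dts] W].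
  rewrite big_nil odd_perm1 expr0 mul1r; congr eta.
  by apply/funext => l; rewrite perm1.
rewrite big_cons /=.
pose W' l := W ((\prod_(t <- ts) tperm t.1 t.2)%g l).
rewrite (_ : (fun l => _) = (fun l => W' (tperm i j l))); last first.
  by apply/funext => l; rewrite permM.
rewrite form_tperm// [eta W']IH// odd_permM odd_tperm ij signr_addb expr1.
by rewrite mulN1r mulNr.
Qed.

End OneForm.
End Forms.

(** * Forms of type (k,0) *)

Section Types.
Context {R : realType} {m : nat} (M : manifold R m).
Variable (I : {linear vfield M -> vfield M}).
Hypothesis II : forall X : vfield M, I (I X) = - X.
Implicit Types (f : cinf M) (Y Z : vfield M).

(** For a form, being of type [(k, 0)] means being complex linear in each slot. *)
Definition complex_linear k (eta : cform M k) : Prop :=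
  forall (W : 'I_k -> vfield M) i Y,
    eta [eta W with i |-> I Y] = iC M * eta [eta W with i |-> Y].

Lemma slots_scale k (F : cform M k) (V X : 'I_k -> vfield M) (c : 'I_k -> ccinf M)
    (s : seq 'I_k) : uniq s ->
  (forall (W : 'I_k -> vfield M) j, j \in s ->
     F [eta W with j |-> V j] = c j * F [eta W with j |-> X j]) ->
  F V = \prod_(j <- s) c j * F (fun j => if j \in s then X j else V j).
Proof.
elim: s => [|i s IH] /=; first by move=> _ _; rewrite big_nil mul1r.
move=> /andP[ns us] H; rewrite big_cons IH//; last first.
  by move=> W j js; apply: H; rewrite inE js orbT.
rewrite -mulrA mulrCA; congr (_ * _).
set W := (fun j => _).
have -> : W = [eta W with i |-> V i] :> ('I_k -> vfield M).
  apply/funext => j /=; case: (eqVneq j i) => [->|//].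
  by rewrite /W (negbTE ns).
rewrite H ?inE ?eqxx//; congr (_ * F _); apply/funext => j /=.
by rewrite inE; case: (eqVneq j i) => [->|].
Qed.

Lemma sum_sets_prod k (a b : 'I_k -> ccinf M) :
  \sum_(S : {set 'I_k}) \prod_j (if j \in S then a j else b j) = \prod_j (a j + b j).
Proof. by rewrite bigA_distr. Qed.

Lemma expr_card k (S : {set 'I_k}) (z : ccinf M) :
  z ^+ #|S| = \prod_j (if j \in S then z else 1).
Proof. by rewrite -big_mkcond prodr_const. Qed.

Notation hf := (toC (@Defs.half R m M)).

Lemma prod_pred (J : finType) (P : pred J) :
  \prod_j (P j)%:R = [forall j, P j]%:R :> ccinf M.
Proof.
case: forallP => [H|/forallP]; first by rewrite big1// => j _; rewrite H.
by rewrite negb_forall => /existsP[j /negbTE Pj]; rewrite (bigD1 j)//= Pj mul0r.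
Qed.

Section MixedType.
Variables (k : nat) (F : cform M k) (E : {set 'I_k}).
Hypothesis FZ : forall (W : 'I_k -> vfield M) i f Y,
  F [eta W with i |-> f *: Y] = toC f * F [eta W with i |-> Y].
Hypothesis FI : forall (W : 'I_k -> vfield M) i Y,
  F [eta W with i |-> I Y] = (-1) ^+ (i \in E) * iC M * F [eta W with i |-> Y].
Implicit Types (X : 'I_k -> vfield M) (T : {set 'I_k}).

(** A map that is complex linear in the slots outside [E] and antilinear in the
    slots in [E] only sees vectors of type (1,0) in the former and of type (0,1)
    in the latter. *)
Lemma cext_types X T :
  cext F (fun j => if j \in T then proj10 I (X j) else proj01 I (X j)) =
  (T == ~: E)%:R * F X.
Proof.
have FN W i Y : F [eta W with i |-> - Y] = - F [eta W with i |-> Y].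
  by rewrite -scaleN1r FZ toCN toC1 mulN1r.
pose V (S : {set 'I_k}) j : vfield M := if j \in S then
  (if j \in T then proj10 I (X j) else proj01 I (X j)).2 else
  (if j \in T then proj10 I (X j) else proj01 I (X j)).1.
have FV S : F (V S) = \prod_j (if j \in S then
    (-1) ^+ (j \in T) * hf * ((-1) ^+ (j \in E) * iC M) else hf) * F X.
  rewrite (@slots_scale _ F (V S) X (fun j => if j \in S then
    (-1) ^+ (j \in T) * hf * ((-1) ^+ (j \in E) * iC M) else hf) (index_enum _)).
  - by congr (_ * F _); apply/funext => j; rewrite mem_index_enum.
  - exact: index_enum_uniq.
  move=> W j _; rewrite /V; case: ifP => _; last by case: ifP => _; rewrite FZ.
  rewrite -[_ * _ * F _]mulrA -FI.
  case: ifP => _ /=; last by rewrite expr0 mul1r FZ.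
  by rewrite expr1 FN FZ mulN1r mulNr.
rewrite /cext -/V; under eq_bigr => S _ do rewrite [F _]FV expr_card mulrA -big_split /=.
rewrite -big_distrl /=; congr (_ * _).
rewrite (eq_bigr (fun S : {set 'I_k} => \prod_j (if j \in S then
    (-1) ^+ ((j \in T) (+) ~~ (j \in E)) * hf else hf))); last first.
  move=> S _; apply: eq_bigr => j _; case: ifP => _; last by rewrite mul1r.
  rewrite signr_addb; have := iC2 M; move: (iC M) hf ((-1) ^+ (j \in T)) => z h t z2.
  case: (j \in E); rewrite /= ?expr0 ?expr1.
    transitivity (- (z * z) * t * h); first by ring.
    by rewrite z2; ring.
  transitivity ((z * z) * t * h); first by ring.
  by rewrite z2; ring.
rewrite sum_sets_prod (eq_bigr (fun j => ((j \in T) == (j \notin E))%:R)); last first.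
  move=> j _; case: (j \in T) (j \in E) => [] [] /=; rewrite ?expr0 ?expr1 ?mul1r ?mulN1r;
    by rewrite ?addNr ?toC_half.
rewrite prod_pred; congr ((_ : bool)%:R); apply/forallP/eqP => [H|-> j].
  by apply/setP => j; rewrite inE (eqP (H j)).
by rewrite inE.
Qed.

Lemma hodge_part_mixed p X :
  hodge_part I p F X = if p == #|~: E| then F X else 0.
Proof.
rewrite /hodge_part; under eq_bigr do rewrite cext_types.
case: eqP => [->|pE].
  rewrite (bigD1 (~: E))//= eqxx mul1r big1 ?addr0// => T /andP[_ /negbTE->].
  by rewrite mul0r.
rewrite big1// => T /eqP Tp; case: eqP => [TE|_]; last by rewrite mul0r.
by case: pE; rewrite -Tp TE.
Qed.

End MixedType.

Lemma hodge_part_linear k (eta : cform M k) p X :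
  is_form eta -> complex_linear eta ->
  hodge_part I p eta X = if p == k then eta X else 0.
Proof.
move=> feta Ieta; rewrite (@hodge_part_mixed _ _ finset.set0).
- by rewrite finset.setC0 cardsT card_ord.
- by move=> W i f Y; exact: formZ.
- by move=> W i Y; rewrite inE expr0 mul1r Ieta.
Qed.

Lemma hodge_part_sum k (J : finType) (c : J -> ccinf M) (F : J -> cform M k) p X :
  hodge_part I p (fun X => \sum_j c j * F j X) X = \sum_j c j * hodge_part I p (F j) X.
Proof.
rewrite /hodge_part /cext; under [RHS]eq_bigr => j _ do rewrite mulr_sumr.
rewrite [RHS]exchange_big /=; apply: eq_bigr => T _.
under [RHS]eq_bigr => j _ do rewrite mulr_sumr.
rewrite [RHS]exchange_big /=; apply: eq_bigr => S _; rewrite mulr_sumr.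
by apply: eq_bigr => j _; rewrite mulrCA.
Qed.

Lemma hodge_part0 k (p : nat) (X : 'I_k -> vfield M) :
  hodge_part I p ((fun=> 0) : cform M k) X = 0.
Proof.
by rewrite /hodge_part big1// => T _; rewrite /cext big1// => S _; rewrite mulr0.
Qed.

Lemma hodge_type_linear k (eta : cform M k) : hodge_type I k 0 eta -> complex_linear eta.
Proof.
move=> [_ feta H] W i Y; rewrite -!H /hodge_part.
have E0 (T : {set 'I_k}) : (#|T| == k) = (T == finset.setT).
  apply/eqP/eqP => [Tk|->]; last by rewrite cardsT card_ord.
  by apply/eqP; rewrite eqEcard finset.subsetT cardsT card_ord Tk leqnn.
rewrite !(eq_bigl _ _ E0) !big_pred1_eq /cext mulr_sumr.
(* Exchanging [Y] for [I Y] in slot [i] amounts to exchanging the real and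
   imaginary parts of that argument. *)
pose fl (S : {set 'I_k}) : {set 'I_k} := finset (fun j => (j \in S) (+) (j == i)).
have flK : involutive fl.
  by move=> S; apply/setP => j; rewrite !inE addbK.
rewrite (reindex_inj (inv_inj flK)) /=; apply: eq_bigr => S _.
have hN Z : Defs.half *: I (I Z) = - (Defs.half *: Z) by rewrite II scalerN.
have fE (S' : {set 'I_k}) Z :
    (fun j => if j \in S' then
       (if j \in (finset.setT : {set 'I_k}) then proj10 I ([eta W with i |-> Z] j)
        else proj01 I ([eta W with i |-> Z] j)).2
     else (if j \in (finset.setT : {set 'I_k}) then proj10 I ([eta W with i |-> Z] j)
        else proj01 I ([eta W with i |-> Z] j)).1) =
    [eta (fun j => if j \in S' then - (Defs.half *: I (W j)) else Defs.half *: W j)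
      with i |-> if i \in S' then - (Defs.half *: I Z) else Defs.half *: Z]
      :> ('I_k -> vfield M).
  apply/funext => j; rewrite finset.in_setT /=.
  by case: (eqVneq j i) => [->|]; case: ifP.
rewrite !fE.
have updE (V V' : 'I_k -> vfield M) Z : (forall j, j != i -> V j = V' j) ->
    [eta V with i |-> Z] = [eta V' with i |-> Z] :> ('I_k -> vfield M).
  by move=> VV; apply/funext => j /=; case: eqVneq => // /VV.
rewrite (updE _ (fun j => if j \in S then - (Defs.half *: I (W j)) else Defs.half *: W j));
  last by move=> j ji; rewrite inE (negbTE ji) addbF.
rewrite inE eqxx addbT; case: (boolP (i \in S)) => iS /=.
  have -> : #|S| = #|fl S|.+1.
    have -> : fl S = (S :\ i)%SET.
      apply/setP => j; rewrite !inE; case: eqVneq => [->|_]; last by rewrite addbF.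
      by rewrite iS.
    by rewrite (cardsD1 i S) iS.
  rewrite formN// exprS mulrA mulrA iC2 mulrN -!mulNr opprK mul1r.
  done.
have -> : #|fl S| = #|S|.+1.
  have -> : fl S = (i |: S)%SET.
    apply/setP => j; rewrite !inE; case: eqVneq => [->|_]; last by rewrite addbF.
    by rewrite (negbTE iS).
  by rewrite cardsU1 iS.
by rewrite hN opprK exprS mulrA.
Qed.

End Types.

(** * Dolbeault operators and torsion-free connections *)

Lemma bump_commute (a b l : nat) : (a <= b)%N ->
  bump b.+1 (bump a l) = bump a (bump b l).
Proof. by rewrite /bump; lia. Qed.

Section Nabla.
Context {R : realType} {m : nat} (M : manifold R m).
Variable D : vfield M -> vfield M -> vfield M.
Hypothesis cD : connection D.
Implicit Types (f : cinf M) (Y Z : vfield M).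

Lemma connD X Y Z : D X (Y + Z) = D X Y + D X Z. Proof. by case: cD. Qed.
Lemma connM X f Y : D X (f *: Y) = (X f : cinf M) *: Y + f *: D X Y.
Proof. by case: cD. Qed.
Lemma conn_addl X Y Z : D (X + Y) Z = D X Z + D Y Z.
Proof. by have [H _ _] := cD; have := H 1 X Y Z; rewrite !scale1r. Qed.
Lemma conn0r X : D X 0 = 0.
Proof.
have := connD X 0 0; rewrite addr0 => /eqP.
by rewrite -subr_eq subrr eq_sym => /eqP.
Qed.
Lemma conn0l X : D 0 X = 0.
Proof.
have := conn_addl 0 0 X; rewrite addr0 => /eqP.
by rewrite -subr_eq subrr eq_sym => /eqP.
Qed.
Lemma conn_scalel f X Y : D (f *: X) Y = f *: D X Y.
Proof. by have [H _ _] := cD; have := H f X 0 Y; rewrite addr0 conn0l addr0. Qed.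
Lemma connN X Y : D X (- Y) = - D X Y.
Proof. by apply/eqP; rewrite -addr_eq0 -connD addNr conn0r. Qed.
Lemma connNl X Y : D (- X) Y = - D X Y.
Proof. by apply/eqP; rewrite -addr_eq0 -conn_addl addNr conn0l. Qed.

Lemma upd_swap k (W : 'I_k -> vfield M) i j Y Z : i != j ->
  [eta [eta W with i |-> Y] with j |-> Z] =
  [eta [eta W with j |-> Z] with i |-> Y] :> ('I_k -> vfield M).
Proof.
move=> ij; apply/funext => l /=; case: (eqVneq l j) => [->|//].
by rewrite eq_sym (negbTE ij).
Qed.

Lemma upd_same k (W : 'I_k -> vfield M) i Y Z :
  [eta [eta W with i |-> Y] with i |-> Z] = [eta W with i |-> Z] :> ('I_k -> vfield M).
Proof. by apply/funext => l /=; case: (eqVneq l i). Qed.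

Section OneForm.
Variables (k : nat) (eta : cform M k).
Hypothesis feta : is_form eta.

Lemma nabla_scalel f X W :
  nabla_form D (f *: X) eta W = toC f * nabla_form D X eta W.
Proof.
rewrite /nabla_form vact_scalel mulrBr mulr_sumr.
by congr (_ - _); apply: eq_bigr => i _; rewrite conn_scalel formZ.
Qed.

Lemma nablaNl X W : nabla_form D (- X) eta W = - nabla_form D X eta W.
Proof. by rewrite -scaleN1r nabla_scalel toCN toC1 mulN1r. Qed.

Lemma nabla_is_form X : is_form (nabla_form D X eta).
Proof.
split=> [W i f Y Z|W i j ij Wij].
  rewrite /nabla_form (proj1 feta) vactD vactM vact_toC mulrBr.
  rewrite (bigD1 i)//= [in RHS](bigD1 i)//= [X in _ = _ + (_ - X)](bigD1 i)//=.
  have E V : [eta [eta W with i |-> V] with i |-> D X ([eta W with i |-> V] i)] =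
      [eta W with i |-> D X V] :> ('I_k -> vfield M).
    by rewrite upd_same /= eqxx.
  rewrite !E connD connM (formD feta) (formD feta) !(formZ feta).
  set S := \sum_(_ | _) _; set S1 := \sum_(_ | _) _; set S2 := \sum_(_ | _) _.
  have -> : S = toC f * S1 + S2.
    rewrite mulr_sumr -big_split /=; apply: eq_bigr => j ji.
    have E' V : [eta [eta W with i |-> V] with j |-> D X ([eta W with i |-> V] j)] =
        [eta [eta W with j |-> D X (W j)] with i |-> V] :> ('I_k -> vfield M).
      by rewrite upd_swap 1?eq_sym//= (negbTE ji).
    by rewrite !E' (proj1 feta).
  ring.
rewrite /nabla_form (form_alt feta ij Wij) vact0 sub0r.
rewrite (bigD1 i)//= (bigD1 j) 1?eq_sym//= big1 => [|l /andP[li lj]]; last first.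
  apply: (form_alt feta ij) => /=.
  by rewrite ![_ == l]eq_sym (negbTE li) (negbTE lj).
have -> : [eta W with j |-> D X (W j)] =
    (fun l => [eta W with i |-> D X (W i)] (tperm i j l)) :> ('I_k -> vfield M).
  apply/funext => l /=; case: tpermP => [->|->|/eqP li /eqP lj].
  - by rewrite (negbTE ij) eq_sym (negbTE ij).
  - by rewrite eqxx eqxx Wij.
  - by rewrite (negbTE li) (negbTE lj).
by rewrite form_tperm// addr0 subrr oppr0.
Qed.

Lemma nabla_scale (h : ccinf M) X W :
  nabla_form D X (fun V => h * eta V) W = vact X h * eta W + h * nabla_form D X eta W.
Proof.
rewrite /nabla_form vactM mulrBr mulr_sumr; ring.
Qed.

Lemma nabla_complex_linear (I : {linear vfield M -> vfield M}) X :
  (forall X Y, D X (I Y) = I (D X Y)) -> complex_linear I eta ->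
  complex_linear I (nabla_form D X eta).
Proof.
move=> DI Ieta W i Y; rewrite /nabla_form Ieta vact_iC mulrBr mulr_sumr.
congr (_ - _); apply: eq_bigr => j _; case: (eqVneq j i) => [->|ji].
  by rewrite !upd_same /= eqxx DI Ieta.
have E' V : [eta [eta W with i |-> V] with j |-> D X ([eta W with i |-> V] j)] =
    [eta [eta W with j |-> D X (W j)] with i |-> V] :> ('I_k -> vfield M).
  by rewrite upd_swap 1?eq_sym//= (negbTE ji).
by rewrite !E' Ieta.
Qed.

End OneForm.
(** Torsion-freeness turns each bracket of Cartan's formula into a difference of
    covariant derivatives, which moves one argument to another slot. *)
Lemma ext_d_nabla k (eta : cform M k) X : torsion_free D -> is_form eta ->
  ext_d eta X = \sum_(i < k.+1) (-1) ^+ i *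
    nabla_form D (X i) eta (fun l => X (lift i l)).
Proof.
case: k eta X => [|k] eta X tD feta.
  rewrite /ext_d [X in _ + X]big1 ?addr0; last first.
    by move=> i _; rewrite big1// => j; rewrite !ord1.
  by apply: eq_bigr => i _; rewrite /nabla_form big_ord0 subr0.
(* [B j i V] has the arguments [X] without the [j]-th one, and [V] in place of
   the [i]-th one; moving [V] from one gap to the other costs a sign. *)
pose B (j i : 'I_k.+2) (V : vfield M) :=
  eta (fun l => if lift j l == i then V else X (lift j l)).
have Bswap (i j : 'I_k.+2) V : (i < j)%N ->
    (-1) ^+ j * B j i V = - ((-1) ^+ i * B i j V).
  move=> ij; have ji : j != i by apply/eqP => ji; move: ij; rewrite ji ltnn.
  have ij' : i != j by rewrite eq_sym.
  have [a ea _] := unlift_some ji; have [b eb _] := unlift_some ij'.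
  have Hab : (a : nat) = i /\ (b : nat).+1 = j.
    move: (congr1 val ea) (congr1 val eb); rewrite /= /bump.
    by case: leqP => ja; case: leqP => ib; rewrite ?add1n ?add0n => ? ?; split; lia.
  have lab (l : 'I_k) : lift j (lift a l) = lift i (lift b l).
    apply: val_inj; rewrite /=; case: Hab => [ai bj].
    by rewrite -ai -bj; apply: bump_commute; move: ij; rewrite -ai -bj.
  have -> : B j i V = (-1) ^+ (lift_perm a b 1) * B i j V.
    rewrite /B -(form_perm feta); congr eta; apply/funext => l.
    have [l' ->|->] := unliftP a l.
      rewrite lift_perm_lift perm1 lab.
      have /negbTE -> : lift i (lift b l') != i by rewrite eq_sym neq_lift.
      by have /negbTE -> : lift i (lift b l') != j by rewrite -lab eq_sym neq_lift.
    by rewrite lift_perm_id -ea -eb !eqxx.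
  rewrite odd_lift_perm odd_perm1 addbF.
  case: Hab => ai bj; rewrite -bj -ai exprS mulrA.
  have -> : -1 * (-1) ^+ b * (-1) ^+ (odd a (+) odd b) = - (-1) ^+ a :> ccinf M.
    rewrite signr_addb !signr_odd.
    have : ((-1) ^+ b * (-1) ^+ b : ccinf M) = 1.
      by rewrite -exprD addnn -signr_odd odd_double.
    move: ((-1) ^+ a) ((-1) ^+ b) => x y yy.
    by transitivity (- (y * y) * x); [ring|rewrite yy mulN1r].
  by rewrite mulNr.
pose T (i j : 'I_k.+2) := (-1) ^+ i * B i j (D (X i) (X j)).
rewrite /ext_d /nabla_form.
under [in RHS]eq_bigr => i _ do rewrite mulrBr.
rewrite [RHS]big_split /=; congr (_ + _).
have -> : \sum_(i < k.+2) - ((-1) ^+ i * \sum_(l < k.+1)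
    eta [eta (fun l => X (lift i l)) with l |-> D (X i) (X (lift i l))]) =
  \sum_(i < k.+2) \sum_(j < k.+2 | j != i) - T i j.
  apply: eq_bigr => i _; rewrite mulr_sumr -sumrN.
  rewrite [RHS]big_mkcond [RHS](bigD1_ord i)//= eqxx add0r.
  apply: eq_bigr => l _; rewrite eq_sym neq_lift /T /B; congr (- (_ * eta _)).
  by apply/funext => l' /=; rewrite (inj_eq lift_inj).
have -> : \sum_(i < k.+2) \sum_(j < k.+2 | (i < j)%N) (-1) ^+ j *
    eta (fun l => if lift j l == i then bracket (X i) (X j) else X (lift j l)) =
  \sum_(i < k.+2) \sum_(j < k.+2 | (i < j)%N) (- T i j - T j i).
  apply: eq_bigr => i _; apply: eq_bigr => j ij; rewrite -tD.
  have ji : j != i by apply/eqP => ji; move: ij; rewrite ji ltnn.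
  have [a ea _] := unlift_some ji.
  have E V : (fun l => if lift j l == i then V else X (lift j l)) =
      [eta (fun l => X (lift j l)) with a |-> V] :> ('I_k.+1 -> vfield M).
    by apply/funext => l /=; rewrite ea (inj_eq lift_inj).
  rewrite E formB// -!E mulrBr -/(B _ _ _) -/(B _ _ _) Bswap//.
have -> : \sum_(i < k.+2) \sum_(j < k.+2 | j != i) - T i j =
    \sum_(i < k.+2) \sum_(j < k.+2 | (i < j)%N) - T i j +
    \sum_(i < k.+2) \sum_(j < k.+2 | (j < i)%N) - T i j.
  rewrite -big_split; apply: eq_bigr => i _.
  rewrite (bigID (fun j : 'I_k.+2 => (i < j)%N)) /=.
  by congr (_ + _); apply: eq_bigl => j; rewrite -(inj_eq val_inj) /=; case: (ltngtP i j).
rewrite [X in _ = _ + X](exchange_big_dep xpredT)//= -big_split /=.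
by apply: eq_bigr => i _; rewrite -big_split.
Qed.

End Nabla.

Section Dolbeault.
Context {R : realType} {m : nat} (M : manifold R m).
Variables (I : {linear vfield M -> vfield M}) (D : vfield M -> vfield M -> vfield M).
Hypothesis II : forall X : vfield M, I (I X) = - X.
Hypothesis cD : connection D.
Hypothesis tD : torsion_free D.
Hypothesis DI : forall X Y, D X (I Y) = I (D X Y).
Variables (k : nat) (eta : cform M k).
Hypothesis feta : is_form eta.
Hypothesis Ieta : complex_linear I eta.

Notation hf := (toC (@Defs.half R m M)).

(** The parts of [nabla_X eta] that are complex linear and antilinear in [X]:
    antisymmetrized, they give [del eta] and [delbar eta]. *)
Definition nabla10 (X : vfield M) : cform M k := fun W =>
  hf * (nabla_form D X eta W - iC M * nabla_form D (I X) eta W).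
Definition nabla01 (X : vfield M) : cform M k := fun W =>
  hf * (nabla_form D X eta W + iC M * nabla_form D (I X) eta W).

Lemma nabla10_01 X W : nabla_form D X eta W = nabla10 X W + nabla01 X W.
Proof.
rewrite /nabla10 /nabla01; move: (nabla_form D X eta W) (nabla_form D (I X) eta W) => u v.
by transitivity ((hf + hf) * u); [rewrite toC_half mul1r|ring].
Qed.

Lemma nabla10_I X W : nabla10 (I X) W = iC M * nabla10 X W.
Proof.
rewrite /nabla10 II nablaNl//; move: (nabla_form D X eta W) (nabla_form D (I X) eta W) => u v.
apply/eqP; rewrite -subr_eq0; apply/eqP.
by transitivity (hf * (1 + iC M * iC M) * v); [ring|rewrite iC2 subrr mulr0 mul0r].
Qed.

Lemma nabla01_I X W : nabla01 (I X) W = - iC M * nabla01 X W.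
Proof.
rewrite /nabla01 II nablaNl//; move: (nabla_form D X eta W) (nabla_form D (I X) eta W) => u v.
apply/eqP; rewrite -subr_eq0; apply/eqP.
by transitivity (hf * (1 + iC M * iC M) * v); [ring|rewrite iC2 subrr mulr0 mul0r].
Qed.

Lemma nabla10_scale f X W : nabla10 (f *: X) W = toC f * nabla10 X W.
Proof. by rewrite /nabla10 linearZ /= !nabla_scalel//; ring. Qed.

Lemma nabla01_scale f X W : nabla01 (f *: X) W = toC f * nabla01 X W.
Proof. by rewrite /nabla01 linearZ /= !nabla_scalel//; ring. Qed.

(** The [i]-th argument is the direction of differentiation. *)
Definition insert_dir (G : vfield M -> cform M k) (i : 'I_k.+1) : cform M k.+1 :=
  fun X => G (X i) (fun l => X (lift i l)).

(** [E] tells whether [G] is antilinear in the direction of differentiation,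
    which decides the type of the inserted form. *)
Lemma hodge_part_insert (G : vfield M -> cform M k) (E : bool) i p X :
  (forall f X W, G (f *: X) W = toC f * G X W) ->
  (forall X W, G (I X) W = (-1) ^+ E * iC M * G X W) ->
  (forall X, is_form (G X)) -> (forall X, complex_linear I (G X)) ->
  hodge_part I p (insert_dir G i) X =
  if p == (if E then k else k.+1) then insert_dir G i X else 0.
Proof.
move=> GZ GI fG IG.
have lift_upd (W : 'I_k.+1 -> vfield M) (l : 'I_k) Y :
    (fun l' => [eta W with lift i l |-> Y] (lift i l')) =
    [eta (fun l' => W (lift i l')) with l |-> Y] :> ('I_k -> vfield M).
  by apply/funext => l' /=; rewrite (inj_eq lift_inj).
have i_upd (W : 'I_k.+1 -> vfield M) Y :
    (fun l' => [eta W with i |-> Y] (lift i l')) = (fun l' => W (lift i l')).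
  by apply/funext => l' /=; rewrite eq_sym (negbTE (neq_lift _ _)).
pose Es : {set 'I_k.+1} := if E then [set i]%SET else finset.set0.
rewrite (@hodge_part_mixed _ _ _ I _ _ Es).
- have -> // : #|~: Es| = if E then k else k.+1.
  rewrite /Es; case: (E); rewrite ?finset.setC0 ?cardsT ?card_ord//.
  by rewrite cardsC1 card_ord.
- move=> W j f Y; rewrite /insert_dir; have [l ->|->] := unliftP i j.
    by rewrite !lift_upd /= (negbTE (neq_lift _ _)) (formZ (fG _)).
  by rewrite !i_upd /= eqxx GZ.
- move=> W j Y; rewrite /insert_dir; have [l ->|->] := unliftP i j.
    rewrite !lift_upd /= (negbTE (neq_lift _ _)) IG /Es.
    case: (E); rewrite !inE ?[_ == i]eq_sym ?(negbTE (neq_lift _ _)) ?expr0 ?mul1r//.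
  rewrite !i_upd /= eqxx GI /Es; case: (E); rewrite !inE ?eqxx//.
Qed.

Lemma nabla10_form X : is_form (nabla10 X) /\ complex_linear I (nabla10 X).
Proof.
have F1 := nabla_is_form cD feta X; have F2 := nabla_is_form cD feta (I X).
have I1 := nabla_complex_linear X DI Ieta; have I2 := nabla_complex_linear (I X) DI Ieta.
rewrite /nabla10; split; first split.
- by move=> W i f Y Z; rewrite (proj1 F1) (proj1 F2); ring.
- by move=> W i j ij Wij; rewrite (form_alt F1 ij) ?(form_alt F2 ij)// mulr0 subrr mulr0.
- by move=> W i Y; rewrite I1 I2; ring.
Qed.

Lemma nabla01_form X : is_form (nabla01 X) /\ complex_linear I (nabla01 X).
Proof.
have F1 := nabla_is_form cD feta X; have F2 := nabla_is_form cD feta (I X).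
have I1 := nabla_complex_linear X DI Ieta; have I2 := nabla_complex_linear (I X) DI Ieta.
rewrite /nabla01; split; first split.
- by move=> W i f Y Z; rewrite (proj1 F1) (proj1 F2); ring.
- by move=> W i j ij Wij; rewrite (form_alt F1 ij) ?(form_alt F2 ij)// mulr0 addr0 mulr0.
- by move=> W i Y; rewrite I1 I2; ring.
Qed.

Lemma hodge_part_d p X : hodge_part I p (ext_d eta) X =
  if p == k.+1 then \sum_(i < k.+1) (-1) ^+ i * insert_dir nabla10 i X else
  if p == k then \sum_(i < k.+1) (-1) ^+ i * insert_dir nabla01 i X else 0.
Proof.
have -> : ext_d eta = (fun X => \sum_(i : 'I_k.+1) (-1) ^+ i *
    (fun Y => \sum_(b : bool) 1 * (if b then insert_dir nabla10 i else insert_dir nabla01 i) Y) X).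
  apply/funext => Y; rewrite (ext_d_nabla Y tD feta); apply: eq_bigr => i _.
  by rewrite big_bool /= !mul1r nabla10_01.
rewrite (hodge_part_sum I (fun i : 'I_k.+1 => (-1) ^+ i)).
have H (i : 'I_k.+1) : hodge_part I p (fun Y => \sum_(b : bool) 1 *
    (if b then insert_dir nabla10 i else insert_dir nabla01 i) Y) X =
    (if p == k.+1 then insert_dir nabla10 i X else 0) +
    (if p == k then insert_dir nabla01 i X else 0).
  rewrite (hodge_part_sum I (fun _ : bool => 1)) big_bool /= !mul1r; congr (_ + _).
    apply: (@hodge_part_insert _ false).
    - exact: nabla10_scale.
    - by move=> Y W; rewrite expr0 mul1r nabla10_I.
    - by move=> Y; have [] := nabla10_form Y.
    - by move=> Y; have [] := nabla10_form Y.
  apply: (@hodge_part_insert _ true).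
  - exact: nabla01_scale.
  - by move=> Y W; rewrite expr1 mulN1r nabla01_I.
  - by move=> Y; have [] := nabla01_form Y.
  - by move=> Y; have [] := nabla01_form Y.
under eq_bigr => i _ do rewrite H.
case: (eqVneq p k.+1) => [->|_].
  have /negbTE -> : k.+1 != k by rewrite gtn_eqF.
  by apply: eq_bigr => i _; rewrite addr0.
case: eqP => _; first by apply: eq_bigr => i _; rewrite add0r.
by rewrite big1// => i _; rewrite addr0 mulr0.
Qed.

Lemma hodge_part_form p : hodge_part I p eta = if p == k then eta else (fun=> 0).
Proof.
by apply/funext => X; rewrite hodge_part_linear//; case: ifP.
Qed.

Lemma ext_d0 j : ext_d ((fun=> 0) : cform M j) = (fun=> 0).
Proof.
apply/funext => X; rewrite /ext_d !big1 ?addr0//.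
  by move=> i _; rewrite big1// => l _; rewrite mulr0.
by move=> i _; rewrite vact0 mulr0.
Qed.

Lemma del_nabla X : del I eta X = \sum_(i < k.+1) (-1) ^+ i * insert_dir nabla10 i X.
Proof.
rewrite /del (bigD1 ord_max)//= hodge_part_form eqxx hodge_part_d eqxx [X in _ + X]big1 ?addr0//.
move=> p pm; rewrite hodge_part_form.
have /negbTE -> : p != k :> nat by move: pm; rewrite -(inj_eq val_inj).
by rewrite ext_d0 hodge_part0.
Qed.

Lemma delbar_nabla X : delbar I eta X = \sum_(i < k.+1) (-1) ^+ i * insert_dir nabla01 i X.
Proof.
rewrite /delbar (bigD1 ord_max)//= hodge_part_form eqxx hodge_part_d eqxx.
have /negbTE -> : k != k.+1 by rewrite ltn_eqF.
rewrite [X in _ + X]big1 ?addr0// => p pm; rewrite hodge_part_form.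
have /negbTE -> : p != k :> nat by move: pm; rewrite -(inj_eq val_inj).
by rewrite ext_d0 hodge_part0.
Qed.

End Dolbeault.

(** * Pfaffians *)

Lemma sum_fixing (V : nmodType) n (i0 : 'I_n.+1) (Q : 'S_n.+1 -> V) :
  \sum_(s : 'S_n.+1 | s i0 == i0) Q s = \sum_(t : 'S_n) Q (lift_perm i0 i0 t).
Proof.
pose low (s : 'S_n.+1) k := odflt k (unlift i0 (s (lift i0 k))).
have lowK (s : 'S_n.+1) k : s i0 == i0 -> lift i0 (low s k) = s (lift i0 k).
  move=> /eqP si; have : s (lift i0 k) != i0 by rewrite -{2}si (inj_eq perm_inj) eq_sym neq_lift.
  by rewrite /low eq_sym => /unlift_some[j -> ->].
have low_inj (s : 'S_n.+1) : s i0 == i0 -> injective (low s).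
  by move=> si k l /(congr1 (lift i0)); rewrite !lowK// => /perm_inj/lift_inj.
pose h (s : 'S_n.+1) : 'S_n :=
  if pselect (s i0 == i0) is left si then perm (low_inj s si) else 1%g.
have hE (s : 'S_n.+1) k : s i0 == i0 -> h s k = low s k.
  by rewrite /h; case: pselect => // si _; rewrite permE.
rewrite (reindex_onto (lift_perm i0 i0) h) => [|s si]; last first.
  apply/permP => k; case: (unliftP i0 k) => [l ->|->].
    by rewrite lift_perm_lift hE// lowK.
  by rewrite lift_perm_id (eqP si).
apply: eq_bigl => t; rewrite lift_perm_id eqxx; apply/eqP/permP => k.
by rewrite hE ?lift_perm_id// /low lift_perm_lift liftK.
Qed.

Section Pairs.
Variable n : nat.

Lemma ev_subproof (i : 'I_n) : (i.*2 < n.*2)%N.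
Proof. by rewrite ltn_double. Qed.
Lemma od_subproof (i : 'I_n) : (i.*2.+1 < n.*2)%N.
Proof. by rewrite ltn_Sdouble. Qed.
Definition ev (i : 'I_n) : 'I_(n.*2) := Ordinal (ev_subproof i).
Definition od (i : 'I_n) : 'I_(n.*2) := Ordinal (od_subproof i).

Lemma ev_inj : injective ev.
Proof. by move=> i j [/double_inj/val_inj]. Qed.
Lemma od_inj : injective od.
Proof. by move=> i j [/double_inj/val_inj]. Qed.
Lemma ev_neq_od i j : ev i != od j.
Proof.
apply/eqP => /(congr1 (fun l => odd (val l))) /=.
by rewrite !odd_double.
Qed.
Lemma ev_or_od (l : 'I_(n.*2)) : exists i, l = ev i \/ l = od i.
Proof.
have ln : (l./2 < n)%N by rewrite -ltn_double; have := ltn_ord l; lia.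
exists (Ordinal ln); case: (boolP (odd l)) => lo; [right|left]; apply: val_inj;
  by rewrite /= -[LHS]odd_double_half ?lo ?(negbTE lo).
Qed.
End Pairs.

Section Pfaffian.
Variables (K : comNzRingType) (T : Type) (w : T -> T -> K).
Hypothesis wN : forall x y, w x y = - w y x.

Definition pair_prod n (X : 'I_(n.*2) -> T) : K := \prod_(i < n) w (X (ev i)) (X (od i)).

Definition pf_term n (X : 'I_(n.*2) -> T) (s : 'S_(n.*2)) : K :=
  (-1) ^+ s * pair_prod (fun l => X (s l)).

(** The Pfaffian of the matrix of [w] on the [X l], times [2 ^ n * n`!]: the sum
    runs over all permutations instead of over perfect matchings. *)
Definition pf n (X : 'I_(n.*2) -> T) : K := \sum_(s : 'S_(n.*2)) pf_term X s.

Lemma pf_kernel n (X : 'I_(n.*2) -> T) l : (forall y, w (X l) y = 0) -> pf X = 0.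
Proof.
move=> H; apply: big1 => s _; rewrite /pf_term /pair_prod.
have [i [li|li]] := ev_or_od (s^-1 l)%g; rewrite (bigD1 i)//= -li permKV.
  by rewrite H mul0r mulr0.
by rewrite wN H oppr0 mul0r mulr0.
Qed.

(** Flipping a pair changes both the sign of the permutation and that of [w]. *)
Lemma pf_term_flip n (X : 'I_(n.*2) -> T) i s :
  pf_term X (tperm (ev i) (od i) * s) = pf_term X s.
Proof.
rewrite /pf_term odd_permM odd_tperm ev_neq_od signr_addb expr1 -!mulrA mulN1r -mulrN.
congr (_ * _); rewrite /pair_prod (bigD1 i)//= [in RHS](bigD1 i)//=.
rewrite !permM tpermL tpermR wN mulNr opprK; congr (_ * _).
apply: eq_bigr => j ji; rewrite !permM !tpermD//.
- by rewrite ev_neq_od.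
- by rewrite (inj_eq (@od_inj n)) eq_sym.
- by rewrite (inj_eq (@ev_inj n)) eq_sym.
- by rewrite eq_sym ev_neq_od.
Qed.

Lemma pf_term_swap n (X : 'I_(n.*2) -> T) i j s :
  pf_term X (tperm (ev i) (ev j) * tperm (od i) (od j) * s) = pf_term X s.
Proof.
rewrite /pf_term !odd_permM !odd_tperm (inj_eq (@ev_inj n)) (inj_eq (@od_inj n)).
rewrite addbb addFb; congr (_ * _); rewrite /pair_prod.
rewrite [RHS](reindex_inj (@perm_inj _ (tperm i j))) /=; apply: eq_bigr => l _.
rewrite !permM.
have od_fix k : tperm (ev i) (ev j) (od k) = od k.
  by rewrite tpermD// ev_neq_od.
have ev_fix k : tperm (od i) (od j) (ev k) = ev k.
  by rewrite tpermD// eq_sym ev_neq_od.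
have ev_t : tperm (ev i) (ev j) (ev l) = ev (tperm i j l).
  by rewrite (inj_tperm _ _ _ (@ev_inj n)).
have od_t : tperm (od i) (od j) (od l) = od (tperm i j l).
  by rewrite (inj_tperm _ _ _ (@od_inj n)).
by rewrite ev_t ev_fix od_fix od_t.
Qed.

Lemma ord_double_split n (j : 'I_(n.+1).*2) :
  [\/ j = ev ord0, j = od ord0 | exists l : 'I_(n.*2), j = rshift 2 l].
Proof.
have [j0|] := eqVneq (j : nat) 0%N; first by constructor 1; exact: val_inj.
have [j1|j1 j0] := eqVneq (j : nat) 1%N; first by constructor 2; exact: val_inj.
have jn : (j.-2 < n.*2)%N by have := ltn_ord j; lia.
by constructor 3; exists (Ordinal jn); apply: val_inj => /=; lia.
Qed.

(** A hyperbolic plane orthogonal to the other arguments splits off. *)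
Lemma pf_pair n (X : 'I_(n.+1).*2 -> T) :
  (forall l : 'I_(n.*2), w (X (ev ord0)) (X (rshift 2 l)) = 0) ->
  (forall x, w x x = 0) ->
  pf X = (n.+1).*2%:R * w (X (ev ord0)) (X (od ord0)) * pf (fun l => X (rshift 2 l)).
Proof.
move=> H wx.
pose e0 : 'I_(n.+1).*2 := ev ord0.
pose o0 : 'I_(n.+1).*2 := od ord0.
(* Permutations are sorted by the position of the first argument.  Each term is
   invariant under permuting the pairs and under flipping one of them, so all
   positions contribute equally. *)
pose g (l : 'I_(n.+1).*2) := \sum_(s : 'S_((n.+1).*2) | s l == e0) pf_term X s.
have -> : pf X = \sum_l g l.
  rewrite /pf (partition_big (fun s : 'S__ => (s^-1)%g e0) xpredT)//=.
  apply: eq_bigr => l _; apply: eq_bigl => s.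
  by apply/eqP/eqP => [<-|<-]; rewrite ?permKV ?permK.
have gev i : g (ev i) = g e0.
  rewrite /g [LHS](reindex_inj (mulgI (tperm (ev i) e0 * tperm (od i) o0)%g)) /=.
  under eq_bigr do rewrite pf_term_swap.
  apply: eq_bigl => s; rewrite !permM tpermL.
  by rewrite tpermD// eq_sym ev_neq_od.
have god i : g (od i) = g (ev i).
  rewrite /g [LHS](reindex_inj (mulgI (tperm (ev i) (od i)))) /=.
  under eq_bigr do rewrite pf_term_flip.
  by apply: eq_bigl => s; rewrite !permM tpermR.
have -> : \sum_l g l = (n.+1).*2%:R * g e0.
  rewrite (eq_bigr (fun=> g e0)); first by rewrite sumr_const card_ord mulr_natl.
  by move=> l _; have [i [->|->]] := ev_or_od l; rewrite ?god gev.
rewrite -mulrA; congr (_ * _); rewrite /g /pf mulr_sumr.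
rewrite (bigID (fun s : 'S__ => s o0 == o0)) /= [X in _ + X]big1 ?addr0; last first.
  move=> s /andP[/eqP se so]; rewrite /pf_term /pair_prod (bigD1 ord0)//= se.
  have [so'|so'|[l ->]] := ord_double_split (s o0).
  - by move/eqP: so'; rewrite -/e0 -se (inj_eq perm_inj) eq_sym (negbTE (ev_neq_od _ _)).
  - by rewrite so' eqxx in so.
  - by rewrite H mul0r mulr0.
rewrite (eq_bigl (fun s : 'S_((n.*2).+2) => (s ord0 == ord0) && (s (lift ord0 ord0) == lift ord0 ord0))); last first.
  have e0E : e0 = (ord0 : 'I_(n.*2).+2) by exact: val_inj.
  have o0E : o0 = (lift ord0 ord0 : 'I_(n.*2).+2) by exact: val_inj.
  by move=> s; rewrite e0E o0E.
rewrite big_mkcondr sum_fixing.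
rewrite (eq_bigr (fun t : 'S_((n.*2).+1) => if t ord0 == ord0 then
    pf_term X (lift_perm ord0 ord0 t : 'S_((n.+1).*2)) else 0)); last first.
  by move=> t _; rewrite lift_perm_lift (inj_eq lift_inj).
rewrite -big_mkcond sum_fixing; apply: eq_bigr => t _.
rewrite /pf_term !odd_lift_perm !addFb mulrCA; congr (_ * _).
rewrite /pair_prod big_ord_recl; congr (w (X _) (X _) * _).
- by rewrite (_ : ev ord0 = ord0 :> 'I_(n.*2).+2) ?lift_perm_id; apply: val_inj.
- rewrite (_ : od ord0 = lift ord0 ord0 :> 'I_(n.*2).+2); last exact: val_inj.
  by rewrite lift_perm_lift lift_perm_id.
apply: eq_bigr => i _; congr (w (X _) (X _)).
- rewrite (_ : ev (lift ord0 i) = lift ord0 (lift ord0 (ev i)) :> 'I_(n.*2).+2); last exact: val_inj.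
  by rewrite !lift_perm_lift; apply: val_inj.
- rewrite (_ : od (lift ord0 i) = lift ord0 (lift ord0 (od i)) :> 'I_(n.*2).+2); last exact: val_inj.
  by rewrite !lift_perm_lift; apply: val_inj.
Qed.

End Pfaffian.

(** * Powers of a 2-form *)

Section Wedge.
Context {R : realType} {m : nat} (M : manifold R m).
Implicit Types (Y Z : vfield M).

Definition wedge_term p q (a : cform M p) (b : cform M q) (X : 'I_(p + q) -> vfield M)
    (s : 'S_(p + q)) : ccinf M :=
  a (fun i => X (s (lshift q i))) * b (fun j => X (s (rshift p j))).

Lemma wedge_term_slot p q (a : cform M p) (b : cform M q) (X : 'I_(p + q) -> vfield M)
    (s : 'S_(p + q)) (i : 'I_(p + q)) :
  (exists W l c, forall Y, wedge_term a b [eta X with i |-> Y] s = a [eta W with l |-> Y] * c) \/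
  (exists W l c, forall Y, wedge_term a b [eta X with i |-> Y] s = c * b [eta W with l |-> Y]).
Proof.
have si : s (s^-1 i)%g = i by rewrite permKV.
case: (split_ordP (s^-1 i)%g) si => l -> si; [left|right].
  exists (fun i' => X (s (lshift q i'))), l, (b (fun j => X (s (rshift p j)))) => Y.
  rewrite /wedge_term; congr (a _ * b _); apply/funext => j /=.
    by rewrite -si (inj_eq perm_inj) (inj_eq (@lshift_inj _ _)).
  by rewrite -si (inj_eq perm_inj) eq_rlshift.
exists (fun i' => X (s (rshift p i'))), l, (a (fun j => X (s (lshift q j)))) => Y.
rewrite /wedge_term; congr (a _ * b _); apply/funext => j /=.
  by rewrite -si (inj_eq perm_inj) eq_lrshift.
by rewrite -si (inj_eq perm_inj) (inj_eq (@rshift_inj _ _)).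
Qed.

Lemma wedgeE p q (a : cform M p) (b : cform M q) X :
  wedge a b X = toC (cst_cinf M (p`! * q`!)%:R^-1) *
    \sum_(s : 'S_(p + q)) (-1) ^+ s * wedge_term a b X s.
Proof. by []. Qed.

Lemma ccinf_double0 (S : ccinf M) : S = - S -> S = 0.
Proof.
move=> SN; rewrite -[S]mul1r -toC_half mulrDl {2}SN mulrN subrr.
by [].
Qed.

Lemma wedge_is_form p q (a : cform M p) (b : cform M q) :
  is_form a -> is_form b -> is_form (wedge a b).
Proof.
move=> fa fb; split=> [X i f Y Z|X i j ij Xij].
  rewrite !wedgeE mulrCA -mulrDr; congr (_ * _); rewrite mulr_sumr -big_split /=.
  apply: eq_bigr => s _.
  have [[W [l [c E]]]|[W [l [c E]]]] := wedge_term_slot a b X s i; rewrite !E.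
    by rewrite (proj1 fa) mulrDl mulrDr -mulrA mulrCA.
  by rewrite (proj1 fb) !mulrDr (mulrCA c (toC f)) (mulrCA _ (toC f)).
rewrite wedgeE; set S := \sum_(_ | _) _; suff -> : S = 0 by rewrite mulr0.
apply: ccinf_double0; rewrite {1}/S (reindex_inj (mulIg (tperm i j))) /= -sumrN.
apply: eq_bigr => s _; rewrite odd_permM odd_tperm ij signr_addb expr1 mulrN1 mulNr.
congr (- (_ * _)); rewrite /wedge_term.
have E l : X ((s * tperm i j)%g l) = X (s l).
  by rewrite permM; case: tpermP => // ->.
by congr (a _ * b _); apply/funext => l; rewrite E.
Qed.

Lemma wedge_complex_linear (I : {linear vfield M -> vfield M}) p q
    (a : cform M p) (b : cform M q) :
  complex_linear I a -> complex_linear I b -> complex_linear I (wedge a b).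
Proof.
move=> Ia Ib X i Y; rewrite !wedgeE mulrCA; congr (_ * _); rewrite mulr_sumr.
apply: eq_bigr => s _.
have [[W [l [c E]]]|[W [l [c E]]]] := wedge_term_slot a b X s i; rewrite !E.
  by rewrite Ia -mulrA mulrCA.
by rewrite Ib (mulrCA c (iC M)) (mulrCA _ (iC M)).
Qed.

Lemma conjC_sum (J : finType) (F : J -> ccinf M) :
  conjC (\sum_j F j) = \sum_j conjC (F j).
Proof.
apply: big_morph; first exact: conjCD.
by apply: ccinf_ext => p; rewrite conjCE !ccinf0E rmorph0.
Qed.

Lemma conjC_sign (b : bool) : conjC ((-1) ^+ b) = (-1) ^+ b :> ccinf M.
Proof.
have c1 : conjC (1 : ccinf M) = 1 by rewrite -toC1 conjC_toC.
by case: b; rewrite ?expr0 ?expr1 ?conjCN c1.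
Qed.

Lemma wedge_real (J : {linear vfield M -> vfield M}) p q
    (a : cform M p) (b : cform M q) :
  real_form J a -> real_form J b -> real_form J (wedge a b).
Proof.
move=> ra rb X.
have -> : act_form J (conj_form (wedge a b)) X = conjC (wedge a b (fun i => J (X i))) by [].
rewrite !wedgeE conjCM conjC_toC.
congr (_ * _); rewrite conjC_sum; apply: eq_bigr => s _.
rewrite conjCM conjC_sign /wedge_term conjCM.
by congr (_ * (_ * _)); [rewrite -[RHS]ra|rewrite -[RHS]rb].
Qed.

Lemma form0_is_form (h : ccinf M) : is_form (form0 h).
Proof. by split=> [X []|X []]. Qed.

Lemma form0_complex_linear I (h : ccinf M) : complex_linear I (form0 h).
Proof. by move=> X []. Qed.

Lemma wedge_pow_is_form (w : cform M 2) n : is_form w -> is_form (wedge_pow w n).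
Proof.
move=> fw; elim: n => [|n IH]; first exact: form0_is_form.
exact: (wedge_is_form fw IH).
Qed.

Lemma wedge_pow_complex_linear I (w : cform M 2) n :
  complex_linear I w -> complex_linear I (wedge_pow w n).
Proof.
move=> fw; elim: n => [|n IH]; first exact: form0_complex_linear.
exact: (wedge_complex_linear fw IH).
Qed.

Lemma wedge_pow_real (J : {linear vfield M -> vfield M}) (w : cform M 2) n :
  real_form J w -> real_form J (wedge_pow w n).
Proof.
move=> fw; elim: n => [|n IH]; last exact: (wedge_real fw IH).
by move=> X; rewrite /act_form /conj_form /= /form0 -toC1 conjC_toC.
Qed.

Definition pairing (w : cform M 2) (p : M) (Y Z : vfield M) : R[i] :=
  w (fun i => if i == ord0 then Y else Z) p.

Lemma pairingE (w : cform M 2) (X : 'I_2 -> vfield M) p :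
  w X p = pairing w p (X ord0) (X ord_max).
Proof.
congr (w _ p); apply/funext => i; case: eqP => [->//|/eqP i0].
by congr X; apply: val_inj; case: i i0 => [[|[|//]]].
Qed.

Local Open Scope complex_scope.

Lemma signE (b : bool) (p : M) : ((-1) ^+ b : ccinf M) p = (-1) ^+ b.
Proof. by case: b; rewrite ?expr0 ?expr1. Qed.

(** The sums over permutations of nested wedge products are absorbed by the
    outermost one; each wedge with [w] contributes a factor [2^-1]. *)
Lemma wedge_pow_pf (w : cform M 2) n X p :
  wedge_pow w n X p = (2^-1 ^+ n)%:C * pf (pairing w p) X.
Proof.
elim: n X => [|n IH] X.
  rewrite /pf (big_pred1 1%g) => [|s]; last by apply/esym/eqP/permP => -[].
  by rewrite /pf_term /pair_prod big_ord0 odd_perm1 !expr0 !mulr1.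
have E (s : 'S_(2 + n.*2)) : wedge_term w (wedge_pow w n) X s p =
    (2^-1 ^+ n)%:C * \sum_(t : 'S_(n.*2)) (-1) ^+ t *
      (pairing w p (X (s (lshift _ ord0))) (X (s (lshift _ ord_max))) *
       pair_prod (pairing w p) (fun l => X (s (rshift 2 (t l))))).
  rewrite /wedge_term ccinfME pairingE IH mulrCA; congr (_ * _).
  rewrite /pf mulr_sumr; apply: eq_bigr => t _; rewrite /pf_term mulrCA.
  by [].
have -> : wedge_pow w n.+1 X p = (wedge w (wedge_pow w n) : cform M (2 + n.*2)) X p by [].
rewrite wedgeE.
rewrite ccinfME ccinf_sumE.
under eq_bigr => s _ do rewrite ccinfME signE E mulrCA mulr_sumr.
rewrite -mulr_sumr exchange_big.
(* A permutation of the arguments of [wedge_pow w n], extended by the identity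
   on the two arguments of [w]. *)
have up_id (t : 'S_(n.*2)) : exists u : 'S_(2 + n.*2), [/\ odd_perm u = t :> bool,
    u (lshift _ ord0) = lshift _ ord0, u (lshift _ ord_max) = lshift _ ord_max
    & forall l, u (rshift 2 l) = rshift 2 (t l)].
  exists (lift_perm ord0 ord0 (lift_perm ord0 ord0 t) : 'S_(n.*2).+2); split.
  - by rewrite !odd_lift_perm.
  - have -> : lshift (n.*2) (ord0 : 'I_2) = (ord0 : 'I_(n.*2).+2) by exact: val_inj.
    by rewrite lift_perm_id.
  - have -> : lshift (n.*2) (ord_max : 'I_2) = (lift ord0 ord0 : 'I_(n.*2).+2).
      exact: val_inj.
    by rewrite lift_perm_lift lift_perm_id.
  - move=> l.
    have shE j : rshift 2 j = (lift ord0 (lift ord0 j) : 'I_(n.*2).+2) by exact: val_inj.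
    by rewrite !shE !lift_perm_lift.
have Et (t : 'S_(n.*2)) : \sum_(s : 'S_(2 + n.*2)) (-1) ^+ s * ((-1) ^+ t *
      (pairing w p (X (s (lshift _ ord0))) (X (s (lshift _ ord_max))) *
       pair_prod (pairing w p) (fun l => X (s (rshift 2 (t l)))))) =
    pf (pairing w p) X.
  have [u [ut u0 u1 ul]] := up_id t.
  rewrite /pf [RHS](reindex_inj (mulgI u)) /=; apply: eq_bigr => s _.
  rewrite /pf_term odd_permM signr_addb mulrCA mulrA ut; congr (_ * _).
  have e0E : @ev n.+1 ord0 = (lshift (n.*2) (ord0 : 'I_2) : 'I_(2 + n.*2)) by exact: val_inj.
  have o0E : @od n.+1 ord0 = (lshift (n.*2) (ord_max : 'I_2) : 'I_(2 + n.*2)).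
    exact: val_inj.
  have eE i : @ev n.+1 (lift ord0 i) = (rshift 2 (ev i) : 'I_(2 + n.*2)) by exact: val_inj.
  have oE i : @od n.+1 (lift ord0 i) = (rshift 2 (od i) : 'I_(2 + n.*2)) by exact: val_inj.
  rewrite /pair_prod [in RHS]big_ord_recl e0E o0E !permM u0 u1; congr (_ * _).
  by apply: eq_bigr => i _; rewrite eE oE !permM !ul.
under eq_bigr => t _ do rewrite Et.
rewrite sumr_const card_Sn mulrA -[pf _ _ *+ _]mulr_natl mulrA; congr (_ * _).
rewrite toCE cst_cinfE; have n0 : ((n.*2)`!%:R : R) != 0 by rewrite pnatr_eq0 -lt0n fact_gt0.
have -> : ((n.*2)`!%:R : R[i]) = ((n.*2)`!%:R : R)%:C by rewrite rmorph_nat.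
rewrite -!rmorphM; congr (_%:C); rewrite natrM exprS (_ : 2`! = 2%N)//.
by field.
Qed.
End Wedge.

(** * Forms of top degree at a point *)

Section Pointwise.
Context {R : realType} {m : nat} (M : manifold R m).
Variables (I : {linear vfield M -> vfield M}) (p : M).
Implicit Types (f : cinf M) (Y Z : vfield M).
Local Open Scope complex_scope.

(** A complex covector at [p], given on vector fields. *)
Definition covector (G : vfield M -> R[i]) : Prop :=
  [/\ forall Y Z, G (Y + Z) = G Y + G Z,
      forall f Y, G (f *: Y) = (f p)%:C * G Y
    & forall Y, G (I Y) = 'i * G Y].

Lemma covector_vanish G Y : covector G -> vat Y p = 0 -> G Y = 0.
Proof.
move=> [GD GZ _]; apply: (tensor_vanish (G := G)) => // f X fp.
by rewrite GZ fp rmorph0 mul0r.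
Qed.

Lemma covector_eq G Y Z : covector G -> vat (Y - Z) p = 0 -> G Y = G Z.
Proof.
move=> cG YZ; have [GD _ _] := cG.
by rewrite -[Y](subrK Z) GD (covector_vanish cG YZ) add0r.
Qed.

Lemma form_covector k (eta : cform M k) (W : 'I_k -> vfield M) i :
  is_form eta -> complex_linear I eta ->
  covector (fun Y => eta [eta W with i |-> Y] p).
Proof.
move=> feta Ieta; split=> [Y Z|f Y|Y].
- by rewrite formD.
- by rewrite formZ// ccinfME toCE.
- by rewrite Ieta ccinfME iCE.
Qed.

Definition ccomb k (e : 'I_k -> vfield M) (a b : 'I_k -> R) : vfield M :=
  \sum_l (cst_cinf M (a l) *: e l + cst_cinf M (b l) *: I (e l)).

Lemma covector_ccomb k (e : 'I_k -> vfield M) a b G : covector G ->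
  G (ccomb e a b) = \sum_l ((a l)%:C + 'i * (b l)%:C) * G (e l).
Proof.
move=> [GD GZ GI].
have G0 : G 0 = 0.
  by rewrite -(scale0r (0 : vfield M)) GZ cinf0E rmorph0 mul0r.
rewrite /ccomb (big_morph G GD G0); apply: eq_bigr => l _.
by rewrite GD !GZ GI !cst_cinfE mulrDl mulrA (mulrC 'i).
Qed.

Section Basis.
Variables (k : nat) (beta : cform M k) (e : 'I_k -> vfield M).
Hypothesis mk : m = (k + k)%N.
Hypothesis fbeta : is_form beta.
Hypothesis Ibeta : complex_linear I beta.
Hypothesis beta_e : beta e p != 0.

Lemma slot_ccomb j a b :
  beta [eta e with j |-> ccomb e a b] p = ((a j)%:C + 'i * (b j)%:C) * beta e p.
Proof.
rewrite (covector_ccomb _ _ _ (form_covector e j fbeta Ibeta)) (bigD1 j)//= upd_id.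
rewrite big1 ?addr0// => l lj; rewrite (form_alt fbeta (i := j) (j := l)) ?mulr0//.
- by rewrite eq_sym.
- by rewrite /= eqxx (negbTE lj).
Qed.

(** Arguments on which a form of type (k,0) does not vanish are linearly
    independent over the complex numbers, hence form a basis if [k] is the
    complex dimension. *)
Lemma basis_span Y : exists a b, vat (Y - ccomb e a b) p = 0.
Proof.
have [cx [lft [cxD cxZ cxK cx0]]] := tangent_coords p.
have cx00 : cx 0 = 0 by rewrite -(scale0r (0 : vfield M)) cxZ cinf0E scale0r.
pose A : 'M[R]_(k + k, m) :=
  col_mx (\matrix_(l, j) cx (e l) ord0 j) (\matrix_(l, j) cx (I (e l)) ord0 j).
have AE (u : 'rV[R]_(k + k)) : u *m A =
    cx (ccomb e (fun l => u ord0 (lshift k l)) (fun l => u ord0 (rshift k l))).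
  rewrite -{1}[u]hsubmxK mul_row_col /ccomb (big_morph cx cxD cx00).
  apply/rowP => j; rewrite !mxE summxE -big_split /=; apply: eq_bigr => l _.
  by rewrite cxD !cxZ !cst_cinfE !mxE.
have fA : row_free A.
  apply: inj_row_free => u; rewrite AE => /cx0 H.
  apply/rowP => l; rewrite [in RHS]mxE.
  have Hj j : u ord0 (lshift k j) = 0 /\ u ord0 (rshift k j) = 0.
    have := slot_ccomb j (fun l => u ord0 (lshift k l)) (fun l => u ord0 (rshift k l)).
    rewrite (covector_vanish (form_covector e j fbeta Ibeta) H) => /esym/eqP.
    rewrite mulf_eq0 (negbTE beta_e) orbF eq_complex /= => /andP[/eqP h1 /eqP h2].
    by move: h1 h2; rewrite !mul0r !mulr0 !mul1r ?subr0 ?add0r ?addr0.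
  by case: (split_ordP l) => j ->; have [] := Hj j.
have /submxP[u uA] : (cx Y <= A)%MS.
  by apply: submx_full; move: fA; rewrite /row_free /row_full => /eqP ->; rewrite -mk.
exists (fun l => u ord0 (lshift k l)), (fun l => u ord0 (rshift k l)).
apply: cx0; have cxN Z : cx (- Z) = - cx Z.
  by apply/eqP; rewrite -addr_eq0 -cxD addNr cx00.
by rewrite cxD cxN -AE -uA subrr.
Qed.

(** In top degree the forms of type (k,0) at a point are a complex line: the
    difference of the two sides vanishes on the basis [e], hence everywhere,
    which is proved by replacing the arguments by basis vectors one at a time. *)
Lemma top_form_proportional (alpha : cform M k) X : is_form alpha -> complex_linear I alpha ->
  alpha X p * beta e p = alpha e p * beta X p.
Proof.
move=> falpha Ialpha; apply/eqP; rewrite -subr_eq0; apply/eqP.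
pose gam (W : 'I_k -> vfield M) := alpha W p * beta e p - alpha e p * beta W p.
have cgam W i : covector (fun Y => gam [eta W with i |-> Y]).
  have [a1 a2 a3] := form_covector W i falpha Ialpha.
  have [b1 b2 b3] := form_covector W i fbeta Ibeta.
  by split=> *; rewrite /gam ?a1 ?b1 ?a2 ?b2 ?a3 ?b3; ring.
suff H (s : seq 'I_k) W : (forall i, i \notin s -> exists l, W i = e l) -> gam W = 0.
  by apply: (H (enum 'I_k)) => i; rewrite mem_enum.
elim: s W => [|i s IH] W We.
  have [h hE] : exists h : 'I_k -> 'I_k, W = (fun i => e (h i)).
    have [h hE] := choice (fun i => We i isT).
    by exists h; apply/funext.
  have [hinj|hninj] := pselect (injective h).
    have -> : W = (fun i => e (perm hinj i)).
      by rewrite hE; apply/funext => i; rewrite permE.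
    rewrite /gam (form_perm falpha) (form_perm fbeta) !ccinfME; ring.
  have [i [j [ij hij]]] : exists i j, i != j /\ h i = h j.
    apply: contrapT => H; apply: hninj => i j hij; apply: contrapT => ij.
    by apply: H; exists i, j; split => //; exact/eqP.
  have Wij : W i = W j by rewrite hE hij.
  by rewrite /gam (form_alt falpha ij Wij) (form_alt fbeta ij Wij) !ccinf0E; ring.
have [a [b ab]] := basis_span (W i).
rewrite -[W](upd_id W i) (covector_eq (cgam W i) ab).
rewrite (covector_ccomb _ _ _ (cgam W i)) big1// => l _.
rewrite IH ?mulr0// => j js /=; case: eqVneq => [_|ji]; first by exists l.
by apply: We; rewrite inE negb_or ji.
Qed.

(** Replacing [e j] by [X] multiplies [beta e] by the [j]-th coordinate. *)
Lemma top_form_nondegenerate (X : vfield M) :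
  (forall j, beta [eta e with j |-> X] p = 0) -> vat X p = 0.
Proof.
move=> H; have [a [b ab]] := basis_span X.
have H0 j : a j = 0 /\ b j = 0.
  have := H j; rewrite (covector_eq (form_covector e j fbeta Ibeta) ab) slot_ccomb => /eqP.
  rewrite mulf_eq0 (negbTE beta_e) orbF eq_complex /= => /andP[/eqP h1 /eqP h2].
  by move: h1 h2; rewrite !mul0r !mulr0 !mul1r ?subr0 ?add0r ?addr0.
have E : ccomb e a b = 0.
  rewrite /ccomb big1// => j _; have [-> ->] := H0 j.
  have -> : cst_cinf M 0 = 0 by exact: cinf_ext.
  by rewrite !scale0r addr0.
by move: ab; rewrite E subr0.
Qed.

End Basis.
End Pointwise.

(** * Symmetric forms invariant under the quaternions *)

Section Hermitian.
Context {R : realType} {m : nat} (M : manifold R m).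
Variables (I J K : {linear vfield M -> vfield M}).
Hypothesis Q : forall X : vfield M,
  [/\ I (I X) = - X, J (J X) = - X, K (K X) = - X & I (J (K X)) = - X].
Implicit Types (X Y Z : vfield M).

Lemma quatII X : I (I X) = - X. Proof. by case: (Q X). Qed.
Lemma quatJJ X : J (J X) = - X. Proof. by case: (Q X). Qed.
Lemma quatKK X : K (K X) = - X. Proof. by case: (Q X). Qed.
Lemma quatIJK X : I (J (K X)) = - X. Proof. by case: (Q X). Qed.
Let II := quatII.
Let JJ := quatJJ.
Let KK := quatKK.
Let IJK := quatIJK.
Lemma quatJK X : J (K X) = I X.
Proof. by apply: oppr_inj; rewrite -II IJK linearN. Qed.
Lemma quatIJ X : I (J X) = K X.
Proof. by apply: oppr_inj; rewrite -[RHS]IJK KK !linearN. Qed.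
Lemma quatIK X : I (K X) = - J X.
Proof. by rewrite -quatIJ II. Qed.
Lemma quatJI X : J (I X) = - K X.
Proof. by rewrite -quatJK JJ. Qed.
Lemma quatKJ X : K (J X) = - I X.
Proof. by rewrite -quatIJ JJ linearN. Qed.
Lemma quatKI X : K (I X) = J X.
Proof. by rewrite -quatJK quatKJ quatIK opprK. Qed.

(** The algebra of a quaternionic Hermitian metric, without positivity. *)
Definition quaternionic_symmetric (g : vfield M -> vfield M -> cinf M) : Prop :=
  [/\ forall (f : cinf M) X Y Z, g (f *: X + Y) Z = f * g X Z + g Y Z,
      forall X Y, g X Y = g Y X
    & forall X Y, [/\ g (I X) (I Y) = g X Y, g (J X) (J Y) = g X Y
                & g (K X) (K Y) = g X Y]].

Section Metric.
Variable g : vfield M -> vfield M -> cinf M.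
Hypothesis qg : quaternionic_symmetric g.

Lemma metric_lin (f : cinf M) X Y Z : g (f *: X + Y) Z = f * g X Z + g Y Z.
Proof. by case: qg. Qed.
Lemma metricC X Y : g X Y = g Y X.
Proof. by case: qg. Qed.
Lemma metricD X Y Z : g (X + Y) Z = g X Z + g Y Z.
Proof. by have := metric_lin 1 X Y Z; rewrite scale1r mul1r. Qed.
Lemma metric0 Z : g 0 Z = 0.
Proof.
have := metricD 0 0 Z; rewrite addr0 => /eqP.
by rewrite -subr_eq subrr eq_sym => /eqP.
Qed.
Lemma metricZ (f : cinf M) X Z : g (f *: X) Z = f * g X Z.
Proof. by have := metric_lin f X 0 Z; rewrite addr0 metric0 addr0. Qed.
Lemma metricN X Z : g (- X) Z = - g X Z.
Proof. by apply/eqP; rewrite -addr_eq0 -metricD addNr metric0. Qed.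
Lemma metric_linr (f : cinf M) X Y Z : g Z (f *: X + Y) = f * g Z X + g Z Y.
Proof. by rewrite !(metricC Z) metric_lin. Qed.
Lemma metricNr X Z : g Z (- X) = - g Z X.
Proof. by rewrite !(metricC Z) metricN. Qed.

Lemma metricI X Y : g (I X) Y = - g X (I Y).
Proof.
have [_ _ H] := qg; have [<- _ _] := H X (I Y).
by rewrite II metricNr opprK.
Qed.
Lemma metricJ X Y : g (J X) Y = - g X (J Y).
Proof.
have [_ _ H] := qg; have [_ <- _] := H X (J Y).
by rewrite JJ metricNr opprK.
Qed.
Lemma metricK X Y : g (K X) Y = - g X (K Y).
Proof.
have [_ _ H] := qg; have [_ _ <-] := H X (K Y).
by rewrite KK metricNr opprK.
Qed.

Lemma mk_ccinf_lin (f a b c d : cinf M) :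
  mk_ccinf (f * a + b) (f * c + d) = toC f * mk_ccinf a c + mk_ccinf b d.
Proof. by rewrite !mk_ccinfE !(toCD, toCM); ring. Qed.

Lemma Omega_swap (X : 'I_2 -> vfield M) (Y : 'I_2 -> vfield M) :
  X ord0 = Y ord_max -> X ord_max = Y ord0 ->
  Omega_of J K g X = - Omega_of J K g Y.
Proof.
move=> H1 H2; rewrite /Omega_of H1 H2 !mk_ccinfE.
by rewrite !(metricC (Y ord_max)) metricJ metricK !toCN; ring.
Qed.

Definition I2_0 : 'I_2 := ord0.
Definition I2_1 : 'I_2 := ord_max.
Lemma I2_case (i : 'I_2) : i = I2_0 \/ i = I2_1.
Proof. by case: i => [[|[|//]] ?]; [left|right]; apply: val_inj. Qed.

Lemma Omega_diag (X : 'I_2 -> vfield M) : X ord0 = X ord_max -> Omega_of J K g X = 0.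
Proof.
by move=> XX; apply: ccinf_double0; exact: Omega_swap.
Qed.

Lemma Omega_is_form : is_form (Omega_of J K g).
Proof.
split=> [X i f Y Z|X i j ij Xij]; last first.
  by apply: Omega_diag; move: ij Xij;
    have [->|->] := I2_case i; have [->|->] := I2_case j => // _ ->.
rewrite /Omega_of; have [->|->] := I2_case i; rewrite /= -mk_ccinf_lin.
  by rewrite !metric_lin.
by rewrite !linearP !metric_linr.
Qed.

Lemma Omega_complex_linear : complex_linear I (Omega_of J K g).
Proof.
have jE (a b : cinf M) : iC M * mk_ccinf a b = mk_ccinf (- b) a.
  rewrite !mk_ccinfE toCN; apply/eqP; rewrite -subr_eq0; apply/eqP.
  by transitivity ((iC M * iC M + 1) * toC b); [ring|rewrite iC2 addNr mul0r].
move=> X i Y; rewrite /Omega_of; have [->|->] := I2_case i; rewrite /= jE.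
  by congr mk_ccinf; rewrite metricI ?quatIJ ?quatIK ?metricNr ?opprK.
by congr mk_ccinf; rewrite ?quatJI ?quatKI ?metricNr.
Qed.

Lemma Omega_real : real_form J (Omega_of J K g).
Proof.
move=> X; rewrite /act_form /conj_form /Omega_of.
have -> : conjC (mk_ccinf (g (J (X ord0)) (J (J (X ord_max))))
    (g (J (X ord0)) (K (J (X ord_max))))) =
  mk_ccinf (g (J (X ord0)) (J (J (X ord_max)))) (- g (J (X ord0)) (K (J (X ord_max)))).
  rewrite !mk_ccinfE conjCD conjCM !conjC_toC conjC_iC toCN; ring.
congr mk_ccinf; first by have [_ _ H] := qg; have [_ -> _] := H (X ord0) (J (X ord_max)).
by rewrite quatKJ metricNr opprK metricJ quatJI metricNr opprK.
Qed.

Local Open Scope complex_scope.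

Lemma pairing_Omega p X Y :
  pairing (Omega_of J K g) p X Y = (g X (J Y) p) +i* (g X (K Y) p).
Proof. by []. Qed.

Lemma pairing_anti p X Y :
  pairing (Omega_of J K g) p X Y = - pairing (Omega_of J K g) p Y X.
Proof.
rewrite /pairing (@Omega_swap _ (fun i => if i == ord0 then Y else X))//.
Qed.

End Metric.
End Hermitian.

(** * Top powers and non-degeneracy *)

Section TopPower.
Context {R : realType} {n : nat} (M : manifold R (4 * n)).
Variables (I J K : {linear vfield M -> vfield M}).
Hypothesis Q : forall X : vfield M,
  [/\ I (I X) = - X, J (J X) = - X, K (K X) = - X & I (J (K X)) = - X].
Variable g : vfield M -> vfield M -> cinf M.
Hypothesis qg : quaternionic_symmetric I J K g.
Variable p : M.
Hypothesis g_def : forall X, g X X p = 0 -> vat X p = 0.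
Implicit Types (X Y Z : vfield M).

Definition quaternionic_orthogonal Z Y : Prop :=
  [/\ g Z Y p = 0, g (I Z) Y p = 0, g (J Z) Y p = 0 & g (K Z) Y p = 0].

Lemma quaternionic_orthogonalJ Z Y :
  quaternionic_orthogonal Z Y -> quaternionic_orthogonal Z (J Y).
Proof.
move=> [g1 gI gJ gK].
have E X : g X (J Y) p = - g (J X) Y p.
  by rewrite (metricJ Q qg) cinfNE opprK.
split; rewrite E.
- by rewrite gJ oppr0.
- by rewrite (quatJI Q) (metricN qg) cinfNE gK oppr0 oppr0.
- by rewrite (quatJJ Q) (metricN qg) cinfNE g1 !oppr0.
- by rewrite (quatJK Q) gI oppr0.
Qed.

(** Fewer than [n] quaternionic lines leave room for a vector orthogonal to them,
    because [4 * l] linear equations in [4 * n] unknowns have a solution. *)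
Lemma orthogonal_vector (l : nat) (e : 'I_l -> vfield M) : (l < n)%N ->
  exists2 y, vat y p <> 0 & forall i, quaternionic_orthogonal (e i) y.
Proof.
move=> ln; have [cx [lft [cxD cxZ cxK cx0]]] := tangent_coords p.
have cx00 : cx 0 = 0 by rewrite -(scale0r (0 : vfield M)) cxZ cinf0E scale0r.
pose bas j := lft (delta_mx ord0 j).
pose y (v : 'rV[R]_(4 * n)) : vfield M := \sum_j cst_cinf M (v ord0 j) *: bas j.
pose B (z : 'I_l -> vfield M) : 'M[R]_(4 * n, l) := \matrix_(j, i) g (z i) (bas j) p.
have gy Z v : g Z (y v) p = \sum_j v ord0 j * g Z (bas j) p.
  rewrite (metricC qg) (big_morph (fun T => g T Z) (fun T T' => metricD qg T T' Z) (metric0 qg Z)).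
  rewrite cinf_sumE; apply: eq_bigr => j _.
  by rewrite (metricZ qg) cinfME cst_cinfE (metricC qg).
have BE z v i : (v *m B z) ord0 i = g (z i) (y v) p.
  by rewrite gy mxE; apply: eq_bigr => j _; rewrite mxE.
pose A := row_mx (row_mx (B e) (B (fun i => I (e i))))
  (row_mx (B (fun i => J (e i))) (B (fun i => K (e i)))).
have : kermx A != 0.
  rewrite -mxrank_eq0 mxrank_ker subn_eq0 -ltnNge.
  by apply: leq_ltn_trans (rank_leq_col _) _; lia.
move=> /rowV0Pn[v /sub_kermxP vA v0].
have : v *m A = row_mx (row_mx 0 0) (row_mx 0 0) by rewrite vA !row_mx0.
rewrite !mul_mx_row => /eq_row_mx[/eq_row_mx[v1 vI] /eq_row_mx[vJ vK]].
exists (y v) => [yv|i]; last first.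
  split.
  - by have := BE e v i; rewrite v1 mxE.
  - by have := BE (fun i => I (e i)) v i; rewrite vI mxE.
  - by have := BE (fun i => J (e i)) v i; rewrite vJ mxE.
  - by have := BE (fun i => K (e i)) v i; rewrite vK mxE.
move/eqP: v0; apply; apply/rowP => j; rewrite [RHS]mxE.
have cxy : cx (y v) = v.
  rewrite /y (big_morph cx cxD cx00) [RHS]row_sum_delta.
  by apply: eq_bigr => i _; rewrite cxZ cst_cinfE cxK.
have : cx (y v) = 0.
  apply: (tensor_vanish (G := cx)) yv => // f X fp.
  by rewrite cxZ fp scale0r.
by rewrite cxy => ->; rewrite mxE.
Qed.

Local Open Scope complex_scope.

(** By induction on [k]: a non-zero vector [y] orthogonal to the lines already chosen
    spans with [J y] a hyperbolic plane for the pairing, which splits off. *)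
Lemma orthogonal_pf (k l : nat) (e : 'I_l -> vfield M) : (l + k = n)%N ->
  exists2 Y : 'I_(k.*2) -> vfield M,
    (forall i j, quaternionic_orthogonal (e i) (Y j))
    & pf (pairing (Omega_of J K g) p) Y != 0.
Proof.
elim: k l e => [|k IH] l e lk.
  exists (fun=> 0) => [i []//|].
  rewrite /pf (big_pred1 1%g) => [|s]; last by apply/esym/eqP/permP => -[].
  by rewrite /pf_term /pair_prod big_ord0 odd_perm1 expr0 mulr1 oner_neq0.
have [|y y0 ey] := @orthogonal_vector l e; first by rewrite -lk; lia.
pose e' (i : 'I_l.+1) : vfield M := if unlift ord_max i is Some i' then e i' else y.
have [|Y eY pfY] := IH l.+1 e'; first by rewrite -lk addSnnS.
have yY j : quaternionic_orthogonal y (Y j).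
  by have := eY ord_max j; rewrite /e' unlift_none.
have eY' i j : quaternionic_orthogonal (e i) (Y j).
  by have := eY (lift ord_max i) j; rewrite /e' liftK.
pose X (j : 'I_(2 + k.*2)) : vfield M := match fintype.split j with
  | inl a => if a == ord0 then y else J y
  | inr b => Y b end.
have X0 : X (@ev k.+1 ord0) = y.
  have -> : @ev k.+1 ord0 = (lshift (k.*2) (ord0 : 'I_2) : 'I_(2 + k.*2)) by exact: val_inj.
  by rewrite /X (unsplitK (inl _)).
have X1 : X (@od k.+1 ord0) = J y.
  have -> : @od k.+1 ord0 = (lshift (k.*2) (ord_max : 'I_2) : 'I_(2 + k.*2)).
    exact: val_inj.
  by rewrite /X (unsplitK (inl _)).
have X2 j : X (rshift 2 j) = Y j by rewrite /X (unsplitK (inr _)).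
exists (X : 'I_(k.+1.*2) -> vfield M) => [i j|].
  have -> : X j = (match fintype.split (j : 'I_(2 + k.*2)) with
    | inl a => if a == ord0 then y else J y | inr b => Y b end) by [].
  case: fintype.split => [a|b]; last exact: eY'.
  by case: ifP => _; [exact: ey|exact: quaternionic_orthogonalJ].
rewrite pf_pair.
- rewrite !mulf_neq0 //.
  + rewrite X0 X1 pairing_Omega eq_complex /= negb_and (quatJJ Q) (metricNr qg) cinfNE oppr_eq0.
    by apply/orP; left; apply/eqP => /g_def.
  + suff -> : (fun l => X (rshift 2 l)) = Y by [].
    by apply/funext => j; rewrite X2.
- by move=> Z W; exact: (pairing_anti Q qg).
- move=> j; rewrite X0 X2 pairing_Omega; have [_ _ gJ gK] := yY j.
  have -> : g y (J (Y j)) p = 0.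
    by rewrite -[LHS]opprK -cinfNE -(metricJ Q qg) gJ oppr0.
  have -> : g y (K (Y j)) p = 0.
    by rewrite -[LHS]opprK -cinfNE -(metricK Q qg) gK oppr0.
  by [].
- move=> Z; have := pairing_anti Q qg p Z Z.
  by move/eqP; rewrite -addr_eq0 -mulr2n mulrn_eq0 /= => /eqP.
Qed.

Lemma power_nonzero : exists W, wedge_pow (Omega_of J K g) n W p != 0.
Proof.
have [|Y _ pfY] := @orthogonal_pf n 0 (fun=> 0); first by rewrite add0n.
exists Y; rewrite wedge_pow_pf mulf_neq0//.
by rewrite eq_complex /= negb_and expf_neq0// invr_neq0.
Qed.

End TopPower.

(** A vector in the kernel of [g] is in the kernel of the 2-form and of its
    powers. *)
Lemma power_nondegenerate {R : realType} {n : nat} (M : manifold R (4 * n))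
    (I J K : {linear vfield M -> vfield M}) (g : vfield M -> vfield M -> cinf M) p e :
  (forall X : vfield M,
    [/\ I (I X) = - X, J (J X) = - X, K (K X) = - X & I (J (K X)) = - X]) ->
  quaternionic_symmetric I J K g -> wedge_pow (Omega_of J K g) n e p != 0 ->
  forall X, (forall Y, g X Y p = 0) -> vat X p = 0.
Proof.
move=> Q qg ep X gX.
have mk : (4 * n = n.*2 + n.*2)%N by lia.
apply: (@top_form_nondegenerate _ _ _ I p _ _ e mk _ _ ep).
- exact/wedge_pow_is_form/(Omega_is_form Q qg).
- exact/wedge_pow_complex_linear/(Omega_complex_linear Q qg).
move=> j; rewrite wedge_pow_pf (@pf_kernel _ _ _ _ _ _ j) ?mulr0//.
  by move=> Y Z; exact: (pairing_anti Q qg).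
by move=> Y; rewrite /= eqxx pairing_Omega !gX.
Qed.

(** * Curvature and the square of del *)

Section Curvature.
Context {R : realType} {m : nat} (M : manifold R m).
Variables (I : {linear vfield M -> vfield M}) (D : vfield M -> vfield M -> vfield M).
Hypothesis II : forall X : vfield M, I (I X) = - X.
Hypothesis cD : connection D.
Hypothesis tD : torsion_free D.
Hypothesis DI : forall X Y, D X (I Y) = I (D X Y).
Variable eta : cform M 1.
Hypothesis feta : is_form eta.
Hypothesis Ieta : complex_linear I eta.
Implicit Types (X Y Z : vfield M).

Notation hf := (toC (@Defs.half R m M)).
Notation i_ := (iC M).

Lemma jacobi X Y Z :
  bracket X (bracket Y Z) + bracket Y (bracket Z X) + bracket Z (bracket X Y) = 0.
Proof.
apply: vfield_ext => f p.
have E U V W : bracket U (bracket V W) f p =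
    U (V (W f)) p - U (W (V f)) p - (V (W (U f)) p - W (V (U f)) p).
  have -> : bracket U (bracket V W) f =
    U (V (W f) - W (V f)) - (V (W (U f)) - W (V (U f))) by [].
  by rewrite vfieldD vfieldN.
have -> : (bracket X (bracket Y Z) + bracket Y (bracket Z X) + bracket Z (bracket X Y)) f p =
  bracket X (bracket Y Z) f p + bracket Y (bracket Z X) f p + bracket Z (bracket X Y) f p by [].
by rewrite !E; transitivity (0 : R); first by ring.
Qed.

Lemma vact_bracket X Y u :
  vact X (vact Y u) - vact Y (vact X u) = vact (D X Y) u - vact (D Y X) u.
Proof.
have -> : vact (D X Y) u - vact (D Y X) u = vact (bracket X Y) u.
  rewrite -tD vact_addl; congr (_ + _).
  by rewrite -scaleN1r vact_scalel toCN toC1 mulN1r.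
rewrite -[u]toC_reim !vact_reim.
have E f : bracket X Y f = X (Y f) - Y (X f) by [].
by rewrite !E !toCD !toCN; ring.
Qed.

(** The next definitions unfold a 1-form: its values, its curvature term
    [eta (R(X, Y) Z)], and its first and second covariant derivatives. *)
Definition ev1 Y := eta (fun=> Y).

Lemma ev1E (W : 'I_1 -> vfield M) : eta W = ev1 (W ord0).
Proof. by congr eta; apply/funext => j; rewrite ord1. Qed.

Lemma ev1_upd (W : 'I_1 -> vfield M) j Y : eta [eta W with j |-> Y] = ev1 Y.
Proof. by congr eta; apply/funext => l /=; rewrite !ord1 eqxx. Qed.

Lemma ev1D Y Z : ev1 (Y + Z) = ev1 Y + ev1 Z.
Proof. by have := formD feta (fun=> 0) ord0 Y Z; rewrite !ev1_upd. Qed.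
Lemma ev1N Y : ev1 (- Y) = - ev1 Y.
Proof. by have := formN feta (fun=> 0) ord0 Y; rewrite !ev1_upd. Qed.
Lemma ev1I Y : ev1 (I Y) = i_ * ev1 Y.
Proof. by have := Ieta (fun=> 0) ord0 Y; rewrite !ev1_upd. Qed.
Lemma ev1Z f Y : ev1 (f *: Y) = toC f * ev1 Y.
Proof. by have := formZ feta (fun=> 0) ord0 f Y; rewrite !ev1_upd. Qed.

Definition curv1 X Y Z := ev1 (D X (D Y Z)) - ev1 (D Y (D X Z)) - ev1 (D (bracket X Y) Z).

(** First Bianchi identity: without torsion the cyclic sum of [R(X, Y) Z] is the
    cyclic sum in the Jacobi identity. *)
Lemma bianchi X Y Z : curv1 X Y Z + curv1 Y Z X + curv1 Z X Y = 0.
Proof.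
have /(congr1 ev1) := jacobi X Y Z.
have -> : ev1 0 = 0 by rewrite -(scale0r (0 : vfield M)) ev1Z toC0 mul0r.
rewrite !ev1D -!tD !(connD cD, connN cD, conn_addl cD, connNl cD, ev1D, ev1N).
rewrite /curv1 -!tD !(conn_addl cD, connNl cD, ev1D, ev1N).
by move=> <-; ring.
Qed.

Definition nabla1 X Y := vact X (ev1 Y) - ev1 (D X Y).
Definition nabla1_10 X Y := hf * (nabla1 X Y - i_ * nabla1 (I X) Y).
Definition nabla1_2 X Y Z := vact X (nabla1 Y Z) - nabla1 (D X Y) Z - nabla1 Y (D X Z).

(** Ricci identity: the derivatives of [eta] in the directions [D X Y] and [D Y X]
    combine to the bracket, because there is no torsion. *)
Lemma ricci X Y Z : nabla1_2 X Y Z - nabla1_2 Y X Z = - curv1 X Y Z.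
Proof.
rewrite /nabla1_2 /nabla1 /curv1 -tD !vactD !vactN !(conn_addl cD, connNl cD, ev1D, ev1N).
have := vact_bracket X Y (ev1 Z); move/eqP; rewrite subr_eq => /eqP ->.
ring.
Qed.

Lemma del_one_form W :
  del I eta W = nabla1_10 (W ord0) (W ord_max) - nabla1_10 (W ord_max) (W ord0).
Proof.
rewrite (del_nabla II cD tD DI)// !big_ord_recl big_ord0 addr0.
have E X V : nabla_form D X eta V = nabla1 X (V ord0).
  by rewrite /nabla_form big_ord_recl big_ord0 addr0 ev1_upd ev1E.
rewrite /insert_dir /nabla10 !E expr0 mul1r expr1 mulN1r.
by congr (nabla1_10 _ (W _) - nabla1_10 (W _) (W _)); exact: val_inj.
Qed.

Lemma nabla1D X X' Y : nabla1 (X + X') Y = nabla1 X Y + nabla1 X' Y.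
Proof. by rewrite /nabla1 vact_addl conn_addl// ev1D; ring. Qed.
Lemma nabla1Dr X Y Y' : nabla1 X (Y + Y') = nabla1 X Y + nabla1 X Y'.
Proof. by rewrite /nabla1 ev1D vactD connD// ev1D; ring. Qed.
Lemma nabla1Z f X Y : nabla1 (f *: X) Y = toC f * nabla1 X Y.
Proof. by rewrite /nabla1 vact_scalel conn_scalel// ev1Z; ring. Qed.
Lemma nabla1Zr f X Y : nabla1 X (f *: Y) = toC f * nabla1 X Y.
Proof. by rewrite /nabla1 ev1Z vactM vact_toC connM// ev1D !ev1Z; ring. Qed.
Lemma nabla1Ir X Y : nabla1 X (I Y) = i_ * nabla1 X Y.
Proof. by rewrite /nabla1 ev1I vact_iC DI ev1I; ring. Qed.

Lemma nabla1_10_I X Y : nabla1_10 (I X) Y = i_ * nabla1_10 X Y.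
Proof.
rewrite /nabla1_10 II -scaleN1r nabla1Z toCN toC1.
apply/eqP; rewrite -subr_eq0; apply/eqP.
transitivity ((i_ * i_ + 1) * (hf * nabla1 (I X) Y)); first by ring.
by rewrite iC2 addNr mul0r.
Qed.

Lemma del_one_form_is_form : is_form (del I eta).
Proof.
have L f X Y Z : nabla1_10 (f *: X + Y) Z = toC f * nabla1_10 X Z + nabla1_10 Y Z.
  by rewrite /nabla1_10 linearP !nabla1D !nabla1Z; ring.
have Lr f X Y Z : nabla1_10 Z (f *: X + Y) = toC f * nabla1_10 Z X + nabla1_10 Z Y.
  by rewrite /nabla1_10 !nabla1Dr !nabla1Zr; ring.
split=> [W i f Y Z|W i j ij Wij].
  rewrite !del_one_form; have [->|->] := I2_case i; rewrite /= !L !Lr; ring.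
rewrite del_one_form; move: ij Wij.
by have [->|->] := I2_case i; have [->|->] := I2_case j => //= _ ->; rewrite subrr.
Qed.

Lemma del_one_form_complex_linear : complex_linear I (del I eta).
Proof.
have Lr X Y : nabla1_10 X (I Y) = i_ * nabla1_10 X Y by rewrite /nabla1_10 !nabla1Ir; ring.
move=> W i Y.
by rewrite !del_one_form; have [->|->] := I2_case i; rewrite /= nabla1_10_I Lr; ring.
Qed.

(** The second derivative in the (1,0)-parts of [X] and [Y]. *)
Definition nabla1_1010 X Y Z := hf * hf * (nabla1_2 X Y Z - i_ * nabla1_2 X (I Y) Z -
  i_ * nabla1_2 (I X) Y Z + i_ * i_ * nabla1_2 (I X) (I Y) Z).

Lemma nabla10_del X (V : 'I_2 -> vfield M) :
  nabla10 I D (del I eta) X V = nabla1_1010 X (V ord0) (V ord_max) - nabla1_1010 X (V ord_max) (V ord0).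
Proof.
have vh Y u : vact Y (hf * u) = hf * vact Y u.
  by rewrite vactM vact_toC vfield_cst toC0 mulr0 addr0.
have E Y : nabla_form D Y (del I eta) V =
    hf * (nabla1_2 Y (V ord0) (V ord_max) - i_ * nabla1_2 Y (I (V ord0)) (V ord_max)) -
    hf * (nabla1_2 Y (V ord_max) (V ord0) - i_ * nabla1_2 Y (I (V ord_max)) (V ord0)).
  have sum2 (G : 'I_2 -> ccinf M) : \sum_i G i = G ord0 + G ord_max.
    rewrite !big_ord_recl big_ord0 addr0; congr (_ + G _); exact: val_inj.
  rewrite /nabla_form sum2.
  rewrite !del_one_form /= /nabla1_10 /nabla1_2.
  have vn U A A' B B' : vact U (hf * (A - i_ * A') - hf * (B - i_ * B')) =
      hf * (vact U A - i_ * vact U A') - hf * (vact U B - i_ * vact U B').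
    by rewrite vactD vactN !vh !(vactD _ A) !(vactD _ B) !vactN !vact_iC.
  by rewrite vn !DI; ring.
rewrite /nabla10 !E /nabla1_1010; ring.
Qed.

(** Both derivatives taken in directions of type (1,0), the commutator is the
    curvature on vectors of type (1,0), and Bianchi's identity applies. *)
Lemma del_del_one_form W : del I (del I eta) W = 0.
Proof.
rewrite (del_nabla II cD tD DI del_one_form_is_form del_one_form_complex_linear).
pose o0 : 'I_3 := ord0; pose o1 : 'I_3 := lift ord0 ord0; pose o2 : 'I_3 := ord_max.
have E (i a b : 'I_3) : lift i ord0 = a -> lift i ord_max = b ->
    insert_dir (nabla10 I D (del I eta)) i W = nabla1_1010 (W i) (W a) (W b) - nabla1_1010 (W i) (W b) (W a).
  by move=> <- <-; rewrite /insert_dir nabla10_del.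
have sum3 (G : 'I_3 -> ccinf M) :
    \sum_(i < 3) (-1) ^+ i * G i = G o0 - G o1 + G o2.
  rewrite !big_ord_recl big_ord0 addr0 expr0 mul1r -addrA; congr (_ + (_ + _)).
    by rewrite expr1 mulN1r.
  rewrite (_ : lift ord0 (lift ord0 ord0) = o2); last exact: val_inj.
  by rewrite expr2 mulrNN !mul1r.
rewrite (sum3 (fun i => insert_dir _ i W)).
rewrite (E o0 o1 o2) ?(E o1 o0 o2) ?(E o2 o0 o1); try exact: val_inj.
move: (W o0) (W o1) (W o2) => X Y Z.
pose C (U V V' : vfield M) := curv1 U V V' - i_ * curv1 U (I V) V' - i_ * curv1 (I U) V V' +
  i_ * i_ * curv1 (I U) (I V) V'.
have TC U V V' : nabla1_1010 U V V' - nabla1_1010 V U V' = - (hf * hf) * C U V V'.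
  rewrite /C; have r a b := ricci a b V'.
  have H a b : curv1 a b V' = nabla1_2 b a V' - nabla1_2 a b V' by rewrite -opprB r opprK.
  rewrite !H /nabla1_1010; ring.
have CI : C X Y Z + C Y Z X + C Z X Y = 0.
  have B a b c := bianchi a b c.
  have curvI a b c : curv1 a b (I c) = i_ * curv1 a b c.
    by rewrite /curv1 !DI !ev1I; ring.
  (* Bianchi's identity for the (1,0)-parts of [X], [Y] and [Z], expanded into
     eight real identities; [1 - i_ * i_ = 2] comes from the third argument. *)
  have Q : (1 - i_ * i_) * (C X Y Z + C Y Z X + C Z X Y) = 0.
    have b0 := B X Y Z; have b1 := B (I X) Y Z; have b2 := B X (I Y) Z.
    have b3 := B X Y (I Z); have b4 := B (I X) (I Y) Z; have b5 := B X (I Y) (I Z).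
    have b6 := B (I X) Y (I Z); have b7 := B (I X) (I Y) (I Z).
    rewrite !curvI in b1 b2 b3 b4 b5 b6 b7; rewrite /C.
    rewrite -[RHS](mulr0 0).
    transitivity (0 - i_ * 0 - i_ * 0 - i_ * 0 + i_ * i_ * 0 + i_ * i_ * 0 + i_ * i_ * 0
      - i_ * i_ * i_ * 0 : ccinf M); last by rewrite !mulr0 !subr0 !addr0.
    rewrite -{1}b0 -{1}b1 -{1}b2 -{1}b3 -{1}b4 -{1}b5 -{1}b6 -{1}b7; ring.
  rewrite iC2 opprK in Q.
  set c := _ + _ + _ in Q *.
  have : hf * ((1 + 1) * c) = c by rewrite mulrDl mul1r mulrDr -mulrDl toC_half mul1r.
  by rewrite Q mulr0.
transitivity (- (hf * hf) * (C X Y Z + C Y Z X + C Z X Y)); last by rewrite CI mulr0.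
have key (k a b c : ccinf M) : k * (a + b + c) = k * a + k * b + k * c by ring.
rewrite key -!TC; ring.
Qed.

End Curvature.

(** * The Hessian of a function *)

Section Hessian.
Context {R : realType} {m : nat} (M : manifold R m).
Variables (I J K : {linear vfield M -> vfield M}) (D : vfield M -> vfield M -> vfield M).
Hypothesis Q : forall X : vfield M,
  [/\ I (I X) = - X, J (J X) = - X, K (K X) = - X & I (J (K X)) = - X].
Hypothesis cD : connection D.
Hypothesis tD : torsion_free D.
Hypothesis DI : forall X Y, D X (I Y) = I (D X Y).
Hypothesis DJ : forall X Y, D X (J Y) = J (D X Y).
Hypothesis DK : forall X Y, D X (K Y) = K (D X Y).
Variable phi : cinf M.
Implicit Types (f : cinf M) (X Y Z : vfield M).

Notation hf := (toC (@Defs.half R m M)).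

Definition hessian X Y : cinf M := X (Y phi) - D X Y phi.

Lemma hessianC X Y : hessian X Y = hessian Y X.
Proof.
have : D X Y phi - D Y X phi = X (Y phi) - Y (X phi).
  have -> : D X Y phi - D Y X phi = (D X Y - D Y X) phi by [].
  by rewrite tD.
rewrite /hessian => H; apply/eqP; rewrite -subr_eq0; apply/eqP.
transitivity (X (Y phi) - Y (X phi) - (D X Y phi - D Y X phi)); first by ring.
by rewrite H subrr.
Qed.

Lemma hessian_lin f X Y Z : hessian (f *: X + Y) Z = f * hessian X Z + hessian Y Z.
Proof.
rewrite /hessian (conn_addl cD) (conn_scalel cD).
have E (U V : vfield M) h : (f *: U + V) h = f * U h + V h :> cinf M by [].
by rewrite !E; ring.
Qed.

Lemma hessianN X Z : hessian (- X) Z = - hessian X Z.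
Proof.
have H0 : hessian 0 Z = 0.
  have := hessian_lin 1 0 0 Z; rewrite scale1r addr0 mul1r => /eqP.
  by rewrite -subr_eq subrr eq_sym => /eqP.
have := hessian_lin (-1) X 0 Z.
by rewrite addr0 H0 addr0 scaleN1r mulN1r.
Qed.
Lemma hessianNr X Z : hessian Z (- X) = - hessian Z X.
Proof. by rewrite hessianC hessianN hessianC. Qed.

Definition qhessian X Y : cinf M := Defs.half * Defs.half *
  (hessian X Y + hessian (I X) (I Y) + hessian (J X) (J Y) + hessian (K X) (K Y)).

Lemma qhessian_symmetric : quaternionic_symmetric I J K qhessian.
Proof.
split.
- by move=> f X Y Z; rewrite /qhessian !linearP !hessian_lin; ring.
- by move=> X Y; rewrite /qhessian (hessianC X) (hessianC (I X)) (hessianC (J X)) (hessianC (K X)).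
- move=> X Y; rewrite /qhessian !(quatII Q, quatJJ Q, quatKK Q, quatIJ Q, quatIK Q, quatJI Q,
    quatJK Q, quatKI Q, quatKJ Q, hessianN, hessianNr, opprK).
  by split; ring.
Qed.

Lemma del_J_function W : del_J I J (form0 (toC phi)) W =
  hf * (toC (J (W ord0) phi) + iC M * toC (K (W ord0) phi)).
Proof.
rewrite /del_J.
have -> : act_form J (form0 (toC phi)) = form0 (toC phi) by [].
rewrite {1}/act_form (delbar_nabla (quatII Q) cD tD DI (form0_is_form _))//; last first.
  exact: form0_complex_linear.
rewrite big_ord_recl big_ord0 addr0 expr0 mul1r /insert_dir /nabla01 /nabla_form !big_ord0 !subr0.
by rewrite !vact_toC (quatIJ Q).
Qed.

Lemma del_J_function_form :
  is_form (del_J I J (form0 (toC phi))) /\ complex_linear I (del_J I J (form0 (toC phi))).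
Proof.
split; first split.
- move=> W i f Y Z; rewrite !del_J_function /= !ord1 eqxx !linearP.
  have E (U V : vfield M) h : (f *: U + V) h = f * U h + V h :> cinf M by [].
  by rewrite !E !toCD !toCM; ring.
- by move=> W i j; rewrite !ord1 eqxx.
- move=> W i Y; rewrite !del_J_function /= !ord1 eqxx (quatJI Q) (quatKI Q).
  have -> : (- K Y) phi = - (K Y phi) by [].
  rewrite toCN; move: (toC (J Y phi)) (toC (K Y phi)) => a b.
  apply/eqP; rewrite -subr_eq0; apply/eqP.
  by transitivity (- hf * (iC M * iC M + 1) * b); [ring|rewrite iC2 addNr mulr0 mul0r].
Qed.

(** The 1-form [del_J phi] differentiates [phi] along [J Y] and [K Y]; its
    (1,0)-derivative, antisymmetrized, collects the values of the Hessian on the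
    pairs of arguments rotated by [1], [I], [J] and [K]. *)
Lemma ddJ_qhessian W : ddJ I J phi W = Omega_of J K qhessian W.
Proof.
have [fe Ie] := del_J_function_form.
rewrite /ddJ (del_one_form (quatII Q) cD tD DI fe Ie).
have nE X Y : nabla1 D (del_J I J (form0 (toC phi))) X Y =
    hf * (toC (hessian X (J Y)) + iC M * toC (hessian X (K Y))).
  rewrite /nabla1 /ev1 !del_J_function vactM vact_toC vfield_cst toC0 mulr0 addr0.
  rewrite vactD vact_iC !vact_toC -DJ -DK /hessian !toCD !toCN; ring.
rewrite /nabla1_10 !nE /Omega_of mk_ccinfE /qhessian.
move: (W ord0) (W ord_max) => X Y.
rewrite !(quatII Q, quatJJ Q, quatKK Q, quatIJ Q, quatIK Q, quatJI Q,
    quatJK Q, quatKI Q, quatKJ Q, hessianN, hessianNr).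
rewrite !(hessianC Y) !(hessianC (I Y)).
move: (hessian X (J Y)) (hessian X (K Y)) (hessian (I X) (J Y)) (hessian (I X) (K Y))
  (hessian (J X) (I Y)) (hessian (K X) Y) (hessian (K X) (I Y)) (hessian (J X) Y).
move=> a1 a2 a3 a4 a5 a6 a7 a8; rewrite !(toCD, toCN, toCM).
apply/eqP; rewrite -subr_eq0; apply/eqP.
transitivity (- hf * hf * (iC M * iC M + 1) * (toC a4 - toC a7)); first by ring.
by rewrite iC2 addNr mulr0 mul0r.
Qed.

Lemma del_ddJ W : del I (ddJ I J phi) W = 0.
Proof.
have [fe Ie] := del_J_function_form.
exact: (del_del_one_form (quatII Q) cD tD DI fe Ie).
Qed.

End Hessian.

(** * Positivity *)

Section QuadraticForms.
Context {R : realType} {m : nat}.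
Implicit Types (G : 'I_m -> 'I_m -> R) (v : 'rV[R]_m).

Definition quadratic G v : R := \sum_i \sum_j v ord0 i * v ord0 j * G i j.

Lemma quadratic_scale G v (t : R) : quadratic G (t *: v) = t ^+ 2 * quadratic G v.
Proof.
rewrite /quadratic mulr_sumr; apply: eq_bigr => i _; rewrite mulr_sumr.
by apply: eq_bigr => j _; rewrite !mxE; ring.
Qed.

Lemma quadratic_continuous G : continuous (quadratic G).
Proof.
apply: continuous_big => [|i _]; first exact: add_continuous.
apply: continuous_big => [|j _]; first exact: add_continuous.
move=> v; apply: (@continuousM _ 'rV[R]_m (fun k => k ord0 i * k ord0 j)); last exact: cst_continuous.
apply: (@continuousM _ 'rV[R]_m (fun k => k ord0 i)); exact: (@coord_continuous R 1 m ord0 _ v).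
Qed.

(** The minimum of a positive definite form on the unit sphere bounds the
    perturbations that keep it positive. *)
Lemma posdef_stable G : (forall v, v != 0 -> 0 < quadratic G v) ->
  exists2 e : R, 0 < e & forall G', (forall i j, `|G' i j - G i j| < e) ->
    forall v, 0 <= quadratic G' v.
Proof.
move=> Gpos; pose S := [set v : 'rV[R]_m | `|v| = 1].
have [S0|S0] := pselect (S !=set0); last first.
  exists 1 => // G' _ v; have [->|v0] := eqVneq v 0.
    by rewrite /quadratic big1// => i _; rewrite big1// => j _; rewrite mxE mul0r mul0r.
  exfalso; apply: S0; exists (`|v|^-1 *: v); rewrite /S /= normrZ normfV normr_id mulVf//.
  by rewrite normr_eq0.
have cS : compact S.
  apply: bounded_closed_compact.
    by exists 1; split=> // x x1 v; rewrite /S /= => ->; exact: ltW.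
  rewrite (_ : S = (fun v : 'rV[R]_m => `|v|) @^-1` [set 1])//.
  by apply: preimage_closed => [v _|]; [exact: norm_continuous|exact: closed_eq].
have cq : {within S, continuous (quadratic G)}.
  by apply: continuous_subspaceT; exact: quadratic_continuous.
have [u uS umin] := EVT_min_rV S0 cS cq.
have u1 : `|u| = 1 by move: uS; rewrite inE.
have c0 : 0 < quadratic G u by apply: Gpos; rewrite -normr_eq0 u1 oner_neq0.
set c := quadratic G u in umin c0.
have m0 : 0 < m%:R * m%:R + 1 :> R by rewrite ltr_wpDl// mulr_ge0.
exists (c / (m%:R * m%:R + 1)) => [|G' GG v]; first exact: divr_gt0.
have [->|v0] := eqVneq v 0.
  by rewrite /quadratic big1// => i _; rewrite big1// => j _; rewrite mxE mul0r mul0r.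
have nv : `|v| != 0 by rewrite normr_eq0.
suff H (w : 'rV[R]_m) : `|w| = 1 -> 0 <= quadratic G' w.
  have -> : v = `|v| *: (`|v|^-1 *: v) by rewrite scalerA divff// scale1r.
  rewrite quadratic_scale mulr_ge0 ?sqr_ge0// H// normrZ normfV normr_id mulVf//.
move=> w1; have wS : w \in S by rewrite inE.
have := umin w wS; rewrite -[quadratic G' w](subrK (quadratic G w)).
have : `|quadratic G' w - quadratic G w| <= c.
  rewrite /quadratic -sumrB; under eq_bigr => i _ do rewrite -sumrB.
  apply: le_trans (ler_norm_sum _ _ _) _.
  apply: (@le_trans _ _ (\sum_(i < m) \sum_(j < m) c / (m%:R * m%:R + 1))).
    apply: ler_sum => i _; apply: le_trans (ler_norm_sum _ _ _) _.
    apply: ler_sum => j _; rewrite -mulrBr normrM normrM -[leRHS]mul1r.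
    have wi k : `|w ord0 k| <= 1 by rewrite -w1 rV_norm_ge.
    by rewrite ler_pM ?mulr_ge0 ?mulr_ile1// ltW.
  have sE (t : R) : \sum_(i < m) t = m%:R * t by rewrite sumr_const card_ord mulr_natl.
  rewrite !sE mulrA mulrCA ger_pMr//.
  by rewrite ler_pdivrMr// mul1r lerDl.
rewrite ler_norml => /andP[h1 _] h3.
by have := lerD h1 h3; rewrite addNr.
Qed.

End QuadraticForms.

Section Positivity.
Context {R : realType} {m : nat} (M : manifold R m).
Variable g : vfield M -> vfield M -> cinf M.
Hypothesis gl : forall (f : cinf M) X Y Z, g (f *: X + Y) Z = f * g X Z + g Y Z.
Hypothesis gC : forall X Y, g X Y = g Y X.
Implicit Types (f : cinf M) (X Y Z : vfield M) (p q : M).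

Let gD X Y Z : g (X + Y) Z = g X Z + g Y Z.
Proof. by have := gl 1 X Y Z; rewrite scale1r mul1r. Qed.
Let g0 Z : g 0 Z = 0.
Proof.
have := gD 0 0 Z; rewrite addr0 => /eqP.
by rewrite -subr_eq subrr eq_sym => /eqP.
Qed.
Let gZ f X Z : g (f *: X) Z = f * g X Z.
Proof. by have := gl f X 0 Z; rewrite addr0 g0 addr0. Qed.

Lemma symmetric_vanish X Y p : vat X p = 0 -> g X Y p = 0.
Proof.
apply: (tensor_vanish (G := fun X => g X Y p)) => [U V|f U fp].
  by rewrite gD.
by rewrite gZ cinfME fp mul0r.
Qed.

Lemma symmetric_sum (J : Type) (r : seq J) (a : J -> cinf M) (E : J -> vfield M) p :
  g (\sum_(i <- r) a i *: E i) (\sum_(i <- r) a i *: E i) p =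
  \sum_(i <- r) \sum_(j <- r) a i p * a j p * g (E i) (E j) p.
Proof.
have gs Z (b : J -> cinf M) : g (\sum_(i <- r) b i *: E i) Z p =
    \sum_(i <- r) b i p * g (E i) Z p.
  rewrite (big_morph (fun T => g T Z) (fun T T' => gD T T' Z) (g0 Z)) cinf_sumE.
  by apply: eq_bigr => i _; rewrite gZ.
rewrite gs; apply: eq_bigr => i _; rewrite gC gs mulr_sumr.
by apply: eq_bigr => j _; rewrite gC; ring.
Qed.

Definition nonnegative_at p := forall X, 0 <= g X X p.

(** Equality case of the Cauchy-Schwarz inequality: a null vector of a
    semidefinite form is in its kernel. *)
Lemma null_kernel p X Y : nonnegative_at p -> g X X p = 0 -> g X Y p = 0.
Proof.
move=> pos gX; apply: contrapT => /eqP gXY.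
have E (t : R) : g (cst_cinf M t *: X + Y) (cst_cinf M t *: X + Y) p =
    2 * t * g X Y p + g Y Y p.
  rewrite gl (gC X) (gC Y (_ + _)) !gl !cinfDE !cinfME !cst_cinfE !cinfDE !cinfME !cst_cinfE.
  by rewrite gX (gC Y X); ring.
(* This coefficient makes the value of the form equal to [-1]. *)
have := pos (cst_cinf M (- (g Y Y p + 1) / (2 * g X Y p)) *: X + Y).
rewrite E.
have -> : 2 * (- (g Y Y p + 1) / (2 * g X Y p)) * g X Y p = - (g Y Y p + 1) by field.
lra.
Qed.

Hypothesis nondegenerate : forall p X, (forall Y, g X Y p = 0) -> vat X p = 0.

Lemma nonnegative_definite p X : nonnegative_at p -> g X X p = 0 -> vat X p = 0.
Proof. by move=> pos gX; apply: nondegenerate => Y; exact: null_kernel. Qed.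

(** In a local frame [g] is a continuous family of matrices, positive definite
    at [p]. *)
Lemma nonnegative_open : open nonnegative_at.
Proof.
rewrite openE => p pos.
have [c [r [E [x [b [_ bp _ bX Ex]]]]]] := local_frame p.
pose G q (i j : 'I_m) := g (E (unit_rV i)) (E (unit_rV j)) q.
have Gpos (v : 'rV[R]_m) : v != 0 -> 0 < quadratic (G p) v.
  move=> v0; pose V := \sum_i cst_cinf M (v ord0 i) *: E (unit_rV i).
  have VE : g V V p = quadratic (G p) v.
    rewrite symmetric_sum; apply: eq_bigr => i _; apply: eq_bigr => j _.
    by rewrite !cst_cinfE.
  rewrite -VE lt_neqAle pos andbT eq_sym; apply: contra v0 => /eqP /nonnegative_definite V0.
  apply/eqP/rowP => j; rewrite mxE.
  have : V (x j) p = 0 by exact: (congr1 (fun w : tangent p => w (x j)) (V0 pos)).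
  rewrite vfield_sumE (bigD1 j)// vfield_scaleE Ex eqxx mulr1 big1 => [|i ij].
    by move=> h; apply: etrans h; exact: esym (addr0 _).
  by rewrite vfield_scaleE Ex (negbTE ij) mulr0.
have [e e0 Ge] := posdef_stable Gpos.
have ct (f : cinf M) (t : R) : 0 < t -> \forall q \near p, `|f q - f p| < t.
  move=> t0; have cf : (f : M -> R) @ p --> f p by exact: (smooth_continuous (cinfP f)).
  by move/cvgrPdist_lt: cf => /(_ t t0); apply: filterS => q; rewrite distrC.
have nG : \forall q \near p, forall i j, `|G q i j - G p i j| < e.
  by apply: filter_forall => i; apply: filter_forall => j; exact: ct.
have nb : \forall q \near p, b q != 0.
  apply: filterS (ct b 1 ltr01) => q; rewrite bp; apply: contraTneq => ->.
  by rewrite sub0r normrN normr1 ltxx.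
apply: filterS2 nG nb => q Gq bq X.
have : 0 <= g (b *: X) (b *: X) q.
  rewrite bX symmetric_sum.
  have := Ge _ Gq (\row_i X (x i) q); congr (0 <= _).
  by apply: eq_bigr => i _; apply: eq_bigr => j _; rewrite !mxE.
by rewrite gZ gC gZ !cinfME mulrA pmulr_rge0// -expr2 exprn_even_gt0.
Qed.

Lemma nonnegative_closed : closed nonnegative_at.
Proof.
rewrite (_ : nonnegative_at = \bigcap_(X in setT) (g X X : M -> R) @^-1` [set y | 0 <= y]).
  apply: closed_bigI => X _; apply: preimage_closed => [q _|]; last exact: closed_ge.
  exact: (smooth_continuous (cinfP (g X X))).
by apply/seteqP; split=> q H X; [move=> _; exact: H|exact: H].
Qed.

(** The index of a non-degenerate symmetric form on a connected manifold is
    constant. *)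
Lemma nonnegative_everywhere p0 : nonnegative_at p0 -> forall p, nonnegative_at p.
Proof. exact: (clopen_all nonnegative_open nonnegative_closed). Qed.

End Positivity.

Section HessianMinimum.
Context {R : realType} {m : nat} (M : manifold R m).
Variable D : vfield M -> vfield M -> vfield M.
Hypothesis cD : connection D.
Hypothesis tD : torsion_free D.

(** The Hessian is tensorial and all first derivatives vanish at [p], so it is
    the second derivative along a suitable field. *)
Lemma hessian_nonnegative (phi : cinf M) p : (forall q, phi p <= phi q) ->
  nonnegative_at (hessian D phi) p.
Proof.
move=> pmin X; have [Y [YX _ YY]] := hessian_at_min pmin X.
have crit (Z : vfield M) : Z phi p = 0.
  have [U [UZ U0 _]] := hessian_at_min pmin Z.
  by rewrite -U0; exact: (congr1 (fun w : tangent p => w phi) (esym UZ)).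
have vZ (U V : vfield M) : vat U p = vat V p -> vat (U - V) p = 0.
  move=> UV; apply: tangent_ext => h.
  have : U h p = V h p by exact: (congr1 (fun w : tangent p => w h) UV).
  have -> : vat (U - V) p h = U h p - V h p by [].
  by move=> ->; exact: subrr.
have h0 := symmetric_vanish (hessian_lin cD phi).
have XY := vZ _ _ YX.
have : hessian D phi X X p = hessian D phi Y Y p.
  have e1 : hessian D phi (Y - X) Y p = 0 by exact: h0.
  have e2 : hessian D phi (Y - X) X p = 0 by exact: h0.
  have E U : hessian D phi (Y - X) U p = hessian D phi Y U p - hessian D phi X U p.
    by rewrite addrC -scaleN1r (hessian_lin cD) mulN1r addrC.
  move: e1 e2; rewrite !E (hessianC tD phi X Y).
  by move=> /subr0_eq -> /subr0_eq ->.
move=> ->; rewrite /hessian cinfBE crit subr0; exact: YY.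
Qed.

End HessianMinimum.

(** * Ratios of forms of top degree *)

(** Local quotients are enough: the denominator [b] may vanish away from [p]. *)
Lemma smooth_quotient {R : realType} {m : nat} (M : manifold R m) (f : M -> R) :
  (forall p, exists a b : cinf M, b p != 0 /\ forall q, b q != 0 -> f q * b q = a q) ->
  smooth f.
Proof.
move=> H; apply: smooth_in_charts => p.
have [a [b [bp fab]]] := H p; have [c Mc cp] := matlas_cover p.
pose N := [set q | b q != 0].
have oN : open N.
  have -> : N = (b : M -> R) @^-1` [set y | y != 0] by [].
  apply: open_comp; last exact: open_neq.
  by move=> q _; exact: (smooth_continuous (cinfP b)).
exists c, (ccod c `&` cbwd c @^-1` N), ((a \o cbwd c) \* (fun x => ((b \o cbwd c) x)^-1)).
have oW := @chart_preimage_open _ _ _ c _ oN.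
split => //.
- by split; [exact: cfwd_cod|rewrite /N /= cfwdK].
- move=> k; apply: CkM => //; first by apply: Ck_sub (cinfP a Mc k) => x [].
  by apply: CkV => // [x []//|]; apply: Ck_sub (cinfP b Mc k) => x [].
- by move=> x [_ Nx] /=; rewrite -(fab _ Nx) mulfK.
Qed.

Section TopForms.
Context {R : realType} {m : nat} (M : manifold R m).
Variables (I J : {linear vfield M -> vfield M}).
Variables (k : nat) (beta : cform M k).
Hypothesis mk : m = (k + k)%N.
Hypothesis fbeta : is_form beta.
Hypothesis Ibeta : complex_linear I beta.
Hypothesis beta0 : nowhere_zero beta.
Implicit Types (X Y : vfield M).
Local Open Scope complex_scope.

Lemma nowhere_zero_cancel (u v : ccinf M) : (forall W, u * beta W = v * beta W) -> u = v.
Proof.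
move=> uv; apply: ccinf_ext => p; have [W Wp] := beta0 p.
by apply: (mulIf Wp); rewrite -!ccinfME uv.
Qed.

(** The ratio of the values on fixed arguments is independent of the arguments,
    which gives smoothness: near each point they can be kept fixed. *)
Lemma top_form_ratio (alpha : cform M k) : is_form alpha -> complex_linear I alpha ->
  exists h : ccinf M, forall W, alpha W = h * beta W.
Proof.
move=> fa Ia; have [e eP] := choice beta0.
pose h p : R[i] := alpha (e p) p / beta (e p) p.
have hE W p : alpha W p = h p * beta W p.
  apply: (mulIf (eP p)); rewrite (top_form_proportional mk fbeta Ibeta (eP p) W fa Ia) /h.
  by rewrite mulrAC divfK.
have key (z a b : R[i]) : z * b = a ->
    (complex.Re z * (complex.Re b * complex.Re b + complex.Im b * complex.Im b) =
      complex.Re (a * conjc b)) /\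
    (complex.Im z * (complex.Re b * complex.Re b + complex.Im b * complex.Im b) =
      complex.Im (a * conjc b)).
  by move=> <-; case: z b => [z1 z2] [b1 b2] /=; split; ring.
have sh : csmooth h.
  pose b p := re_cinf (beta (e p)) * re_cinf (beta (e p)) +
    im_cinf (beta (e p)) * im_cinf (beta (e p)).
  have bp p : b p p != 0.
    have := eP p; rewrite /b cinfDE !cinfME /=; case: (beta (e p) p) => x y.
    rewrite eq_complex /= negb_and => xy; rewrite -!expr2 paddr_eq0 ?sqr_ge0//.
    by rewrite !sqrf_eq0 negb_and.
  have bE p q : b p q = complex.Re (beta (e p) q) * complex.Re (beta (e p) q) +
    complex.Im (beta (e p) q) * complex.Im (beta (e p) q) by [].
  have reE (u v : ccinf M) q : re_cinf (u * conjC v) q = complex.Re (u q * conjc (v q)).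
    by rewrite -conjCE.
  have imE (u v : ccinf M) q : im_cinf (u * conjC v) q = complex.Im (u q * conjc (v q)).
    by rewrite -conjCE.
  split; apply: smooth_quotient => p.
    exists (re_cinf (alpha (e p) * conjC (beta (e p)))), (b p); split=> // q _.
    by rewrite bE reE; have [-> _] := key _ _ _ (esym (hE (e p) q)).
  exists (im_cinf (alpha (e p) * conjC (beta (e p)))), (b p); split=> // q _.
  by rewrite bE imE; have [_ ->] := key _ _ _ (esym (hE (e p) q)).
by exists (CCinf (asboolT sh)) => W; apply: ccinf_ext => p; exact: hE.
Qed.

Lemma real_ratio (alpha : cform M k) (h : ccinf M) : real_form J alpha -> real_form J beta ->
  (forall W, alpha W = h * beta W) -> h = toC (re_cinf h).
Proof.
move=> ra rb hE; have hc : conjC h = h.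
  apply: nowhere_zero_cancel => W; rewrite -hE -[RHS]ra.
  have -> : act_form J (conj_form alpha) W = conjC (alpha (fun i => J (W i))) by [].
  by rewrite hE conjCM; congr (_ * _); rewrite -[LHS]rb.
apply: ccinf_ext => p; have := congr1 (fun u : ccinf M => u p) hc.
rewrite conjCE toCE /=; case: (h p) => x y [] yy.
apply/eqP; rewrite eq_complex /= eqxx /=; apply/eqP; lra.
Qed.

End TopForms.

Section RealConnection.
Context {R : realType} {m : nat} (M : manifold R m).
Variables (J : {linear vfield M -> vfield M}) (D : vfield M -> vfield M -> vfield M).
Hypothesis DJ : forall X Y, D X (J Y) = J (D X Y).

(** The connection preserves [J], hence the real structure on forms. *)
Lemma nabla_real k (eta : cform M k) X : real_form J eta -> real_form J (nabla_form D X eta).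
Proof.
move=> re W.
have -> : act_form J (conj_form (nabla_form D X eta)) W =
    conjC (nabla_form D X eta (fun i => J (W i))) by [].
have r V : conjC (eta (fun i => J (V i))) = eta V := re V.
rewrite /nabla_form conjCD conjCN conjC_sum -vact_conj r; congr (_ - _).
apply: eq_bigr => i _; rewrite -[RHS]r; congr (conjC (eta _)); apply/funext => j /=.
by case: eqP => [_|//]; rewrite DJ.
Qed.

Lemma nabla_form_add k (a b : cform M k) X W :
  nabla_form D X (form_add a b) W = nabla_form D X a W + nabla_form D X b W.
Proof.
by rewrite /nabla_form /form_add vactD big_split /= opprD addrACA.
Qed.

End RealConnection.

Lemma complex_linear_hodge_type {R : realType} {m : nat} (M : manifold R m)
    (I : {linear vfield M -> vfield M}) k (eta : cform M k) :
  is_form eta -> complex_linear I eta -> hodge_type I k 0 eta.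
Proof.
move=> fe Ie; split=> [||X]; [exact: addn0|by []|].
by rewrite hodge_part_linear// eqxx.
Qed.

(** * Parallel forms of top degree *)

Section ParallelForms.
Context {R : realType} {m : nat} (M : manifold R m).
Variables (I J : {linear vfield M -> vfield M}) (D : vfield M -> vfield M -> vfield M).
Hypothesis II : forall X : vfield M, I (I X) = - X.
Hypothesis cD : connection D.
Hypothesis tD : torsion_free D.
Hypothesis DI : forall X Y, D X (I Y) = I (D X Y).
Hypothesis DJ : forall X Y, D X (J Y) = J (D X Y).
Variable k : nat.
Implicit Types (X Y : vfield M).
Local Open Scope complex_scope.

(** The connection form of a real trivialization is real, so real and imaginary
    parts of the coefficient of [Phi], and their real combinations, solve the
    same linear equation; a solution that is positive at one point never
    vanishes. *)
Lemma positive_parallel_multiple (beta Phi : cform M k) : m = (k + k)%N ->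
  is_form beta -> complex_linear I beta -> real_form J beta -> nowhere_zero beta ->
  is_form Phi -> complex_linear I Phi -> parallel_form D Phi -> (exists W, Phi W <> 0) ->
  exists2 f : cinf M, (forall p, 0 < f p) & parallel_form D (fun W => toC f * beta W).
Proof.
move=> mk fb Ib rb b0 fP IP parP [W0 P0].
have [h hE] := top_form_ratio mk fb Ib b0 fP IP.
have [th thE] : exists th : vfield M -> cinf M,
    forall X W, nabla_form D X beta W = toC (th X) * beta W.
  have H X : exists t : cinf M, forall W, nabla_form D X beta W = toC t * beta W.
    have [t tE] := top_form_ratio mk fb Ib b0 (nabla_is_form cD fb X)
      (nabla_complex_linear X DI Ib).
    exists (re_cinf t) => W.
    by rewrite tE {1}(real_ratio b0 (nabla_real DJ X rb) rb tE).
  by have [th thE] := choice H; exists th.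
have Xh X : vact X h = - toC (th X) * h.
  apply: (nowhere_zero_cancel b0) => W; have := parP X W.
  have -> : Phi = (fun V => h * beta V) by apply/funext.
  rewrite nabla_scale thE => /eqP; rewrite addr_eq0 => /eqP ->; ring.
have reX X : X (re_cinf h) = - th X * re_cinf h.
  have -> : X (re_cinf h) = re_cinf (vact X h) by apply: cinf_ext.
  rewrite Xh; apply: cinf_ext => p.
  have -> : re_cinf (- toC (th X) * h) p = complex.Re ((- (th X p)%:C) * h p) by [].
  have -> : (- th X * re_cinf h) p = - th X p * complex.Re (h p) by [].
  by case: (h p) => x y /=; ring.
have imX X : X (im_cinf h) = - th X * im_cinf h.
  have -> : X (im_cinf h) = im_cinf (vact X h) by apply: cinf_ext.
  rewrite Xh; apply: cinf_ext => p.
  have -> : im_cinf (- toC (th X) * h) p = complex.Im ((- (th X p)%:C) * h p) by [].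
  have -> : (- th X * im_cinf h) p = - th X p * complex.Im (h p) by [].
  by case: (h p) => x y /=; ring.
have [p0 hp0] : exists p0, h p0 != 0.
  apply: contrapT => H; apply: P0; apply: ccinf_ext => p; rewrite hE ccinfME.
  have -> : h p = 0 by apply: contrapT => /eqP hp; apply: H; exists p.
  by rewrite mul0r.
pose x := complex.Re (h p0); pose y := complex.Im (h p0).
have lin a b X : X (cst_cinf M a * re_cinf h + cst_cinf M b * im_cinf h) =
    - th X * (cst_cinf M a * re_cinf h + cst_cinf M b * im_cinf h).
  by rewrite vfieldD !vfieldZ reX imX; ring.
have linE a b p : (cst_cinf M a * re_cinf h + cst_cinf M b * im_cinf h) p =
  a * complex.Re (h p) + b * complex.Im (h p) by [].
(* The real part of [conj (h p0) * h]. *)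
pose f := cst_cinf M x * re_cinf h + cst_cinf M y * im_cinf h.
have fp0 : 0 < f p0.
  rewrite /f linE -/x -/y -!expr2 lt0r addr_ge0 ?sqr_ge0// andbT.
  rewrite paddr_eq0 ?sqr_ge0// !sqrf_eq0.
  by move: hp0; rewrite /x /y; case: (h p0) => u v; rewrite eq_complex.
have f0 p : f p != 0.
  apply/eqP => fp; have := linear_transport_unique (lin x y) fp p0 => fp0'.
  by move: fp0; rewrite [f p0]fp0' ltxx.
exists f => [p|X W]; last first.
  rewrite nabla_scale vact_toC lin toCM toCN thE -/f; ring.
have cf : continuous (f : M -> R) by exact: (smooth_continuous (cinfP f)).
apply: (@clopen_all _ _ M (fun p => 0 < f p) p0) => //.
  rewrite (_ : (fun p => _) = (f : M -> R) @^-1` [set t | 0 < t])//.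
  by apply: open_comp; [move=> q _; exact: cf|exact: open_gt].
rewrite (_ : (fun p => _ : Prop) = (f : M -> R) @^-1` [set t | 0 <= t]).
  by apply: preimage_closed => [q _|]; [exact: cf|exact: closed_ge].
by apply/funext => q; rewrite /= le_eqVlt eq_sym (negbTE (f0 q)).
Qed.

Lemma parallel_scale (eta : cform M k) (a : R) : parallel_form D eta ->
  parallel_form D (fun W => toC (cst_cinf M a) * eta W).
Proof.
by move=> H X W; rewrite nabla_scale H mulr0 vact_toC vfield_cst toC0 mul0r addr0.
Qed.

Lemma parallel_delbar (eta : cform M k) : is_form eta -> complex_linear I eta ->
  parallel_form D eta -> forall W, delbar I eta W = 0.
Proof.
move=> fe Ie pe W; rewrite (delbar_nabla II cD tD DI fe Ie) big1// => i _.
by rewrite /insert_dir /nabla01 !pe mulr0 addr0 !mulr0.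
Qed.

(** A real function [f] such that [f *: Psi] is holomorphic, [Psi] parallel, has
    vanishing (0,1)-derivative: comparing the arguments [X] and [I X] in the first
    slot isolates the term differentiating in the direction [X]. *)
Lemma holomorphic_multiple_parallel (Psi : cform M k) (f : cinf M) :
  is_form Psi -> complex_linear I Psi -> nowhere_zero Psi -> parallel_form D Psi ->
  (forall W, delbar I (fun V => toC f * Psi V) W = 0) ->
  parallel_form D (fun V => toC f * Psi V).
Proof.
move=> fP IP P0 pP dP.
pose al : cform M k := fun V => toC f * Psi V.
have fal : is_form al.
  split=> [W i u Y Z|W i j ij Wij]; first by rewrite /al (proj1 fP); ring.
  by rewrite /al (form_alt fP ij Wij) mulr0.
have Ial : complex_linear I al by move=> W i Y; rewrite /al IP; ring.
have nal X W : nabla_form D X al W = toC (X f) * Psi W.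
  by rewrite nabla_scale pP mulr0 addr0 vact_toC.
pose df X := toC (Defs.half) * (toC (X f) + iC M * toC (I X f)).
have n01 X W : nabla01 I D al X W = df X * Psi W.
  by rewrite /nabla01 !nal /df; ring.
have dfI X : df (I X) = - iC M * df X by
  rewrite -[df X]mulr1 /df II;
  have -> : (- X) f = - X f by [];
  rewrite toCN mulr1; apply/eqP; rewrite -subr_eq0; apply/eqP;
  transitivity (toC Defs.half * (iC M * iC M + 1) * toC (I X f));
  [ring|rewrite iC2 addNr mulr0 mul0r].
have key (a r : ccinf M) : a + r = 0 -> - iC M * a + iC M * r = 0 -> a = 0.
  move=> e1 e2.
  transitivity (toC Defs.half * (a + r + iC M * (- iC M * a + iC M * r))); last first.
    by rewrite e1 e2 mulr0 addr0 mulr0.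
  apply/eqP; rewrite -subr_eq0; apply/eqP.
  transitivity ((1 - (toC Defs.half + toC Defs.half)) * a -
    toC Defs.half * (iC M * iC M + 1) * (r - a)); first by ring.
  by rewrite toC_half subrr mul0r iC2 addNr mulr0 mul0r subrr.
have df0 X : df X = 0.
  apply: (nowhere_zero_cancel P0) => V; rewrite mul0r.
  pose W Y : 'I_k.+1 -> vfield M := fun i => if unlift ord0 i is Some j then V j else Y.
  pose rest Y := \sum_(j < k) (-1) ^+ (lift ord0 j) * insert_dir (nabla01 I D al) (lift ord0 j) (W Y).
  have dW Y : delbar I al (W Y) = df Y * Psi V + rest Y.
    rewrite (delbar_nabla II cD tD DI fal Ial) big_ord_recl expr0 mul1r; congr (_ + _).
    rewrite /insert_dir n01 /W unlift_none; congr (_ * Psi _).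
    by apply/funext => j; rewrite liftK.
  have restI Y : rest (I Y) = iC M * rest Y.
    rewrite /rest mulr_sumr; apply: eq_bigr => j _; rewrite [RHS]mulrCA; congr (_ * _).
    have ne : lift ord0 j != ord0 :> 'I_k.+1 by rewrite eq_sym neq_lift.
    have [l el _] := unlift_some ne.
    have E Z : insert_dir (nabla01 I D al) (lift ord0 j) (W Z) =
        nabla01 I D al (V j) [eta (fun l' => W 0 (lift (lift ord0 j) l')) with l |-> Z].
      rewrite /insert_dir {1}/W liftK; congr (nabla01 _ _ _ _ _); apply/funext => l' /=.
      rewrite /W; case: unliftP => [j' e|e].
        have /negbTE -> // : l' != l.
        by apply/eqP => ll; move: e; rewrite ll -el => /eqP; rewrite (negbTE (neq_lift _ _)).
      have -> : l' = l by apply: (@lift_inj _ (lift ord0 j)); rewrite e -el.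
      by rewrite eqxx.
    by rewrite !E (proj2 (nabla01_form cD DI fal Ial (V j))).
  have := dP (W (I X)); rewrite [delbar _ _ _]dW restI dfI -mulrA => e2.
  have := dP (W X); rewrite [delbar _ _ _]dW => e1.
  exact: key e1 e2.
have Xf X : X f = 0.
  apply: cinf_ext => p; have : complex.Re (df X p) = 0 by rewrite df0.
  have -> : complex.Re (df X p) = 2^-1 * X f p.
    rewrite /df ccinfME ccinfDE ccinfME !toCE iCE cst_cinfE /=; ring.
  by move=> /= /eqP; rewrite mulf_eq0 invr_eq0 pnatr_eq0 /= => /eqP.
move=> X W; rewrite nabla_scale pP mulr0 addr0 vact_toC.
by rewrite Xf toC0 mul0r.
Qed.

End ParallelForms.

(** * The Calabi-Yau metric *)

Section HKT.
Context {R : realType} {m : nat} (M : manifold R m).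
Variables (I J K : {linear vfield M -> vfield M}) (D : vfield M -> vfield M -> vfield M).
Hypothesis Q : forall X : vfield M,
  [/\ I (I X) = - X, J (J X) = - X, K (K X) = - X & I (J (K X)) = - X].
Implicit Types (X Y : vfield M) (g h : vfield M -> vfield M -> cinf M).

Lemma hermitian_symmetric g : quaternionic_hermitian I J K g -> quaternionic_symmetric I J K g.
Proof. by move=> [[gl gC _] gq]; split. Qed.

Lemma quaternionic_symmetricD g h : quaternionic_symmetric I J K g ->
  quaternionic_symmetric I J K h -> quaternionic_symmetric I J K (fun X Y => g X Y + h X Y).
Proof.
move=> [gl gC gq] [hl hC hq]; split=> [f X Y Z|X Y|X Y].
- by rewrite gl hl; ring.
- by rewrite gC hC.
- by have [-> -> ->] := gq X Y; have [-> -> ->] := hq X Y.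
Qed.

Lemma Omega_ofD g h W : Omega_of J K (fun X Y => g X Y + h X Y) W =
  Omega_of J K g W + Omega_of J K h W.
Proof. by rewrite /Omega_of !mk_ccinfE !toCD; ring. Qed.

Lemma delD k (a b : cform M k) W : connection D -> torsion_free D ->
  (forall X Y, D X (I Y) = I (D X Y)) ->
  is_form a -> is_form b -> complex_linear I a -> complex_linear I b ->
  del I (form_add a b) W = del I a W + del I b W.
Proof.
move=> cD tD DI fa fb Ia Ib.
have fab : is_form (form_add a b).
  split=> [V i u Y Z|V i j ij Vij]; rewrite /form_add; first by rewrite (proj1 fa) (proj1 fb); ring.
  by rewrite (form_alt fa ij Vij) (form_alt fb ij Vij) addr0.
have Iab : complex_linear I (form_add a b).
  by move=> V i Y; rewrite /form_add Ia Ib; ring.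
have II := quatII Q.
rewrite !(del_nabla II cD tD DI)// -big_split; apply: eq_bigr => i _ /=.
by rewrite /insert_dir /nabla10 !nabla_form_add; ring.
Qed.

End HKT.

Section Main.
Context {R : realType} {n : nat} (M : manifold R (4 * n)).
Variables (I J K : {linear vfield M -> vfield M}) (D : vfield M -> vfield M -> vfield M).
Hypothesis Q : forall X : vfield M,
  [/\ I (I X) = - X, J (J X) = - X, K (K X) = - X & I (J (K X)) = - X].
Hypothesis oD : obata I J K D.
Hypothesis M_compact : compact [set: M].

Lemma hermitian_power_nonzero g : quaternionic_hermitian I J K g ->
  nowhere_zero (wedge_pow (Omega_of J K g) n).
Proof.
move=> hg p; apply: (power_nonzero Q (hermitian_symmetric hg)) => X.
by have [[_ _ gp] _] := hg; have [] := gp X p.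
Qed.

(** At a minimum of [phi] the perturbation by the averaged Hessian is
    nonnegative, and a form with non-degenerate top power cannot lose positivity
    anywhere else. *)
Lemma hermitian_perturbation g phi : quaternionic_hermitian I J K g ->
  nowhere_zero (wedge_pow (Omega_of J K (fun X Y => g X Y + qhessian I J K D phi X Y)) n) ->
  quaternionic_hermitian I J K (fun X Y => g X Y + qhessian I J K D phi X Y).
Proof.
move=> hg nz; have [cD tD _] := oD.
have qg1 := quaternionic_symmetricD (hermitian_symmetric hg) (qhessian_symmetric Q cD tD phi).
set g1 := fun X Y => _ in nz qg1 *.
have [g1l g1C g1q] := qg1; split=> //; split=> // X p.
have nd q Y : (forall Z, g1 Y Z q = 0) -> vat Y q = 0.
  by have [e ep] := nz q; exact: (power_nondegenerate Q qg1 ep).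
have [p0 _ p0min] : exists2 p0, p0 \in [set: M] & forall q, q \in [set: M] -> phi p0 <= phi q.
  apply: compact_EVT_min => //; first exact: mnonempty.
  by apply: continuous_subspaceT; exact: (smooth_continuous (cinfP phi)).
have pos0 : nonnegative_at g1 p0.
  move=> Y; have [[_ _ gp] _] := hg; have [gY _] := gp Y p0.
  have H Z : 0 <= hessian D phi Z Z p0.
    by apply: (hessian_nonnegative cD tD) => q; apply: p0min; rewrite inE.
  rewrite /g1 cinfDE addr_ge0// /qhessian cinfME mulr_ge0//.
    by rewrite cinfME mulr_ge0// cst_cinfE invr_ge0.
  have sum_ge0 (a b c d : cinf M) : 0 <= a p0 -> 0 <= b p0 -> 0 <= c p0 -> 0 <= d p0 ->
      0 <= (a + b + c + d) p0 by move=> *; rewrite !cinfDE !addr_ge0.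
  by apply: sum_ge0; exact: H.
have pos := nonnegative_everywhere g1l g1C nd pos0.
by split; [exact: pos|exact: (nonnegative_definite g1l g1C nd (pos p))].
Qed.

End Main.

Theorem proposition4p2 (R : realType) (n : nat) (M : manifold R (4 * n))
    (I J K : {linear vfield M -> vfield M}) (Omega : cform M 2)
    (nabla : vfield M -> vfield M -> vfield M) (Phi : cform M n.*2)
    (M_compact : compact [set: M])
    (IJK_hypercomplex : hypercomplex I J K)
    (Omega_HKT : HKT_form I J K Omega)
    (nabla_obata : obata I J K nabla)
    (hol_SL : forall (p : M) (A : tangent p -> tangent p),
       holonomy nabla A -> SLH I J K A)
    (Phi_canonical : hodge_type I n.*2 0 Phi)
    (Phi_nonzero : exists X, Phi X <> 0)
    (Phi_parallel : parallel_form nabla Phi)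
    (CY : quaternionic_Calabi_Yau I J Omega n) :
  (exists phi : cinf M,
     let Omega1 := form_add Omega (ddJ I J phi) in
     HKT_form I J K Omega1 /\
     holomorphic_volume_form I (wedge_pow Omega1 n)) /\
  (forall phi : cinf M,
     let Omega1 := form_add Omega (ddJ I J phi) in
     HKT_form I J K Omega1 ->
     holomorphic_volume_form I (wedge_pow Omega1 n) ->
     parallel_form nabla (wedge_pow Omega1 n)).
Proof.
have [_ _ _ Q] := IJK_hypercomplex; have II := quatII Q.
have [cD tD DIJK] := nabla_obata.
have DI X Y : nabla X (I Y) = I (nabla X Y) by have [] := DIJK X Y.
have DJ X Y : nabla X (J Y) = J (nabla X Y) by have [] := DIJK X Y.
have DK X Y : nabla X (K Y) = K (nabla X Y) by have [] := DIJK X Y.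
have mk : (4 * n = n.*2 + n.*2)%N by lia.
have power h : quaternionic_symmetric I J K h ->
    [/\ is_form (wedge_pow (Omega_of J K h) n), complex_linear I (wedge_pow (Omega_of J K h) n)
      & real_form J (wedge_pow (Omega_of J K h) n)].
  move=> qh; split.
  - exact/wedge_pow_is_form/(Omega_is_form Q qh).
  - exact/wedge_pow_complex_linear/(Omega_complex_linear Q qh).
  - exact/wedge_pow_real/(Omega_real Q qh).
have [g [hg OE dO]] := Omega_HKT.
have {OE}OE : Omega = Omega_of J K g by apply/funext.
have [fO IO rO] := power _ (hermitian_symmetric hg).
have nzO := hermitian_power_nonzero Q hg.
have [f f0 parPsi] : exists2 f : cinf M, (forall p, 0 < f p) &
    parallel_form nabla (fun W => toC f * wedge_pow (Omega_of J K g) n W).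
  apply: (positive_parallel_multiple cD DI DJ mk fO IO rO nzO _ _ Phi_parallel Phi_nonzero).
    by case: Phi_canonical.
  exact: (hodge_type_linear II Phi_canonical).
set Psi : cform M n.*2 := (fun W => _) in parPsi.
have fPsi : is_form Psi.
  split=> [W i u Y Z|W i j ij Wij]; first by rewrite /Psi (proj1 fO); ring.
  by rewrite /Psi (form_alt fO ij Wij) mulr0.
have IPsi : complex_linear I Psi by move=> W i Y; rewrite /Psi IO; ring.
have rPsi : real_form J Psi.
  move=> W; rewrite [LHS](_ : _ = conjC (Psi (fun i => J (W i))))// /Psi conjCM conjC_toC.
  by congr (_ * _); exact: rO.
have nzPsi : nowhere_zero Psi.
  move=> p; have [W Wp] := nzO p; exists W; rewrite /Psi ccinfME mulf_neq0// toCE.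
  by rewrite eq_complex /= eqxx andbT gt_eqF.
split; last first.
  move=> phi Omega1 [g1 [hg1 O1E dO1]] [_ nz1 db1].
  have {}O1E : Omega1 = Omega_of J K g1 by apply/funext.
  have [f1 I1 r1] := power _ (hermitian_symmetric hg1); rewrite -O1E in f1 I1 r1.
  have [h hE] := top_form_ratio mk fPsi IPsi nzPsi f1 I1.
  have hr := real_ratio nzPsi r1 rPsi hE.
  have E : wedge_pow Omega1 n = (fun W => toC (re_cinf h) * Psi W).
    by apply/funext => W; rewrite -hr hE.
  rewrite E; apply: (holomorphic_multiple_parallel II cD tD DI) => // W.
  by rewrite -E db1.
have PsiO : positive Omega Psi by exists f => // W; rewrite /Psi OE.
have [A [phi [A0 PsiE]]] := CY Psi (complex_linear_hodge_type fPsi IPsi) nzPsi rPsi PsiO.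
exists phi => Omega1.
pose g1 X Y := g X Y + qhessian I J K nabla phi X Y.
have qh := qhessian_symmetric Q cD tD phi.
have qg1 : quaternionic_symmetric I J K g1 := quaternionic_symmetricD (hermitian_symmetric hg) qh.
have O1E : Omega1 = Omega_of J K g1.
  apply/funext => W; rewrite Omega_ofD /Omega1 /form_add OE.
  by rewrite (ddJ_qhessian Q cD tD DI DJ DK).
have [f1 I1 _] := power _ qg1; rewrite -O1E in f1 I1.
have powE : wedge_pow Omega1 n = (fun W => toC (cst_cinf M A^-1) * Psi W).
  apply/funext => W; rewrite PsiE mulrA -toCM.
  have -> : cst_cinf M A^-1 * cst_cinf M A = 1.
    by apply: cinf_ext => p; rewrite cinfME !cst_cinfE mulVf// gt_eqF.
  by rewrite toC1 mul1r.
have nz1 : nowhere_zero (wedge_pow Omega1 n).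
  move=> p; have [W Wp] := nzPsi p; exists W; rewrite powE ccinfME mulf_neq0// toCE cst_cinfE.
  by rewrite eq_complex /= eqxx andbT invr_eq0 gt_eqF.
split.
  exists g1; split=> [|W|W].
  - by apply: (hermitian_perturbation Q nabla_obata M_compact hg); rewrite -O1E.
  - by rewrite O1E.
  - rewrite /Omega1 (delD Q W cD tD DI) ?dO.
    + by rewrite (del_ddJ Q cD tD DI) addr0.
    + by rewrite OE; exact: (Omega_is_form Q (hermitian_symmetric hg)).
    + have -> : ddJ I J phi = Omega_of J K (qhessian I J K nabla phi).
        by apply/funext => V; exact: (ddJ_qhessian Q cD tD DI DJ DK).
      exact: (Omega_is_form Q qh).
    + by rewrite OE; exact: (Omega_complex_linear Q (hermitian_symmetric hg)).
    + have -> : ddJ I J phi = Omega_of J K (qhessian I J K nabla phi).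
        by apply/funext => V; exact: (ddJ_qhessian Q cD tD DI DJ DK).
      exact: (Omega_complex_linear Q qh).
split=> //; first exact: complex_linear_hodge_type.
by apply: (parallel_delbar II cD tD DI f1 I1); rewrite powE; exact: parallel_scale.
Qed.
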